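(* Let $p\in\mathbb{C}[z_1,z_2]$ be scattering stable with $\tilde p(0,0)=0$, and let $f=\frac{p+\tilde p}{p-\tilde p}$. If $p$ is $\mathbb{T}^2$-saturated and $p-\tilde p$ is irreducible, then $f$ is an extreme point of $PRP_2$.
   Context: $\mathbb{D}$ is the open unit disk, $\mathbb{T}$ the unit circle. $PRP_2$ is the convex set of holomorphic functions $f:\mathbb{D}^2\to\{w\in\mathbb{C}:\operatorname{Re}w>0\}$ with $f(0,0)=1$. For $p\in\mathbb{C}[z_1,z_2]$ of bidegree $n=(n_1,n_2)$ (degree $n_j$ in $z_j$), the reflection is $\tilde p(z)=z_1^{n_1}z_2^{n_2}\overline{p(1/\bar z_1,1/\bar z_2)}$. $p$ is scattering stable if $p$ has no zeros in $\mathbb{D}^2$ and $p,\tilde p$ have no nonconstant common factor. A scattering stable $p$ of bidegree $(n_1,n_2)$ is $\mathbb{T}^2$-saturated if $p$ and $\tilde p$ have $2n_1n_2$ common zeros on $\mathbb{T}^2$, counted with intersection multiplicity, i.e. $\sum_{\zeta\in\mathbb{T}^2}I_\zeta(p,\tilde p)=2n_1n_2$, where $I_\zeta(p,q)=\dim_{\mathbb{C}}\mathcal{O}_\zeta/(p,q)\mathcal{O}_\zeta$ and $\mathcal{O}_\zeta$ is the ring of rational functions with denominators nonvanishing at $\zeta$. *)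

(* Defs.v *)
From mathcomp Require Export all_boot all_order all_algebra.
From mathcomp Require Export all_classical all_reals all_analysis.
From mathcomp Require Export complex.

Set Implicit Arguments.
Unset Strict Implicit.
Unset Printing Implicit Defensive.

Import Order.TTheory GRing.Theory Num.Theory numFieldNormedType.Exports.

Local Open Scope classical_set_scope.
Local Open Scope ring_scope.

(* Polynomials in z1, z2 over a ring K are elements of {poly {poly K}} with the
   convention of polyXY: z1 is the outer variable 'X, z2 is the inner variable
   'Y, and p.[x, y] is the value of p at z1 = x, z2 = y. *)

Section Bivariate.
Variable K : idomainType.
Implicit Types p q : {poly {poly K}}.

Definition deg1 p : nat := (size p).-1.
Definition deg2 p : nat := (sizeY p).-1.

Definition constant_poly p := exists c : K, p = c%:P%:P.

Definition no_common_factor p q :=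
  forall r, (exists a, p = a * r) -> (exists b, q = b * r) -> constant_poly r.

End Bivariate.

Definition irreducible_elt (A : idomainType) (p : A) :=
  [/\ p != 0, p \isn't a GRing.unit &
      forall a b : A, p = a * b -> a \is a GRing.unit \/ b \is a GRing.unit].

Local Notation "x %:F" := (tofrac x).

Section LocalRing.
Variables (K : fieldType) (zeta : K * K).
Local Notation F := {fraction {poly {poly K}}}.

Definition local_ring : set F :=
  [set x | exists a b : {poly {poly K}},
     b.[zeta.1, zeta.2] != 0 /\ x = a%:F / b%:F].

Definition local_ideal (p q : {poly {poly K}}) : set F :=
  [set x | exists u v : F,
     [/\ local_ring u, local_ring v & x = u * p%:F + v * q%:F]].

(* The classes of e_0, ..., e_(d-1) form a K-basis of the quotient of
   local_ring by local_ideal p q. *)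
Definition local_quotient_basis (p q : {poly {poly K}}) (d : nat)
    (e : 'I_d -> F) :=
  [/\ forall i, local_ring (e i),
      forall x, local_ring x -> exists c : 'I_d -> K,
        local_ideal p q (x - \sum_(i < d) (c i)%:P%:P%:F * e i) &
      forall c : 'I_d -> K,
        local_ideal p q (\sum_(i < d) (c i)%:P%:P%:F * e i) ->
        forall i, c i = 0].

End LocalRing.

(* The dimension of the quotient, with value +oo when there is no finite basis
   (the set below is a singleton or empty). *)
Definition intersection_multiplicity (R : realType) (K : fieldType)
    (zeta : K * K) (p q : {poly {poly K}}) : \bar R :=
  ereal_inf [set (d%:R)%:E | d in
    [set d : nat | exists e : 'I_d -> {fraction {poly {poly K}}},
       local_quotient_basis zeta p q e]].

Section Complex.
Variable R : realType.
Local Notation C := R[i].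
Implicit Types p : {poly {poly C}}.

Definition bidisk : set (C * C) := [set z | `|z.1| < 1 /\ `|z.2| < 1].
Definition torus : set (C * C) := [set z | `|z.1| = 1 /\ `|z.2| = 1].

(* If p is the sum of a_(i,j) z1^i z2^j, the reflection has coefficients
   conj a_(n1-i,n2-j); see reflectionE for the usual formula. *)
Definition reflection p : {poly {poly C}} :=
  \poly_(i < (deg1 p).+1) \poly_(j < (deg2 p).+1)
    ((p`_(deg1 p - i))`_(deg2 p - j))^*.

Lemma reflectionE p (z1 z2 : C) : z1 != 0 -> z2 != 0 ->
  (reflection p).[z1, z2] =
    z1 ^+ deg1 p * z2 ^+ deg2 p * (p.[(z1^*)^-1, (z2^*)^-1])^*.
Proof.
move=> z10 z20.
have shuffle (c a x b y : C) : c * (b * y) * (a * x) = x * y * (c * b * a).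
  by rewrite [c * _]mulrA mulrACA mulrC [y * x]mulrC.
have conj_pow (x : C) n k : x != 0 -> (k <= n)%N ->
    (((x^*)^-1 ^+ k)^*) * x ^+ n = x ^+ (n - k).
  move=> x0 kn; rewrite rmorphXn fmorphV /= conjCK -{1}(subnK kn) exprD.
  by rewrite mulrC -mulrA -exprMn divff // expr1n mulr1.
have coefs (x y : C) : p.[x, y] =
    \sum_(i < (deg1 p).+1) \sum_(j < (deg2 p).+1) p`_i`_j * y ^+ j * x ^+ i.
  rewrite (@horner_coef_wide _ (deg1 p).+1 p) ?leqSpred // horner_sum.
  apply: eq_bigr => i _; rewrite hornerM -polyC_exp hornerC -mulr_suml.
  rewrite (@horner_coef_wide _ (deg2 p).+1) //.
  exact: leq_trans (max_size_coefXY _ _) (leqSpred _).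
rewrite coefs horner_poly horner_sum rmorph_sum mulr_sumr.
rewrite [RHS](reindex_inj rev_ord_inj); apply: eq_bigr => i _.
rewrite hornerM -polyC_exp hornerC horner_poly rmorph_sum mulr_sumr mulr_suml.
rewrite [RHS](reindex_inj rev_ord_inj); apply: eq_bigr => j _.
rewrite /= !subSS !rmorphM.
have iE : z1 ^+ i = z1 ^+ (deg1 p - (deg1 p - i)) by rewrite subKn // -ltnS.
have jE : z2 ^+ j = z2 ^+ (deg2 p - (deg2 p - j)) by rewrite subKn // -ltnS.
rewrite iE jE -(conj_pow z1 _ _ z10 (leq_subr i _)).
rewrite -(conj_pow z2 _ _ z20 (leq_subr j _)) /=.
exact: shuffle.
Qed.

Definition scattering_stable p :=
  (forall z, bidisk z -> p.[z.1, z.2] != 0) /\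
  no_common_factor p (reflection p).

Definition torus_saturated p :=
  (\esum_(zeta in torus) intersection_multiplicity R zeta p (reflection p)
   = ((2 * deg1 p * deg2 p)%N%:R)%:E)%E.

(* Functions on the bidisk are represented by total functions on C^2, whose
   values outside the bidisk are irrelevant. Holomorphic means complex
   (Frechet) differentiable, as the base field of the normed spaces is C. *)
Definition PRP2 (f : C * C -> C) :=
  [/\ forall z, bidisk z ->
        differentiable (f : C^o * C^o -> C^o) (z : C^o * C^o),
      forall z, bidisk z -> 0 < complex.Re (f z) &
      f (0, 0) = 1].

Definition extreme_point_PRP2 (f : C * C -> C) :=
  PRP2 f /\
  forall (g h : C * C -> C) (t : R), PRP2 g -> PRP2 h -> 0 < t < 1 ->
    (forall z, bidisk z -> f z = t%:C%C * g z + (1 - t)%:C%C * h z) ->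
    forall z, bidisk z -> g z = f z /\ h z = f z.

End Complex.

(* Main.v *)
Require Import Defs.
From mathcomp Require Import ring lra zify.

(* Let C = R[i], q = p - p~ and f = t g + (1 - t) h in PRP_2.  Since t Re g <= Re f
   and |q|^2 Re f = |p|^2 - |p~|^2 vanishes on the torus, the Fourier coefficients of
   q g outside the box [0, n1] x [0, n2] vanish: q g, hence D = q (g - f), is a
   polynomial of bidegree at most (n1, n2), with D(0, 0) = 0 and
   Re ((p + p~ +- t D) / q) >= 0 on the bidisc.  For b on the circle, q(., b) has all
   its zeros on the circle, and approaching a simple zero a inside two sectors gives
   |D(a, b)| <= (4 / t) |p(a, b)|.

   Let N(E)(y) be the resultant of E and q with respect to z1, a polynomial of degree
   at most 2 n1 n2.  For every constant c the last bound makes N(D - c p) dominated by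
   a multiple of N(p) on the circle.  The sum of the intersection multiplicities over
   the torus is at most the number of zeros of N(p) on the circle, so saturation puts
   all 2 n1 n2 zeros of N(p) there; hence N(p) divides N(D - c p) and the quotient is
   constant.  If c is chosen such that D - c p vanishes at a zero of q at which p does
   not, then N(D - c p) = 0, the irreducible q divides D - c p, and D = c p~ by degrees.
   Finally Re (c p~ / q) = 0 on the torus gives conj c p = c p~, so c = 0 and g = f. *)

Set Implicit Arguments.
Unset Strict Implicit.
Unset Printing Implicit Defensive.

Import Order.TTheory GRing.Theory Num.Theory numFieldNormedType.Exports.
Local Open Scope ring_scope.

(** Cauchy's formula for these means is derived from complex differentiability alone, with an error
    that is uniform in the evaluation point; as the bidegree is fixed, interpolation then turns
    approximation into equality. Replacing p~ by q keeps the ideal (p, p~) and gains a polynomial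
    that is its own reflection up to sign. Since p~(0, 0) = 0, the top coefficient of p vanishes and
    q has exact bidegree (n1, n2). Irreducibility keeps every slice q(., b) nonzero, makes q divide
    E when N(E) = 0, and hence makes N(q') nonzero for the z1-derivative q' of q. The bound at the
    zeros of q requires simple zeros, so the slices with N(q')(b) = 0 are lost; they are recovered
    by multiplying the inequality by N(q') and cancelling this factor on the circle. With D alone
    one would only learn that N(D) is a constant multiple of N(p); the shift by c p makes this
    constant zero. *)

Section Modulus.
Variable R : realType.
Local Notation C := R[i].
Local Notation Re := complex.Re.
Local Notation Im := complex.Im.

Definition cmod (z : C) : R := Normc.normc z.

Lemma cmodE z : `|z| = (cmod z)%:C%C.
Proof. by rewrite normc_def; case: z. Qed.
Lemma cmod_ge0 z : 0 <= cmod z.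
Proof. by rewrite -lecR -cmodE normr_ge0. Qed.
Lemma cmod0 : cmod 0 = 0. Proof. exact: Normc.normc0. Qed.
Lemma cmod1 : cmod 1 = 1. Proof. exact: Normc.normc1. Qed.
Lemma cmodM x y : cmod (x * y) = cmod x * cmod y.
Proof. exact: Normc.normcM. Qed.
Lemma cmodV x : cmod x^-1 = (cmod x)^-1.
Proof. exact: Normc.normcV. Qed.
Lemma cmodN x : cmod (- x) = cmod x.
Proof. by apply: (@complexI R); rewrite -!cmodE normrN. Qed.
Lemma cmodD x y : cmod (x + y) <= cmod x + cmod y.
Proof. by rewrite -lecR rmorphD -!cmodE ler_normD. Qed.
Lemma cmodB x y : cmod (x - y) <= cmod x + cmod y.
Proof. by rewrite -(cmodN y) cmodD. Qed.
Lemma cmodX x n : cmod (x ^+ n) = cmod x ^+ n.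
Proof. by apply: (@complexI R); rewrite rmorphXn /= -!cmodE normrX. Qed.
Lemma cmod_eq0 x : (cmod x == 0) = (x == 0).
Proof. by rewrite -(inj_eq (@complexI R)) -cmodE normr_eq0. Qed.
Lemma cmod_gt0 x : (0 < cmod x) = (x != 0).
Proof. by rewrite lt_def cmod_ge0 andbT cmod_eq0. Qed.
Lemma cmodJ x : cmod x^* = cmod x.
Proof. by apply: (@complexI R); rewrite -!cmodE norm_conjC. Qed.
Lemma cmod_real (x : R) : cmod x%:C%C = `|x|.
Proof. by rewrite /cmod /= expr0n addr0 sqrtr_sqr. Qed.
Lemma cmod_nat n : cmod n%:R = n%:R.
Proof. by apply: (@complexI R); rewrite -cmodE normr_nat rmorph_nat. Qed.
Lemma cmod_sum I (r : seq I) (P : pred I) (F : I -> C) :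
  cmod (\sum_(i <- r | P i) F i) <= \sum_(i <- r | P i) cmod (F i).
Proof.
elim/big_rec2: _ => [|i y x _ h]; first by rewrite cmod0.
by apply: le_trans (cmodD _ _) _; rewrite lerD2l.
Qed.
Lemma cmod_prod I (r : seq I) (P : pred I) (F : I -> C) :
  cmod (\prod_(i <- r | P i) F i) = \prod_(i <- r | P i) cmod (F i).
Proof. by elim/big_rec2: _ => [|i y x _ <-]; rewrite ?cmod1 ?cmodM. Qed.
Lemma mulcJ z : z * z^* = (cmod z ^+ 2)%:C%C.
Proof. by rewrite rmorphXn /= -cmodE sqr_normc. Qed.
Lemma conjcV_circle z : z != 0 -> z^* = (cmod z ^+ 2)%:C%C / z.
Proof. by move=> z0; rewrite -mulcJ mulrAC divff // mul1r. Qed.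
Lemma Re_le_cmod z : `|Re z| <= cmod z.
Proof. by rewrite -lecR -cmodE; exact: normc_ge_Re. Qed.
Lemma cmod_le_ReIm z : cmod z <= `|Re z| + `|Im z|.
Proof.
have {1}-> := complexE z.
by apply: le_trans (cmodD _ _) _; rewrite cmodM !cmod_real /cmod /= expr0n expr1n add0r sqrtr1 mul1r.
Qed.
Lemma ReM_real (x : R) z : Re (x%:C%C * z) = x * Re z.
Proof. by case: z => a b /=; rewrite mul0r subr0. Qed.
Lemma ReJ (z : C) : Re z^* = Re z. Proof. by case: z. Qed.
Lemma ReD (x y : C) : Re (x + y) = Re x + Re y. Proof. by case: x; case: y. Qed.
Lemma ReN (x : C) : Re (- x) = - Re x. Proof. by case: x. Qed.
Lemma ReB (x y : C) : Re (x - y) = Re x - Re y. Proof. by rewrite ReD ReN. Qed.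
Lemma addcJ2 (z : C) : z + z^* = (2 * Re z)%:C%C.
Proof. by rewrite addcJ rmorphM rmorph_nat. Qed.
Lemma ltc_cmod z (r : R) : (`|z| < r%:C%C) = (cmod z < r).
Proof. by rewrite cmodE ltcR. Qed.
Lemma lec_cmod z (r : R) : (`|z| <= r%:C%C) = (cmod z <= r).
Proof. by rewrite cmodE lecR. Qed.
Lemma ltc1_cmod z : (`|z| < 1) = (cmod z < 1).
Proof. exact: ltc_cmod. Qed.
Lemma eqc1_cmod z : `|z| = 1 <-> cmod z = 1.
Proof. by rewrite cmodE; split=> [[]|->]. Qed.

End Modulus.

Lemma expr_small (R : realType) (u e : R) : 0 <= u < 1 -> 0 < e ->
  exists N, forall n, (N <= n)%N -> u ^+ n <= e.
Proof.
move=> /andP[u0 u1] e0; have : `|u| < 1 by rewrite ger0_norm.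
move=> /cvg_expr /cvgrPdist_le /(_ _ e0) [N _ NP]; exists N => n Nn.
by have := NP n Nn; rewrite sub0r normrN ger0_norm // exprn_ge0.
Qed.

(** * Goursat's theorem by subdivision *)

Section ChordSums.
Variable R : realType.
Local Notation C := R[i].
Implicit Types (K : C -> C) (c : R -> C).

(** Trapezoidal rule on one chord. It is exact for affine integrands, and around a circle it
    collapses to a mean over roots of unity ([chord_sum_circle]), so no integral has to be
    defined. *)
Definition chord K (u v : C) : C := (K u + K v) / 2 * (v - u).

Definition chord_sum K c (a b : R) (M : nat) : C :=
  \sum_(k < M) chord K (c (a + (b - a) * k%:R / M%:R))
                       (c (a + (b - a) * k.+1%:R / M%:R)).

(** With an even number of pieces the midpoint is a node; this is why the number of nodes is later a
    power of two. *)
Lemma chord_sum_split K c a b M : (0 < M)%N ->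
  chord_sum K c a b (M + M) =
  chord_sum K c a ((a + b) / 2) M + chord_sum K c ((a + b) / 2) b M.
Proof.
move=> M0; rewrite /chord_sum big_split_ord /=.
have M0' : M%:R != 0 :> R by rewrite pnatr_eq0 -lt0n.
have M2 : M%:R + M%:R != 0 :> R by rewrite -natrD pnatr_eq0 addnn double_eq0 -lt0n.
congr (_ + _); apply: eq_bigr => k _; congr (chord _ (c _) (c _)).
- by rewrite natrD; field; rewrite ?M2 ?M0'.
- by rewrite natrD; field; rewrite ?M2 ?M0'.
- by rewrite !natrD; field; rewrite ?M2 ?M0'.
- by rewrite -addnS !natrD; field; rewrite ?M2 ?M0'.
Qed.

(** The primitive u z + v z^2 / 2 telescopes exactly, so affine functions contribute nothing around
    a closed contour. *)
Lemma chord_sum_affine K c a b M (u v : C) : (0 < M)%N ->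
  (forall z, K z = u + v * z) ->
  chord_sum K c a b M = u * (c b - c a) + v / 2 * (c b ^+ 2 - c a ^+ 2).
Proof.
move=> M0 KE; have M0' : M%:R != 0 :> R by rewrite pnatr_eq0 -lt0n.
pose F k := u * c (a + (b - a) * k%:R / M%:R) +
            v / 2 * c (a + (b - a) * k%:R / M%:R) ^+ 2.
rewrite /chord_sum (eq_bigr (fun k : 'I_M => F k.+1 - F k)); last first.
  by move=> k _; rewrite /chord !KE /F; field.
rewrite -(big_mkord xpredT (fun k => F k.+1 - F k)) telescope_sumr // /F.
by rewrite mulr0 mul0r addr0 mulfK // [a + _]addrC subrK; ring.
Qed.

Lemma chord_sumB K K' c a b M :
  chord_sum (fun z => K z - K' z) c a b M =
  chord_sum K c a b M - chord_sum K' c a b M.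
Proof.
by rewrite /chord_sum -sumrB; apply: eq_bigr => k _; rewrite /chord; field.
Qed.

Lemma chord_sum_le K c a b M (B L : R) : (0 < M)%N -> a <= b -> 0 <= B ->
  (forall s, a <= s <= b -> cmod (K (c s)) <= B) ->
  (forall s s', a <= s <= b -> a <= s' <= b ->
     cmod (c s - c s') <= L * `|s - s'|) ->
  cmod (chord_sum K c a b M) <= B * L * (b - a).
Proof.
move=> M0 ab B0 KB cL; have M0' : 0 < M%:R :> R by rewrite ltr0n.
apply: le_trans (cmod_sum _ _ _) _.
have nodeP (k : nat) : (k <= M)%N ->
    a <= a + (b - a) * k%:R / M%:R <= b.
  move=> kM; have k1 : 0 <= (k%:R / M%:R : R) <= 1.
    by rewrite divr_ge0 ?ler0n //= ler_pdivrMr // mul1r ler_nat.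
  rewrite -mulrA; nra.
apply: (@le_trans _ _ (\sum_(k < M) B * L * ((b - a) / M%:R))); last first.
  rewrite sumr_const card_ord -[_ *+ M]mulr_natr.
  by rewrite -!mulrA mulVf ?mulr1 // gt_eqF.
apply: ler_sum => k _; rewrite /chord cmodM -(mulrA B).
apply: ler_pM; rewrite ?cmod_ge0 //.
  rewrite cmodM cmodV cmod_nat ler_pdivrMr ?ltr0n // [B * _]mulr_natr mulr2n.
  by apply: le_trans (cmodD _ _) _; rewrite lerD // KB // nodeP // ltnW.
apply: le_trans (cL _ _ _ _) _; rewrite ?nodeP // 1?ltnW //.
suff -> : a + (b - a) * k.+1%:R / M%:R - (a + (b - a) * k%:R / M%:R) =
    (b - a) / M%:R by rewrite ger0_norm // divr_ge0 ?subr_ge0 ?ler0n.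
by rewrite -addn1 natrD; field; rewrite gt_eqF.
Qed.

End ChordSums.

Section Bisection.
Variable R : realType.
Variable P : R -> R -> R -> Prop.
Hypothesis P_glue : forall x y h : R, 0 < h ->
  P x y (h / 2) -> P (x + h / 2) y (h / 2) ->
  P x (y + h / 2) (h / 2) -> P (x + h / 2) (y + h / 2) (h / 2) -> P x y h.
Hypothesis P_local : forall s t : R, 0 <= s <= 1 -> 0 <= t <= 1 ->
  exists2 d : R, 0 < d & forall x y h : R, 0 < h < d ->
    0 <= x -> x + h <= 1 -> 0 <= y -> y + h <= 1 ->
    x <= s <= x + h -> y <= t <= y + h -> P x y h.

(** A quarter on which P fails. The fourth one needs no test: if the other three satisfy P and the
    whole square does not, [P_glue] makes it fail. *)
Let child (q : R * R) h :=
  if ~~ `[< P q.1 q.2 (h / 2) >] then q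
  else if ~~ `[< P (q.1 + h / 2) q.2 (h / 2) >] then (q.1 + h / 2, q.2)
  else if ~~ `[< P q.1 (q.2 + h / 2) (h / 2) >] then (q.1, q.2 + h / 2)
  else (q.1 + h / 2, q.2 + h / 2).

Let side n : R := 2^-1 ^+ n.

Let corner := fix corner n : R * R :=
  if n is m.+1 then child (corner m) (side m) else (0, 0).

(** Otherwise some quarter fails at every stage, and the nested failing squares shrink to a point
    (s, t), where [P_local] is contradicted. *)
Lemma subdivision : P 0 0 1.
Proof.
apply: contrapT => notP.
have side_gt0 n : 0 < side n by rewrite exprn_gt0 // invr_gt0.
have sideS n : side n.+1 = side n / 2 by rewrite /side exprSr.
have cornerP n : ~ P (corner n).1 (corner n).2 (side n).
  elim: n => [|n IH]; first by rewrite /side expr0.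
  rewrite sideS /= /child; set q := corner n in IH *.
  case: asboolP => //= h1; case: asboolP => //= h2; case: asboolP => //= h3 h4.
  exact/IH/P_glue.
have stepP n : ((corner n).1 <= (corner n.+1).1 <= (corner n).1 + side n.+1) /\
    ((corner n).2 <= (corner n.+1).2 <= (corner n).2 + side n.+1).
  have := side_gt0 n; rewrite sideS [corner n.+1]/= /child.
  case: asboolP => _ /=; last by split; lra.
  case: asboolP => _ /=; last by split; lra.
  by case: asboolP => _ /=; split; lra.
(* Both coordinates are treated at once through [nth]; for [i] at least 2 the value is the default 0
   and the bounds remain true. *)
have mono i : forall m n, (m <= n)%N ->
    nth 0 [:: (corner m).1; (corner m).2] i <=
    nth 0 [:: (corner n).1; (corner n).2] i <=
    nth 0 [:: (corner m).1; (corner m).2] i + side m - side n.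
  move=> m; elim=> [|n IH].
    by rewrite leqn0 => /eqP ->; rewrite addrK lexx.
  rewrite leq_eqVlt => /orP[/eqP <-|]; first by rewrite addrK lexx.
  rewrite ltnS => /IH; have := stepP n; have := side_gt0 n; rewrite sideS.
  by case: i {IH} => [|[|i]] /=; rewrite ?nth_nil; lra.
have limP i : exists s, forall n, nth 0 [:: (corner n).1; (corner n).2] i
    <= s <= nth 0 [:: (corner n).1; (corner n).2] i + side n.
  pose E := [set nth 0 [:: (corner n).1; (corner n).2] i | n in setT]%classic.
  have ubE n : ubound E (nth 0 [:: (corner n).1; (corner n).2] i + side n).
    move=> _ [m _ <-]; have [nm|/ltnW mn] := leqP n m.
      by have := mono i _ _ nm; have := side_gt0 m; lra.
    by have := mono i _ _ mn; have := side_gt0 n; lra.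
  exists (sup E) => n; apply/andP; split.
    by apply: ub_le_sup; [exists (nth 0 [:: (corner 0).1; (corner 0).2] i + side 0); exact: ubE | exists n].
  by apply: ge_sup; [exists (nth 0 [:: (corner 0).1; (corner 0).2] i); exists 0%N | exact: ubE].
have [s sP] := limP 0%N; have [t tP] := limP 1%N.
have range i n : 0 <= nth 0 [:: (corner n).1; (corner n).2] i /\
    nth 0 [:: (corner n).1; (corner n).2] i + side n <= 1.
  have := mono i _ _ (leq0n n); have -> : side 0 = 1 by rewrite /side expr0.
  by case: i => [|[|i]] /=; rewrite ?nth_nil; lra.
have s01 : 0 <= s <= 1.
  have := sP 0%N; have := range 0%N 0%N; rewrite /= /side expr0; lra.
have t01 : 0 <= t <= 1.
  have := tP 0%N; have := range 1%N 0%N; rewrite /= /side expr0; lra.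
have [d d0 dP] := P_local s01 t01.
have [n nd] : exists n, side n < d.
  have [n nP] := @expr_small R 2^-1 (d / 2) ltac:(lra) ltac:(lra).
  by exists n; apply: le_lt_trans (nP n (leqnn n)) _; lra.
have [x0 x1] := range 0%N n; have [y0 y1] := range 1%N n.
apply: (cornerP n); apply: dP => //; first by rewrite side_gt0.
  exact: sP.
exact: tP.
Qed.

End Bisection.

Section Goursat.
Variable R : realType.
Local Notation C := R[i].

Definition boundary_sum (g : R -> R -> C) (K : C -> C) (a b c d : R) M : C :=
  chord_sum K (fun s => g s c) a b M + chord_sum K (g b) c d M
  - chord_sum K (fun s => g s d) a b M - chord_sum K (g a) c d M.

(** Over an interval of length h that contains 0 this function grows by at least sqrt h, so the
    product of two such increments is at least h rather than h^2. *)
Definition odd_sqrt (u : R) : R := if 0 <= u then Num.sqrt u else - Num.sqrt (- u).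

Lemma odd_sqrt_nd u v : u <= v -> odd_sqrt u <= odd_sqrt v.
Proof.
move=> uv; rewrite /odd_sqrt; case: ifPn => u0; case: ifPn => v0.
- exact: ler_wsqrtr.
- by have := le_trans u0 uv; rewrite (negbTE v0).
- by apply: le_trans (sqrtr_ge0 _); rewrite oppr_le0 sqrtr_ge0.
- by rewrite lerN2 ler_wsqrtr // lerN2.
Qed.

Lemma odd_sqrt_ge u v : u <= 0 <= v -> Num.sqrt (v - u) <= odd_sqrt v - odd_sqrt u.
Proof.
move=> /andP[u0 v0]; have -> : odd_sqrt v = Num.sqrt v by rewrite /odd_sqrt v0.
have -> : odd_sqrt u = - Num.sqrt (- u).
  rewrite /odd_sqrt; case: ifPn => // u0'; have -> : u = 0 by apply: le_anti; rewrite u0.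
  by rewrite oppr0 sqrtr0 oppr0.
have nu : 0 <= - u by rewrite oppr_ge0.
rewrite opprK -(@ler_pXn2r _ 2) ?nnegrE ?addr_ge0 ?sqrtr_ge0 //.
rewrite sqrrD !sqr_sqrtr ?addr_ge0 //.
by have := mulr_ge0 (sqrtr_ge0 v) (sqrtr_ge0 (- u)); rewrite -mulr_natr; nra.
Qed.

(* The second summand is additive over subdivisions, yet at least h whenever
   the square contains w: it absorbs the error at a point of mere continuity. *)
Definition square_weight (X : seq (R * R)) (x y h : R) : R :=
  h ^+ 2 + \sum_(w <- X) (odd_sqrt (x + h - w.1) - odd_sqrt (x - w.1)) *
                         (odd_sqrt (y + h - w.2) - odd_sqrt (y - w.2)).

Lemma square_weight_ge0 X x y h : 0 <= h ->
  h ^+ 2 <= square_weight X x y h.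
Proof.
move=> h0; rewrite lerDl; apply: sumr_ge0 => w _.
by rewrite mulr_ge0 // subr_ge0 odd_sqrt_nd // lerB // lerDl.
Qed.

Lemma square_weight_mem X x y h w : 0 <= h -> w \in X ->
  x <= w.1 <= x + h -> y <= w.2 <= y + h -> h <= square_weight X x y h.
Proof.
move=> h0 wX xw yw; rewrite /square_weight (big_rem w) //=.
have sx : Num.sqrt h <= odd_sqrt (x + h - w.1) - odd_sqrt (x - w.1).
  have := @odd_sqrt_ge (x - w.1) (x + h - w.1).
  by have -> : x + h - w.1 - (x - w.1) = h by [ring]; apply; lra.
have sy : Num.sqrt h <= odd_sqrt (y + h - w.2) - odd_sqrt (y - w.2).
  have := @odd_sqrt_ge (y - w.2) (y + h - w.2).
  by have -> : y + h - w.2 - (y - w.2) = h by [ring]; apply; lra.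
have := ler_pM (sqrtr_ge0 h) (sqrtr_ge0 h) sx sy.
rewrite -expr2 sqr_sqrtr // => hle; apply: le_trans hle _.
rewrite addrCA lerDl addr_ge0 ?sqr_ge0 // sumr_ge0 // => v _.
by rewrite mulr_ge0 // subr_ge0 odd_sqrt_nd // lerB // lerDl.
Qed.

Variables (g : R -> R -> C) (K : C -> C) (L : R) (X : seq (R * R)).
Hypothesis L0 : 0 < L.
Hypothesis gL : forall s t s' t' : R, 0 <= s <= 1 -> 0 <= t <= 1 -> 0 <= s' <= 1 ->
  0 <= t' <= 1 -> cmod (g s t - g s' t') <= L * (`|s - s'| + `|t - t'|).
Hypothesis Kg : forall s t : R, 0 <= s <= 1 -> 0 <= t <= 1 ->
  (exists v : C, forall e : R, 0 < e -> exists2 d : R, 0 < d & forall s' t' : R,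
     0 <= s' <= 1 -> 0 <= t' <= 1 -> `|s' - s| < d -> `|t' - t| < d ->
     cmod (K (g s' t') - K (g s t) - v * (g s' t' - g s t)) <=
       e * (`|s' - s| + `|t' - t|)) \/
  ((s, t) \in X /\ forall e : R, 0 < e -> exists2 d : R, 0 < d & forall s' t' : R,
     0 <= s' <= 1 -> 0 <= t' <= 1 -> `|s' - s| < d -> `|t' - t| < d ->
     cmod (K (g s' t') - K (g s t)) <= e).

(** The affine function has boundary sum 0, so only the deviation B counts, over four sides whose
    images have length at most L h. *)
Lemma boundary_sum_le u v x y h B M : (0 < M)%N -> 0 < h -> 0 <= B ->
  0 <= x -> x + h <= 1 -> 0 <= y -> y + h <= 1 ->
  (forall s t, x <= s <= x + h -> y <= t <= y + h ->
     cmod (K (g s t) - (u + v * g s t)) <= B) ->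
  cmod (boundary_sum g K x (x + h) y (y + h) M) <= 4 * B * L * h.
Proof.
move=> M0 h0 B0 x0 x1 y0 y1 KB; pose A z := u + v * z.
have -> : boundary_sum g K x (x + h) y (y + h) M =
    boundary_sum g (fun z => K z - A z) x (x + h) y (y + h) M.
  rewrite /boundary_sum !chord_sumB.
  rewrite !(@chord_sum_affine _ A _ _ _ _ u v) //; ring.
have xx : x <= x + h by rewrite lerDl ltW.
have yy : y <= y + h by rewrite lerDl ltW.
have hE z : z + h - z = h by rewrite addrAC subrr add0r.
have H c : y <= c <= y + h ->
    cmod (chord_sum (fun z => K z - A z) (fun s => g s c) x (x + h) M) <= B * L * h.
  move=> cP; rewrite -{2}(hE x); apply: chord_sum_le => // [s sP|s s' sP s'P].
    exact: KB.
  apply: le_trans (gL _ _ _ _) _; rewrite ?subrr ?normr0 ?addr0 //; lra.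
have V c : x <= c <= x + h ->
    cmod (chord_sum (fun z => K z - A z) (g c) y (y + h) M) <= B * L * h.
  move=> cP; rewrite -{2}(hE y); apply: chord_sum_le => // [s sP|s s' sP s'P].
    exact: KB.
  apply: le_trans (gL _ _ _ _) _; rewrite ?subrr ?normr0 ?add0r //; lra.
have -> : 4 * B * L * h = B * L * h + B * L * h + B * L * h + B * L * h by ring.
apply: le_trans (cmodB _ _) _; apply: lerD; last by apply: V; rewrite lexx.
apply: le_trans (cmodB _ _) _; apply: lerD; last by apply: H; rewrite lexx yy.
apply: le_trans (cmodD _ _) _; apply: lerD; first by apply: H; rewrite lexx.
by apply: V; rewrite lexx xx.
Qed.

Lemma boundary_sum_split x y h M : (0 < M)%N ->
  boundary_sum g K x (x + h) y (y + h) (M + M) =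
  boundary_sum g K x (x + h / 2) y (y + h / 2) M +
  boundary_sum g K (x + h / 2) (x + h / 2 + h / 2) y (y + h / 2) M +
  boundary_sum g K x (x + h / 2) (y + h / 2) (y + h / 2 + h / 2) M +
  boundary_sum g K (x + h / 2) (x + h / 2 + h / 2) (y + h / 2) (y + h / 2 + h / 2) M.
Proof.
move=> M0; have mE z : (z + (z + h)) / 2 = z + h / 2 :> R by field.
have eE z : z + h / 2 + h / 2 = z + h :> R by field.
by rewrite /boundary_sum !chord_sum_split // !mE !eE; ring.
Qed.

(** Near a point of differentiability the deviation from an affine function is o(h), hence the
    boundary sum is o(h^2). At a point of X continuity yields only o(h), which the weight of a
    square containing that point still dominates. *)
Theorem goursat (e : R) : 0 < e -> exists N0, forall N, (N0 <= N)%N ->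
  cmod (boundary_sum g K 0 1 0 1 (2 ^ N)) <= e.
Proof.
move=> e0; pose W := square_weight X 0 0 1.
have W1 : 1 <= W by have := @square_weight_ge0 X 0 0 1 ler01; rewrite expr1n.
have W0 : 0 < W by apply: lt_le_trans W1.
pose e1 := e / W; have e10 : 0 < e1 by rewrite divr_gt0.
pose P x y h := exists N0, forall N, (N0 <= N)%N ->
  cmod (boundary_sum g K x (x + h) y (y + h) (2 ^ N)) <= e1 * square_weight X x y h.
suff [N0 HN] : P 0 0 1.
  exists N0 => N /HN; rewrite !add0r => /le_trans; apply.
  by rewrite /e1 divfK ?gt_eqF.
have two n : (0 < 2 ^ n)%N by rewrite expn_gt0.
apply: subdivision => [x y h h0 [n1 H1] [n2 H2] [n3 H3] [n4 H4]|s t s01 t01].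
  (* One doubling of the nodes is spent on splitting the square, hence the successor. *)
  exists (n1 + n2 + n3 + n4).+1 => -[//|N]; rewrite ltnS => le_N.
  rewrite expnS mul2n -addnn boundary_sum_split //.
  have -> : square_weight X x y h =
     square_weight X x y (h / 2) + square_weight X (x + h / 2) y (h / 2) +
     square_weight X x (y + h / 2) (h / 2) +
     square_weight X (x + h / 2) (y + h / 2) (h / 2).
    have eE z : z + h / 2 + h / 2 = z + h :> R by field.
    rewrite /square_weight.
    have sumE (S S1 S2 S3 S4 : R) : S = S1 + S2 + S3 + S4 ->
      h ^+ 2 + S = (h / 2) ^+ 2 + S1 + ((h / 2) ^+ 2 + S2) +
        ((h / 2) ^+ 2 + S3) + ((h / 2) ^+ 2 + S4) by move=> ->; field.
    apply: sumE; rewrite -!big_split /=; apply: eq_bigr => w _.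
    by rewrite !eE; ring.
  have sum4 (a b c d : C) (A B D E : R) : cmod a <= e1 * A -> cmod b <= e1 * B ->
      cmod c <= e1 * D -> cmod d <= e1 * E -> cmod (a + b + c + d) <= e1 * (A + B + D + E).
    move=> ha hb hc hd; rewrite !mulrDr; apply: le_trans (cmodD _ _) _.
    apply: lerD hd; apply: le_trans (cmodD _ _) _; apply: lerD hc.
    by apply: le_trans (cmodD _ _) _; apply: lerD.
  apply: sum4; [apply: H1|apply: H2|apply: H3|apply: H4]; lia.
have [[v Kv]|[stX Kc]] := Kg s01 t01.
  (* Both parameters are within h of (s, t), so the deviation is at most 2 h times this number; the
     factor 4 L h of [boundary_sum_le] then gives e1 h^2. *)
  have e2 : 0 < e1 / (8 * L) by rewrite divr_gt0 // mulr_gt0.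
  have [d d0 dP] := Kv _ e2.
  exists d => // x y h /andP[h0 hd] x0 x1 y0 y1 xs yt; exists 0%N => N _.
  apply: le_trans (_ : e1 * h ^+ 2 <= _); last first.
    by rewrite ler_pM2l // square_weight_ge0 // ltW.
  have -> : e1 * h ^+ 2 = 4 * (e1 / (8 * L) * (h + h)) * L * h by field; rewrite gt_eqF.
  apply: (@boundary_sum_le (K (g s t) - v * g s t) v) => //.
    by apply: mulr_ge0; [exact: ltW | lra].
  move=> s' t' xs' yt'.
  have ds : `|s' - s| <= h by rewrite ler_norml; lra.
  have dt : `|t' - t| <= h by rewrite ler_norml; lra.
  have -> : K (g s' t') - (K (g s t) - v * g s t + v * g s' t') =
    K (g s' t') - K (g s t) - v * (g s' t' - g s t) by ring.
  apply: le_trans (dP _ _ _ _ _ _) _; try by clear -h0 hd x0 x1 y0 y1 xs' yt' ds dt; lra.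
  by rewrite ler_wpM2l ?lerD // ltW.
have e2 : 0 < e1 / (4 * L) by rewrite divr_gt0 // mulr_gt0.
have [d d0 dP] := Kc _ e2.
exists d => // x y h /andP[h0 hd] x0 x1 y0 y1 xs yt; exists 0%N => N _.
apply: le_trans (_ : e1 * h <= _); last first.
  by rewrite ler_pM2l // (square_weight_mem (ltW h0) stX).
have -> : e1 * h = 4 * (e1 / (4 * L)) * L * h by field; rewrite gt_eqF.
apply: (@boundary_sum_le (K (g s t)) 0) => //.
  exact: ltW.
move=> s' t' xs' yt'; rewrite mul0r addr0.
have ds : `|s' - s| <= h by rewrite ler_norml; lra.
have dt : `|t' - t| <= h by rewrite ler_norml; lra.
by apply: dP; clear -h0 hd x0 x1 y0 y1 xs' yt' ds dt; lra.
Qed.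

End Goursat.

(** * Cauchy's formula with means over roots of unity *)

Section ComplexDerivative.
Variable R : realType.
Local Notation C := R[i].

Definition cdiff (F : C -> C) (z : C) := differentiable (F : C^o -> C^o) (z : C^o).

Lemma cdiffP F z : cdiff F z -> exists v, forall e : R, 0 < e ->
  exists2 d : R, 0 < d & forall w, cmod (w - z) < d ->
    cmod (F w - F z - v * (w - z)) <= e * cmod (w - z).
Proof.
move=> /derivable1_diffP; rewrite /derivable => /cvg_ex[v /= Fv].
exists v => e e0; have e0' : 0 < e%:C%C by rewrite ltcR.
have /cvgrPdist_le /(_ _ e0') := Fv; rewrite near_withinE => -[d /= d0 dP].
have /complex_realP[r rE] : d \is Num.real by rewrite ger0_real // ltW.
rewrite rE in d0 dP; exists r => [|w wz]; first by rewrite -ltcR.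
have [->|wz0] := eqVneq w z; first by rewrite !subrr mulr0 subr0 cmod0 mulr0.
have wz0' : w - z != 0 by rewrite subr_eq0.
have := dP (w - z); rewrite /= sub0r normrN ltc_cmod => /(_ wz wz0').
rewrite lec_cmod /= /GRing.scale /= mulr1 subrK => le_e.
have -> : F w - F z - v * (w - z) = - (v - (w - z)^-1 * (F w - F z)) * (w - z).
  by field.
by rewrite cmodM cmodN ler_wpM2r // cmod_ge0.
Qed.

Lemma cdiff_continuous F z : cdiff F z -> forall e : R, 0 < e ->
  exists2 d : R, 0 < d & forall w, cmod (w - z) < d -> cmod (F w - F z) <= e.
Proof.
move=> /cdiffP[v /(_ 1 ltr01)[d d0 dP]] e e0.
have k0 : 0 < 1 + cmod v by rewrite ltr_pwDl // cmod_ge0.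
exists (Num.min d (e / (1 + cmod v))); first by rewrite lt_min d0 divr_gt0.
move=> w; rewrite lt_min => /andP[/dP h1 h2].
have -> : F w - F z = (F w - F z - v * (w - z)) + v * (w - z) by ring.
apply: le_trans (cmodD _ _) _; rewrite cmodM.
move: h2; rewrite ltr_pdivlMr // => h2; nra.
Qed.

Lemma cdiff_cst c z : cdiff (fun=> c) z.
Proof. exact: differentiable_cst. Qed.
Lemma cdiff_id z : cdiff id z.
Proof. by case: (is_diff_id (z : C^o)). Qed.
Lemma cdiffD F G z : cdiff F z -> cdiff G z -> cdiff (fun w => F w + G w) z.
Proof. exact: differentiableD. Qed.
Lemma cdiffN F z : cdiff F z -> cdiff (fun w => - F w) z.
Proof. exact: differentiableN. Qed.
Lemma cdiffB F G z : cdiff F z -> cdiff G z -> cdiff (fun w => F w - G w) z.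
Proof. exact: differentiableB. Qed.
Lemma cdiffM F G z : cdiff F z -> cdiff G z -> cdiff (fun w => F w * G w) z.
Proof. exact: differentiableM. Qed.
Lemma cdiffV F z : F z != 0 -> cdiff F z -> cdiff (fun w => (F w)^-1) z.
Proof. by move=> Fz0 dF; exact: differentiableV. Qed.
Lemma cdiffX F n z : cdiff F z -> cdiff (fun w => F w ^+ n) z.
Proof.
move=> dF; elim: n => [|n IH]; first exact: cdiff_cst.
by under eq_fun do rewrite exprS; exact: cdiffM.
Qed.
Lemma cdiff_horner (p : {poly C}) F z : cdiff F z -> cdiff (fun w => p.[F w]) z.
Proof.
move=> dF; elim/poly_ind: p => [|p c IH].
  by under eq_fun do rewrite horner0; exact: cdiff_cst.
under eq_fun do rewrite hornerMXaddC.
by apply: cdiffD (cdiff_cst _ _); apply: cdiffM.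
Qed.

End ComplexDerivative.

(** * The unit circle and the roots of unity of order 2^N *)

Section Circle.
Variable R : realType.
Local Notation C := R[i].

Definition cis (t : R) : C := (cos t +i* sin t)%C.

Lemma cisD s t : cis (s + t) = cis s * cis t.
Proof. by rewrite /cis cosD sinD [X in (_ +i* X)%C]addrC. Qed.
Lemma cis0 : cis 0 = 1. Proof. by rewrite /cis cos0 sin0. Qed.
Lemma cisX t n : cis t ^+ n = cis (n%:R * t).
Proof.
elim: n => [|n IH]; first by rewrite mul0r cis0.
by rewrite exprS IH -cisD -addn1 natrD mulrDl mul1r addrC.
Qed.
Lemma cis2pi : cis (2 * pi) = 1.
Proof. by rewrite mulr_natl /cis cos2pi sin2pi. Qed.
Lemma cispi : cis pi = -1.
Proof. by rewrite /cis cospi sinpi; apply/eqP; rewrite eq_complex /= oppr0 !eqxx. Qed.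
Lemma cmod_cis t : cmod (cis t) = 1.
Proof. by rewrite /cmod /= cos2Dsin2 sqrtr1. Qed.
Lemma cis_neq0 t : cis t != 0.
Proof. by rewrite -cmod_eq0 cmod_cis oner_eq0. Qed.
Lemma cisN t : cis (- t) = (cis t)^-1.
Proof. by apply: (mulfI (cis_neq0 t)); rewrite divff ?cis_neq0 // -cisD subrr cis0. Qed.

Lemma lipschitz_of_derive (f df : R -> R) :
  (forall x : R, is_derive x 1 f (df x)) -> (forall x, `|df x| <= 1) ->
  forall s t, `|f s - f t| <= `|s - t|.
Proof.
move=> fd df1; suff H s t : s <= t -> `|f s - f t| <= `|s - t|.
  move=> s t; have [st|/ltW ts] := leP s t; first exact: H.
  by rewrite distrC (distrC s); exact: H.
move=> st; have [x _ E] : exists2 x, x \in `[s, t] & f t - f s = df x * (t - s).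
  apply: MVT_segment => //.
  apply: continuous_subspaceT => x.
  by apply: differentiable_continuous; apply/derivable1_diffP; case: (fd x).
rewrite distrC E normrM (distrC s) -[leRHS]mul1r.
by rewrite ler_wpM2r.
Qed.

Lemma cis_lipschitz s t : cmod (cis s - cis t) <= 2 * `|s - t|.
Proof.
apply: le_trans (cmod_le_ReIm _) _; rewrite /= mulr_natl mulr2n; apply: lerD.
  apply: (@lipschitz_of_derive _ (fun x => - sin x)) => x; rewrite normrN.
  exact: sin_max.
by apply: (@lipschitz_of_derive _ cos) => x; exact: cos_max.
Qed.

(** The double-angle identity reduces the hypothesis to sin (pi (s - t)) = 0, and sin has no zero
    strictly between 0 and pi. *)
Lemma cis_inj s t : `|s - t| <= 1 -> cis (2 * pi * s) = cis (2 * pi * t) ->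
  [\/ s = t, s = t + 1 | s = t - 1].
Proof.
move=> st1 E; have E1 : cis (2 * pi * (s - t)) = 1.
  by rewrite mulrBr cisD cisN E divff // cis_neq0.
have sin0 : sin (pi * (s - t)) = 0.
  have : complex.Re (cis (2 * pi * (s - t))) = 1 by rewrite E1.
  rewrite /= (_ : 2 * pi * (s - t) = (pi * (s - t)) *+ 2); last by rewrite mulr2n; ring.
  rewrite cos_mulr2n cos2sin2 => /eqP; rewrite -subr_eq0.
  by rewrite (_ : _ - 1 = - 2 * sin (pi * (s - t)) ^+ 2);
    [rewrite mulf_eq0 oppr_eq0 pnatr_eq0 /= sqrf_eq0 => /eqP|rewrite mulr2n; ring].
have p0 : 0 < pi :> R := pi_gt0 R.
have [st|st|st] := ltgtP (s - t) 0; last 1 first.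
- by constructor 1; apply: subr0_eq.
- case: (eqVneq (s - t) (-1)) => [e|n]; first by constructor 3; rewrite -e; ring.
  have n' : -1 < s - t.
    by rewrite lt_neqAle eq_sym n /=; move: st1; rewrite ler_norml => /andP[].
  have := @sin_gt0_pi R (- (pi * (s - t))).
  by rewrite sinN sin0 oppr0 ltxx; move=> h; exfalso; suff: false by []; apply: h; nra.
- case: (eqVneq (s - t) 1) => [e|n]; first by constructor 2; rewrite -e; ring.
  have n' : s - t < 1.
    by rewrite lt_neqAle n /=; move: st1; rewrite ler_norml => /andP[].
  have := @sin_gt0_pi R (pi * (s - t)).
  by rewrite sin0 ltxx; move=> h; exfalso; suff: false by []; apply: h; nra.
Qed.

Definition omega (N : nat) : C := cis (2 * pi / (2 ^ N)%:R).

Lemma omegaX N k : omega N ^+ k = cis (2 * pi * (k%:R / (2 ^ N)%:R)).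
Proof. by rewrite /omega cisX; congr cis; ring. Qed.

Lemma cmod_omegaX N k : cmod (omega N ^+ k) = 1.
Proof. by rewrite omegaX cmod_cis. Qed.

(** The order divides 2^N; were it a smaller power of two, the power 2^(N-1) of [omega] would be 1,
    whereas it is cis pi = -1. *)
Lemma omega_prim N : (2 ^ N).-primitive_root (omega N).
Proof.
have W : (2 ^ N)%:R != 0 :> R by rewrite pnatr_eq0 expn_eq0.
have o1 : omega N ^+ (2 ^ N) = 1 by rewrite omegaX divff // mulr1 cis2pi.
have /andP[k0 k1] : (0 < 2 ^ N <= 2 ^ N)%N by rewrite expn_gt0 /=.
have [m /= pm] := @prim_order_exists _ _ (omega N) k0 o1.
move=> /(dvdn_pfactor _ N (isT : prime 2))[j jN mE]; move: pm; rewrite mE.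
have [->//|jN'] := eqVneq j N; have {jN'}jN : (j < N)%N by rewrite ltn_neqAle jN' jN.
move=> /prim_expr_order pj; exfalso; have := @congr1 _ _ (fun z => z ^+ (2 ^ (N - j.+1))) _ _ pj.
rewrite /= -exprM -expnD expr1n.
have -> : (j + (N - j.+1) = N.-1)%N by lia.
rewrite omegaX (_ : _ * _ = pi) ?cispi.
  by move=> /eqP; rewrite -subr_eq0 -opprD oppr_eq0 -(natrD _ 1 1) pnatr_eq0.
have -> : (2 ^ N)%:R = 2 * (2 ^ N.-1)%:R :> R by rewrite -natrM -expnS prednK //; lia.
by field; rewrite pnatr_eq0 expn_eq0.
Qed.

(** Equality holds at N = 2, and doubling does not decrease the value because sin 2x = 2 sin x cos x
    is at most 2 sin x. The bound compensates the factor sin (2 pi / 2^N) of [chord_sum_circle]. *)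
Lemma sin_omega_ge N : (2 <= N)%N -> 4 <= (2 ^ N)%:R * sin (2 * pi / (2 ^ N)%:R) :> R.
Proof.
elim: N => // N IH; rewrite ltnS leq_eqVlt => /orP[/eqP <-|/IH].
  by rewrite (_ : 2 * pi / _ = pi / 2) ?sin_pihalf ?mulr1 //; field.
have W : 0 < (2 ^ N)%:R :> R by rewrite ltr0n expn_gt0.
set x := 2 * pi / (2 ^ N.+1)%:R.
have -> : 2 * pi / (2 ^ N)%:R = x *+ 2.
  by rewrite /x expnS natrM mulr2n; field; rewrite gt_eqF.
rewrite sin_mulr2n expnS natrM mulr2n => h; apply: le_trans h _.
have sx : 0 <= sin x.
  apply: sin_ge0_pi; rewrite /x divr_ge0 ?mulr_ge0 ?pi_ge0 ?ler0n //=.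
  rewrite ler_pdivrMr ?ltr0n ?expn_gt0 // expnS natrM.
  have : 1 <= (2 ^ N)%:R :> R by rewrite ler1n expn_gt0.
  by have := @pi_gt0 R; nra.
have cs : cos x * sin x <= sin x by rewrite ler_piMl // cos_le1.
by rewrite [2 * _]mulrC -mulrA ler_pM2l //; lra.
Qed.

End Circle.

Section CauchyFormula.
Variable R : realType.
Local Notation C := R[i].

Definition circle_mean (N : nat) (r : R) (F : C -> C) : C :=
  (2 ^ N)%:R^-1 * \sum_(k < 2 ^ N) F (r%:C%C * omega R N ^+ k).

(** This is x / (x - z): the Cauchy kernel relative to the normalised arc length dx / (2 pi i x). *)
Definition cauchy_kernel (z x : C) : C := (1 - z / x)^-1.

Lemma pow2_gt0 N : 0 < (2 ^ N)%:R :> R.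
Proof. by rewrite ltr0n expn_gt0. Qed.
Lemma pow2C_neq0 N : (2 ^ N)%:R != 0 :> C.
Proof. by rewrite pnatr_eq0 expn_eq0. Qed.

Lemma cmod_node N (r : R) k : 0 <= r -> cmod (r%:C%C * omega R N ^+ k) = r.
Proof. by move=> r0; rewrite cmodM cmod_omegaX mulr1 cmod_real ger0_norm. Qed.

Lemma circle_meanD N r F G :
  circle_mean N r (fun x => F x + G x) = circle_mean N r F + circle_mean N r G.
Proof. by rewrite /circle_mean big_split /= mulrDr. Qed.
Lemma circle_meanB N r F G :
  circle_mean N r (fun x => F x - G x) = circle_mean N r F - circle_mean N r G.
Proof. by rewrite /circle_mean sumrB mulrBr. Qed.
Lemma circle_meanZ N r a F :
  circle_mean N r (fun x => a * F x) = a * circle_mean N r F.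
Proof. by rewrite /circle_mean -mulr_sumr mulrCA. Qed.
Lemma circle_mean_sum N r I (s : seq I) (F : I -> C -> C) :
  circle_mean N r (fun x => \sum_(i <- s) F i x) = \sum_(i <- s) circle_mean N r (F i).
Proof. by rewrite /circle_mean exchange_big mulr_sumr. Qed.
Lemma eq_circle_mean N (r : R) F G : 0 <= r -> (forall x, cmod x = r -> F x = G x) ->
  circle_mean N r F = circle_mean N r G.
Proof.
by move=> r0 FG; congr (_ * _); apply: eq_bigr => k _; rewrite FG // cmod_node.
Qed.
Lemma circle_mean_cst N r a : circle_mean N r (fun=> a) = a.
Proof.
by rewrite /circle_mean sumr_const card_ord -[a *+ _]mulr_natl mulKf ?pow2C_neq0.
Qed.
Lemma circle_mean_le N (r B : R) F : 0 <= r ->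
  (forall x, cmod x = r -> cmod (F x) <= B) -> cmod (circle_mean N r F) <= B.
Proof.
move=> r0 FB; rewrite cmodM cmodV cmod_nat ler_pdivrMl ?pow2_gt0 //.
apply: le_trans (cmod_sum _ _ _) _.
apply: le_trans (ler_sum _ (_ : forall k, true -> _ <= B)) _ => [k _|].
  by apply: FB; rewrite cmod_node.
by rewrite sumr_const card_ord mulr_natl.
Qed.
Lemma circle_meanJ N r F : (circle_mean N r F)^* = circle_mean N r (fun x => (F x)^*).
Proof. by rewrite /circle_mean rmorphM fmorphV rmorph_nat rmorph_sum. Qed.

(** With M = 2^N, each term is a finite geometric sum divided by 1 - u^M, since (u w^k)^M = u^M.
    Summation over k annihilates every power w^(j k) with 0 < j < M. *)
Lemma sum_geometric_roots N (w u : C) : (2 ^ N).-primitive_root w -> u ^+ (2 ^ N) != 1 ->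
  \sum_(k < 2 ^ N) (1 - u * w ^+ k)^-1 = (2 ^ N)%:R / (1 - u ^+ (2 ^ N)).
Proof.
move=> pw uM; set M := (2 ^ N)%N in pw uM *.
have M0 : (0 < M)%N by rewrite expn_gt0.
have uM' : 1 - u ^+ M != 0 by rewrite subr_eq0 eq_sym.
have termE k : (1 - u * w ^+ k)^-1 = (1 - u ^+ M)^-1 * \sum_(j < M) u ^+ j * w ^+ (k * j).
  have E : (1 - u * w ^+ k) * \sum_(j < M) u ^+ j * w ^+ (k * j) = 1 - u ^+ M.
    have -> : \sum_(j < M) u ^+ j * w ^+ (k * j) = \sum_(j < M) (u * w ^+ k) ^+ j.
      by apply: eq_bigr => j _; rewrite exprMn -exprM.
    by rewrite -[in LHS](opprB _ 1) mulNr -subrX1 opprB exprMn -exprM mulnC exprM (prim_expr_order pw) expr1n mulr1.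
  have n0 : 1 - u * w ^+ k != 0.
    by apply: contraNneq uM' => n0; rewrite -E n0 mul0r.
  by apply: (mulfI n0); rewrite divff // mulrCA E mulVf.
under eq_bigr do rewrite termE.
rewrite -mulr_sumr mulrC; congr (_ * _).
rewrite exchange_big /= (bigD1 (Ordinal M0)) //= [X in _ + X]big1 ?addr0.
  under eq_bigr do rewrite muln0 !expr0 mulr1.
  by rewrite sumr_const card_ord.
move=> j j0; rewrite -mulr_sumr.
have wj : w ^+ j != 1.
  apply: contra j0 => /eqP wj; rewrite -val_eqE /=.
  by have := prim_order_dvd pw j; rewrite wj eqxx => /dvdnP[[|m] e] //; have := ltn_ord j; rewrite e; nia.
have -> : \sum_(k < M) w ^+ (k * j) = \sum_(k < M) (w ^+ j) ^+ k.
  by apply: eq_bigr => k _; rewrite -exprM mulnC.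
suff -> : \sum_(k < M) (w ^+ j) ^+ k = 0 by rewrite mulr0.
apply: (mulfI (_ : w ^+ j - 1 != 0)); first by rewrite subr_eq0.
by rewrite -subrX1 mulr0 -exprM mulnC exprM (prim_expr_order pw) expr1n subrr.
Qed.

Lemma omegaV_prim N : (2 ^ N).-primitive_root (omega R N)^-1.
Proof.
have -> : (omega R N)^-1 = (omega R N)^*.
  by rewrite conjcV_circle ?cis_neq0 // cmod_cis expr1n mul1r.
by rewrite fmorph_primitive_root omega_prim.
Qed.

Lemma mean_cauchy_kernel N (r : R) z : 0 < r -> cmod z < r ->
  circle_mean N r (cauchy_kernel z) = (1 - (z / r%:C%C) ^+ (2 ^ N))^-1.
Proof.
move=> r0 zr; have r0' : r%:C%C != 0 by rewrite -cmod_eq0 cmod_real normr_eq0 gt_eqF.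
have uM : (z / r%:C%C) ^+ (2 ^ N) != 1.
  apply/eqP => /(congr1 (@cmod R)); rewrite cmodX cmod1 cmodM cmodV cmod_real gtr0_norm //.
  have : cmod z / r < 1 by rewrite ltr_pdivrMr ?mul1r.
  have : 0 <= cmod z / r by rewrite divr_ge0 ?cmod_ge0 // ltW.
  move=> h0 h1 e; have : (cmod z / r) ^+ (2 ^ N) < 1 by rewrite exprn_ilt1 // expn_eq0.
  by rewrite e ltxx.
rewrite /circle_mean -[RHS](mulKf (pow2C_neq0 N)); congr (_ * _).
rewrite -(sum_geometric_roots (omegaV_prim N) uM); apply: eq_bigr => k _.
rewrite /cauchy_kernel; congr (1 - _)^-1.
by rewrite invfM exprVn mulrA.
Qed.

(** Summation by parts around the circle: the node x_k collects (x_(k+1) - x_(k-1)) / 2 = x_k (w -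
    w^-1) / 2, and (w - w^-1) / 2 = i sin (2 pi / 2^N). *)
Lemma chord_sum_circle (K : C -> C) (r : R) N :
  chord_sum K (fun t => r%:C%C * cis (2 * pi * t)) 0 1 (2 ^ N) =
  'i%C * (sin (2 * pi / (2 ^ N)%:R))%:C%C *
    \sum_(k < 2 ^ N) (K (r%:C%C * omega R N ^+ k) * (r%:C%C * omega R N ^+ k)).
Proof.
set w := omega R N; pose x k := r%:C%C * w ^+ k; set M := (2 ^ N)%N.
have nodeE (k : nat) : r%:C%C * cis (2 * pi * (0 + (1 - 0) * k%:R / M%:R)) = x k.
  by rewrite subr0 mul1r add0r /x omegaX.
have w0 : w != 0 by exact: cis_neq0.
have isin : 'i%C * (sin (2 * pi / M%:R))%:C%C = (w - w^-1) / 2.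
  have -> : w^-1 = w^* by rewrite conjcV_circle // cmod_cis expr1n mul1r.
  by rewrite subcJ /=; field.
pose G k := K (x k) * (x k - x k * w^-1) / 2.
rewrite /chord_sum (eq_bigr (fun k : 'I_M => K (x k) * (x k.+1 - x k) / 2 + G k.+1)); last first.
  move=> k _; rewrite !nodeE /chord /G; have -> : x k.+1 * w^-1 = x k.
    by rewrite /x exprSr mulrA mulfK.
  by field.
rewrite big_split /=.
have -> : \sum_(k < M) G k.+1 = \sum_(k < M) G k.
  apply: (addrI (G 0%N)).
  rewrite -(big_ord_recl M (fun k => G k)) big_ord_recr /= addrC; congr (_ + _).
  by rewrite /G /x (prim_expr_order (omega_prim R N)) expr0.
rewrite -big_split isin mulr_sumr; apply: eq_bigr => k _ /=.
by rewrite /G -/(x k); have -> : x k.+1 = x k * w by [rewrite /x exprSr mulrA]; ring.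
Qed.

(** [goursat] is applied in polar coordinates to the difference quotient, which is merely continuous
    at z. The side s = 0 collapses to a point, the sides t = 0 and t = 1 coincide, and only the
    outer circle remains. The condition z <> 0 keeps the set of preimages of z finite; for z = 0 it
    would be a whole side. *)
Lemma mean_difference_quotient (F : C -> C) (r : R) z : 0 < r ->
  (forall x, cmod x <= r -> cdiff F x) -> z != 0 -> cmod z < r ->
  forall e : R, 0 < e -> exists N0, forall N, (N0 <= N)%N ->
  cmod (circle_mean N r (fun x => (F x - F z) * cauchy_kernel z x)) <= e.
Proof.
move=> r0 Fd z0 zr e e0.
have [v vP] := cdiffP (Fd z (ltW zr)).
pose K x := if x == z then v else (F x - F z) / (x - z).
pose g (s t : R) := (r * s)%:C%C * cis (2 * pi * t).
have p0 : 0 < pi :> R := pi_gt0 R.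
have cmod_g s t : 0 <= s -> cmod (g s t) = r * s.
  by move=> s0; rewrite cmodM cmod_cis mulr1 cmod_real ger0_norm // mulr_ge0 // ltW.
(* The factor r comes from s, and 4 pi r from t: 2 pi for the angle, times the constant 2 of
   [cis_lipschitz]. *)
pose L := r * (1 + 4 * pi).
have L0 : 0 < L by rewrite mulr_gt0 // addr_gt0 // mulr_gt0.
have gL (s t s' t' : R) : 0 <= s <= 1 -> 0 <= t <= 1 -> 0 <= s' <= 1 -> 0 <= t' <= 1 ->
    cmod (g s t - g s' t') <= L * (`|s - s'| + `|t - t'|).
  move=> /andP[s0 s1] _ /andP[s'0 s'1] _.
  have -> : g s t - g s' t' = (r * (s - s'))%:C%C * cis (2 * pi * t) +
      (r * s')%:C%C * (cis (2 * pi * t) - cis (2 * pi * t')).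
    by rewrite /g !rmorphM !rmorphB /=; ring.
  apply: le_trans (cmodD _ _) _; rewrite !cmodM cmod_cis mulr1 !cmod_real.
  rewrite !normrM !(ger0_norm (ltW r0)) (ger0_norm s'0) /L.
  have := cis_lipschitz (2 * pi * t) (2 * pi * t').
  rewrite -mulrBr normrM (ger0_norm (_ : 0 <= 2 * pi)); last by rewrite mulr_ge0 // ltW.
  have := normr_ge0 (s - s'); have := normr_ge0 (t - t').
  have := cmod_ge0 (cis (2 * pi * t) - cis (2 * pi * t')).
  move: (cmod _) (`|t - t'|) (`|s - s'|) => c a b c0 a0 b0 cle.
  rewrite -!mulrA -mulrDr ler_pM2l //.
  have : s' * c <= c by rewrite ler_piMl.
  have : 0 <= pi * b by rewrite mulr_ge0 // ltW.
  nra.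
clearbody L.
(* The modulus of z determines s, and z determines t modulo 1; inside the unit square all preimages
   are thus among one of them and its two translates in t. *)
pose X : seq (R * R) := if pselect (exists q : R * R, [/\ 0 <= q.1, 0 <= q.2 <= 1 & g q.1 q.2 = z])
  is left h then let q := projT1 (cid h) in [:: q; (q.1, q.2 + 1); (q.1, q.2 - 1)] else [::].
have Xmem s t : 0 <= s -> 0 <= t <= 1 -> g s t = z -> (s, t) \in X.
  move=> s0 t01 gst; rewrite /X; case: pselect => [h|[]]; last by exists (s, t).
  case: (cid h) => -[s' t'] /= [s'0 t'01 gst'].
  have ss' : s = s'.
    by apply: (mulfI (lt0r_neq0 r0)); rewrite -(cmod_g s t) // -(cmod_g s' t') // gst gst'.
  have rs0 : (r * s)%:C%C != 0.
    by apply: contraNneq z0 => rs; rewrite -gst /g rs mul0r.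
  have E : cis (2 * pi * t) = cis (2 * pi * t').
    by apply: (mulfI rs0); rewrite -/(g s t) gst -gst' /g ss'.
  have tt' : `|t - t'| <= 1 by rewrite ler_norml; lra.
  rewrite ss'; have [->|->|->] := cis_inj tt' E;
  by rewrite !inE !eqxx ?orbT.
have Kg (s t : R) : 0 <= s <= 1 -> 0 <= t <= 1 ->
  (exists v : C, forall e : R, 0 < e -> exists2 d : R, 0 < d & forall s' t' : R,
     0 <= s' <= 1 -> 0 <= t' <= 1 -> `|s' - s| < d -> `|t' - t| < d ->
     cmod (K (g s' t') - K (g s t) - v * (g s' t' - g s t)) <=
       e * (`|s' - s| + `|t' - t|)) \/
  ((s, t) \in X /\ forall e : R, 0 < e -> exists2 d : R, 0 < d & forall s' t' : R,
     0 <= s' <= 1 -> 0 <= t' <= 1 -> `|s' - s| < d -> `|t' - t| < d ->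
     cmod (K (g s' t') - K (g s t)) <= e).
  move=> s01 t01.
  have near_g (d : R) : 0 < d -> exists2 d' : R, 0 < d' & forall s' t' : R,
      0 <= s' <= 1 -> 0 <= t' <= 1 -> `|s' - s| < d' -> `|t' - t| < d' ->
      cmod (g s' t' - g s t) < d.
    move=> d0; exists (d / (2 * L)); first by rewrite divr_gt0 // mulr_gt0.
    move=> s' t' s'01 t'01 sd td; apply: le_lt_trans (gL _ _ _ _ _ _ _ _) _ => //.
    move: sd td; rewrite !ltr_pdivlMr ?mulr_gt0 //.
    by move: (`|s' - s|) (`|t' - t|) => a b; nra.
  have [gz|gz] := eqVneq (g s t) z.
    right; split; first by apply: Xmem => //; case/andP: s01.
    move=> e1 e10; have [d d0 dP] := vP _ e10; have [d' d'0 d'P] := near_g _ d0.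
    exists d' => // s' t' s'01 t'01 sd td.
    have := dP _ (_ : cmod (g s' t' - z) < d); rewrite -{1}gz => /(_ (d'P _ _ s'01 t'01 sd td)).
    rewrite gz /K eqxx; case: eqVneq => [_ _|wz]; first by rewrite subrr cmod0 ltW.
    have wz0 : g s' t' - z != 0 by rewrite subr_eq0.
    rewrite (_ : (F (g s' t') - F z) / (g s' t' - z) - v =
      (F (g s' t') - F z - v * (g s' t' - z)) / (g s' t' - z)); last by field.
    by rewrite cmodM cmodV ler_pdivrMr ?cmod_gt0.
  left; pose Q x := (F x - F z) / (x - z).
  have gr : cmod (g s t) <= r.
    by rewrite cmod_g; [rewrite ler_piMr; lra|lra].
  have /cdiffP[u uP] : cdiff Q (g s t).
    apply: cdiffM; first by apply: cdiffB; [exact: Fd|exact: cdiff_cst].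
    apply: cdiffV; first by rewrite subr_eq0.
    by apply: cdiffB; [exact: cdiff_id|exact: cdiff_cst].
  exists u => e1 e10; have e2 : 0 < e1 / L by rewrite divr_gt0.
  have [d d0 dP] := uP _ e2.
  have gz0 : 0 < cmod (g s t - z) by rewrite cmod_gt0 subr_eq0.
  have [d1 d10 d1P] := near_g _ d0; have [d2 d20 d2P] := near_g _ gz0.
  exists (Num.min d1 d2); first by rewrite lt_min d10.
  move=> s' t' s'01 t'01; rewrite !lt_min => /andP[sd1 sd2] /andP[td1 td2].
  have wz : g s' t' != z.
    by apply: contraTneq (d2P _ _ s'01 t'01 sd2 td2) => ->; rewrite -cmodN opprB ltxx.
  rewrite /K (negbTE gz) (negbTE wz); apply: le_trans (dP _ (d1P _ _ s'01 t'01 sd1 td1)) _.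
  apply: le_trans (ler_wpM2l (ltW e2) (gL _ _ _ _ _ _ _ _)) _ => //.
  by rewrite mulrA divfK // gt_eqF.
(* The factor 4 matches [sin_omega_ge]: a bound 4 e on sin (2 pi / 2^N) |S| gives |S| <= 2^N e. *)
have [N0 N0P] := goursat L0 gL Kg (mulr_gt0 (ltr0n R 4) e0).
exists (N0 + 2)%N => N NN; have N0N : (N0 <= N)%N by apply: leq_trans NN; rewrite leq_addr.
have N2 : (2 <= N)%N by apply: leq_trans NN; rewrite leq_addl.
pose S := \sum_(k < 2 ^ N) K (r%:C%C * omega R N ^+ k) * (r%:C%C * omega R N ^+ k).
have -> : circle_mean N r (fun x => (F x - F z) * cauchy_kernel z x)
    = (2 ^ N)%:R^-1 * S.
  congr (_ * _); apply: eq_bigr => k _; set x := r%:C%C * _.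
  have xr : cmod x = r by rewrite cmod_node // ltW.
  have x0 : x != 0 by rewrite -cmod_eq0 xr gt_eqF.
  have xz : x != z by apply: contraTneq zr => <-; rewrite xr ltxx.
  rewrite /K (negbTE xz) /cauchy_kernel; field.
  by rewrite subr_eq0 xz x0.
have := N0P N N0N; rewrite /boundary_sum.
have -> : (fun s => g s 1) = (fun s => g s 0).
  by apply: funext => s; rewrite /g mulr1 mulr0 cis2pi cis0.
have -> : chord_sum K (g 0) 0 1 (2 ^ N) = 0.
  by rewrite /chord_sum big1 // => k _; rewrite /chord /g mulr0 !mul0r subrr mulr0.
rewrite subr0 addrAC subrr add0r.
have -> : g 1 = fun t => r%:C%C * cis (2 * pi * t) by apply: funext => t; rewrite /g mulr1.
rewrite chord_sum_circle -/S !cmodM cmod_real cmodV cmod_nat.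
have -> : cmod ('i%C : C) = 1 by rewrite /cmod /= expr0n expr1n add0r sqrtr1.
rewrite mul1r ler_pdivrMl ?pow2_gt0 //.
have s4 := sin_omega_ge R N2; have W := pow2_gt0 N.
rewrite ger0_norm.
  have := cmod_ge0 S; move: (sin _) s4 (cmod S) => s s4 c c0 h.
  nra.
by rewrite -(pmulr_rge0 _ W) (le_trans _ s4).
Qed.

End CauchyFormula.

(** * Uniform error bounds in Cauchy's formula and the maximum modulus principle *)

Section UniformCauchy.
Variable R : realType.
Local Notation C := R[i].

Definition ctends (a : nat -> C) (l : C) := forall e : R, 0 < e ->
  exists N0, forall N, (N0 <= N)%N -> cmod (a N - l) <= e.

Lemma ctends_cst l : ctends (fun=> l) l.
Proof. by move=> e e0; exists 0%N => N _; rewrite subrr cmod0 ltW. Qed.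

Lemma ctendsD a b l m : ctends a l -> ctends b m -> ctends (fun N => a N + b N) (l + m).
Proof.
move=> al bm e e0; have e2 : 0 < e / 2 by lra.
have [N1 P1] := al _ e2; have [N2 P2] := bm _ e2.
exists (N1 + N2)%N => N NN; rewrite opprD addrACA.
apply: le_trans (cmodD _ _) _; rewrite [e]splitr; apply: lerD.
  by apply: P1; lia.
by apply: P2; lia.
Qed.

Lemma ctendsZ c a l : ctends a l -> ctends (fun N => c * a N) (c * l).
Proof.
move=> al e e0; have k0 : 0 < 1 + cmod c by rewrite ltr_pwDl // cmod_ge0.
have [N0 NP] := al _ (divr_gt0 e0 k0); exists N0 => N /NP.
rewrite -mulrBr cmodM ler_pdivlMr // => h; have := cmod_ge0 (a N - l); nra.
Qed.

Lemma ctendsN a l : ctends a l -> ctends (fun N => - a N) (- l).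
Proof.
move=> /(ctendsZ (-1)); rewrite mulN1r; congr ctends.
by apply: funext => N; rewrite mulN1r.
Qed.

Lemma ctends_sum I (s : seq I) (a : I -> nat -> C) l :
  (forall i, ctends (a i) (l i)) ->
  ctends (fun N => \sum_(i <- s) a i N) (\sum_(i <- s) l i).
Proof.
move=> al; elim: s => [|i s IH].
  by rewrite big_nil; under eq_fun do rewrite big_nil; exact: ctends_cst.
by rewrite big_cons; under eq_fun do rewrite big_cons; exact: ctendsD.
Qed.

Lemma ctends_le a l (B : R) : (forall N, cmod (a N) <= B) -> ctends a l -> cmod l <= B.
Proof.
move=> aB al; apply/ler_addgt0Pr => e e0; have [N /(_ N (leqnn N)) NP] := al e e0.
have -> : l = a N - (a N - l) by ring.
by apply: le_trans (cmodB _ _) _; apply: lerD.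
Qed.

Lemma cmod_inv1B_le (v : C) (s : R) : cmod v <= s -> s < 1 ->
  cmod (1 - v)^-1 <= (1 - s)^-1.
Proof.
move=> vs s1; have h : 1 - s <= cmod (1 - v).
  by have := cmodD (1 - v) v; rewrite subrK cmod1; lra.
have s0 : 0 < 1 - s by lra.
by rewrite cmodV lef_pV2 ?posrE //; exact: lt_le_trans h.
Qed.

Lemma cauchy_limit (F : C -> C) (r : R) z : 0 < r ->
  (forall x, cmod x <= r -> cdiff F x) -> z != 0 -> cmod z < r ->
  ctends (fun N => circle_mean N r (fun x => F x * cauchy_kernel z x)) (F z).
Proof.
move=> r0 Fd z0 zr.
have T1 : ctends (fun N => circle_mean N r (fun x => (F x - F z) * cauchy_kernel z x)) 0.
  by move=> e e0; have [N0 NP] := mean_difference_quotient r0 Fd z0 zr e0;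
     exists N0 => N /NP; rewrite subr0.
suff T2 : ctends (fun N => circle_mean N r (cauchy_kernel z)) 1.
  have := ctendsD T1 (ctendsZ (F z) T2); rewrite add0r mulr1.
  under eq_fun do rewrite -circle_meanZ -circle_meanD.
  by congr ctends; apply: funext => N; congr circle_mean; apply: funext => x; ring.
have u1 : 0 <= cmod z / r < 1.
  by rewrite divr_ge0 ?cmod_ge0 ?ltW //= ltr_pdivrMr ?mul1r.
move=> e e0; pose d := Num.min (2^-1) (e / 2).
have d0 : 0 < d by rewrite lt_min; apply/andP; split; lra.
have [N0 NP] := expr_small u1 d0; exists N0 => N NN.
rewrite mean_cauchy_kernel //; set u := _ ^+ _.
have ud : cmod u <= d.
  rewrite /u cmodX cmodM cmodV cmod_real gtr0_norm //; apply: NP.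
  by apply: leq_trans NN _; apply/ltnW/ltn_expl.
have [d1 d2] : d <= 2^-1 /\ d <= e / 2 by rewrite !ge_min !lexx orbT.
have n0 : 1 - u != 0.
  by rewrite subr_eq0 eq_sym; apply: contraTneq ud => ->; rewrite cmod1 -ltNge; lra.
rewrite (_ : _ - 1 = u * (1 - u)^-1); last by field.
rewrite cmodM; have := cmod_inv1B_le (le_trans ud d1) ltac:(lra).
rewrite (_ : (1 - 2^-1)^-1 = 2 :> R); last by field.
have := cmod_ge0 u; have := cmod_ge0 (1 - u)^-1; nra.
Qed.

(** The Goursat argument gives no rate. Writing F on the circle of radius r by its Cauchy formula on
    the larger circle rho turns the error into a limit of means of F(y) (A(y) - k_z(y)), k_z being
    the kernel at z; here A is known in closed form, and its distance to k_z is of order s^(2^N). *)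
Lemma cauchy_uniform_neq0 (F : C -> C) (rho r s B : R) z N :
  0 < rho -> 0 < r -> 0 < s < 1 -> r <= s * rho -> cmod z <= s * r -> z != 0 ->
  (forall x, cmod x <= rho -> cdiff F x) ->
  (forall x, cmod x = rho -> cmod (F x) <= B) ->
  cmod (circle_mean N r (fun x => F x * cauchy_kernel z x) - F z) <=
    2 * B * s ^+ (2 ^ N) / (1 - s) ^+ 2.
Proof.
move=> rho0 r0 /andP[s0 s1] rs zs z0 Fd FB; set M := (2 ^ N)%N.
have rrho : r < rho by apply: le_lt_trans rs _; rewrite gtr_pMl.
have zr : cmod z < r by apply: le_lt_trans zs _; rewrite gtr_pMl.
have sM : s ^+ M <= s by rewrite -[leRHS]expr1 ler_wiXn2l ?expn_gt0 // ltW.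
have sM0 : 0 <= s ^+ M by rewrite exprn_ge0 // ltW.
pose A y := circle_mean N r (fun x => cauchy_kernel x y * cauchy_kernel z x).
pose b N' := circle_mean N' rho (fun y => F y * (A y - cauchy_kernel z y)).
have bT : ctends b (circle_mean N r (fun x => F x * cauchy_kernel z x) - F z).
  rewrite /b; under eq_fun => N'.
    rewrite (_ : (fun y => _) = fun y =>
      (2 ^ N)%:R^-1 * (\sum_(k < 2 ^ N) cauchy_kernel z (r%:C%C * omega R N ^+ k) *
         (F y * cauchy_kernel (r%:C%C * omega R N ^+ k) y)) - F y * cauchy_kernel z y); last first.
      apply: funext => y; rewrite /A /circle_mean mulrBr; congr (_ - _).
      by rewrite mulrCA; congr (_ * _); rewrite mulr_sumr; apply: eq_bigr => k _; ring.
    rewrite circle_meanB circle_meanZ circle_mean_sum.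
    under eq_bigr do rewrite circle_meanZ.
  over.
  apply: ctendsD; last first.
    by apply: ctendsN; apply: cauchy_limit => //; exact: lt_trans zr _.
  rewrite [X in ctends _ X]/circle_mean; apply: ctendsZ; apply: ctends_sum => k.
  rewrite [X in ctends _ X]mulrC; apply: ctendsZ; apply: cauchy_limit => //.
    by rewrite -cmod_eq0 cmod_node ?gt_eqF // ltW.
  by rewrite cmod_node // ltW.
apply: ctends_le bT => N'; apply: circle_mean_le => [|y yrho]; first exact: ltW.
have y0 : y != 0 by rewrite -cmod_eq0 yrho gt_eqF.
have rC : r%:C%C != 0 :> C by rewrite -cmod_eq0 cmod_real gtr0_norm // gt_eqF.
pose u := (r%:C%C / y) ^+ M; pose v := (z / r%:C%C) ^+ M.
have us : cmod u <= s ^+ M.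
  rewrite /u cmodX cmodM cmodV cmod_real (gtr0_norm r0) yrho.
  by apply: lerXn2r; rewrite ?nnegrE ?ler_pdivrMr ?divr_ge0 //; exact: ltW.
have vs : cmod v <= s ^+ M.
  rewrite /v cmodX cmodM cmodV cmod_real (gtr0_norm r0).
  by apply: lerXn2r; rewrite ?nnegrE ?ler_pdivrMr ?divr_ge0 ?cmod_ge0 //; exact: ltW.
have neq1 w : cmod w <= s ^+ M -> 1 - w != 0.
  move=> ws; rewrite subr_eq0 eq_sym; apply: contraTneq ws => ->.
  by rewrite cmod1 -ltNge; apply: le_lt_trans sM _.
have AE : A y - cauchy_kernel z y =
    cauchy_kernel z y * (u * (1 - u)^-1 + v * (1 - v)^-1).
  (* Partial fractions: with a = x / y and b = z / x, 1 / ((1 - a) (1 - b)) equals (1 / (1 - a) + 1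
     / (1 - b) - 1) / (1 - a b), and a b = z / y no longer depends on x. *)
  have -> : A y = circle_mean N r (fun x =>
      cauchy_kernel z y * (cauchy_kernel x y + cauchy_kernel z x - 1)).
    apply: eq_circle_mean => [|x xr]; first exact: ltW.
    have x0 : x != 0 by rewrite -cmod_eq0 xr gt_eqF.
    have n (a c : C) : cmod a < cmod c -> c - a != 0.
      by move=> ac; rewrite subr_eq0; apply: contraTneq ac => ->; rewrite ltxx.
    rewrite /cauchy_kernel; field.
    by rewrite x0 y0 !n ?xr ?yrho // (lt_trans zr).
  rewrite circle_meanZ circle_meanB circle_meanD circle_mean_cst.
  rewrite mean_cauchy_kernel // -/M -/v.
  have -> : circle_mean N r (fun x => cauchy_kernel x y) = (1 - u)^-1.
    rewrite /circle_mean -[RHS](mulKf (pow2C_neq0 R N)); congr (_ * _).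
    rewrite /u -(sum_geometric_roots (omega_prim R N)); last first.
      by have := neq1 _ us; rewrite subr_eq0 eq_sym.
    by apply: eq_bigr => k _; rewrite /cauchy_kernel mulrAC.
  by field; rewrite !neq1.
have B0 : 0 <= B by apply: le_trans (FB _ yrho); exact: cmod_ge0.
have s10 : 0 < 1 - s by lra.
have kz : cmod (cauchy_kernel z y) <= (1 - s)^-1.
  apply: cmod_inv1B_le => //; rewrite cmodM cmodV yrho ler_pdivrMr //.
  by apply: le_trans (ltW zr) _; apply: le_trans rs _.
have term w : cmod w <= s ^+ M -> cmod (w * (1 - w)^-1) <= s ^+ M / (1 - s).
  move=> ws; rewrite cmodM; apply: ler_pM; rewrite ?cmod_ge0 //.
  by apply: cmod_inv1B_le => //; exact: le_trans ws sM.
rewrite AE !cmodM.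
have -> : 2 * B * s ^+ M / (1 - s) ^+ 2 =
    B * ((1 - s)^-1 * (s ^+ M / (1 - s) + s ^+ M / (1 - s))).
  by field; rewrite gt_eqF.
apply: ler_pM; rewrite ?mulr_ge0 ?cmod_ge0 //; first exact: FB.
apply: ler_pM; rewrite ?cmod_ge0 //.
by apply: le_trans (cmodD _ _) _; apply: lerD; exact: term.
Qed.

Lemma cauchy_uniform (F : C -> C) (rho r s B : R) z N :
  0 < rho -> 0 < r -> 0 < s < 1 -> r <= s * rho -> cmod z <= s * r ->
  (forall x, cmod x <= rho -> cdiff F x) ->
  (forall x, cmod x = rho -> cmod (F x) <= B) ->
  cmod (circle_mean N r (fun x => F x * cauchy_kernel z x) - F z) <=
    2 * B * s ^+ (2 ^ N) / (1 - s) ^+ 2.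
Proof.
move=> rho0 r0 s01 rs zs Fd FB.
have [z0|z0] := eqVneq z 0; last exact: (@cauchy_uniform_neq0 _ rho).
set W := (X in _ <= X); apply/ler_addgt0Pr => e e0; rewrite {z zs}z0.
have -> : circle_mean N r (fun x => F x * cauchy_kernel 0 x) = circle_mean N r F.
  by congr circle_mean; apply: funext => x; rewrite /cauchy_kernel mul0r subr0 invr1 mulr1.
have e2 : 0 < e / 2 by lra.
have [d d0 dP] := cdiff_continuous (Fd 0 ltac:(by rewrite cmod0 ltW)) e2.
pose S := \sum_(k < 2 ^ N) cmod (F (r%:C%C * omega R N ^+ k)).
have S0 : 0 <= S by apply: sumr_ge0 => k _; exact: cmod_ge0.
have /andP[s0 s1] := s01; have sr0 : 0 < s * r by rewrite mulr_gt0.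
(* The case z = 0 is reached from a small positive t: s r admits [cauchy_uniform_neq0], d / 2
   controls F, r / 2 bounds the kernel by 2, and the last term makes the change of the mean at most
   e / 2. *)
pose t := Num.min (Num.min (s * r) (d / 2)) (Num.min (r / 2) (e * r / (4 * (1 + S)))).
have S1 : 0 < 4 * (1 + S) by lra.
have t0 : 0 < t.
  by rewrite !lt_min sr0 (divr_gt0 (mulr_gt0 e0 r0) S1) (divr_gt0 d0) ?(divr_gt0 r0).
have [tsr td tr te] : [/\ t <= s * r, t <= d / 2, t <= r / 2 & t <= e * r / (4 * (1 + S))].
  by rewrite /t !ge_min !lexx !orbT.
have ct : cmod (t%:C%C : C) = t by rewrite cmod_real gtr0_norm.
have := @cauchy_uniform_neq0 F rho r s B t%:C%C N rho0 r0 s01 rs.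
rewrite ct -cmod_eq0 ct gt_eqF // => /(_ tsr isT Fd FB) h.
have h2 := dP t%:C%C; rewrite subr0 ct in h2.
have {}h2 : cmod (F t%:C%C - F 0) <= e / 2 by apply: h2; lra.
have h3 : cmod (circle_mean N r F - circle_mean N r (fun x => F x * cauchy_kernel t%:C%C x)) <= e / 2.
  rewrite -circle_meanB cmodM cmodV cmod_nat ler_pdivrMl ?pow2_gt0 //.
  apply: le_trans (cmod_sum _ _ _) _.
  apply: (@le_trans _ _ (S * (e / (2 * (1 + S))))); last first.
    have M1 : 1 <= (2 ^ N)%:R :> R by rewrite ler1n expn_gt0.
    have -> : S * (e / (2 * (1 + S))) = (S / (1 + S)) * (e / 2).
      by field; rewrite gt_eqF //; lra.
    have : S / (1 + S) <= 1 by rewrite ler_pdivrMr; lra.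
    have : 0 <= S / (1 + S) by rewrite divr_ge0 //; lra.
    nra.
  rewrite mulr_suml; apply: ler_sum => k _; set x := _ * _.
  have xr : cmod x = r by rewrite cmod_node // ltW.
  have x0 : x != 0 by rewrite -cmod_eq0 xr gt_eqF.
  rewrite -[F x in X in X - _]mulr1 -mulrBr cmodM ler_wpM2l ?cmod_ge0 //.
  have n0 : 1 - t%:C%C / x != 0.
    have h1 : cmod (t%:C%C / x) <= 2^-1.
      by rewrite cmodM cmodV ct xr ler_pdivrMr //; lra.
    rewrite subr_eq0 eq_sym; apply: contraTneq h1 => ->; rewrite cmod1 -ltNge; lra.
  have -> : 1 - cauchy_kernel t%:C%C x = - (t%:C%C / x) * (1 - t%:C%C / x)^-1.
    by rewrite /cauchy_kernel; field; rewrite x0 subr_eq0 eq_sym; move: n0;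
      rewrite subr_eq0; apply: contraNneq => ->; rewrite divff.
  rewrite cmodM cmodN cmodM cmodV ct xr.
  have := @cmod_inv1B_le (t%:C%C / x) 2^-1.
  rewrite cmodM cmodV ct xr ler_pdivrMr // => /(_ ltac:(lra) ltac:(lra)).
  rewrite (_ : (1 - 2^-1)^-1 = 2 :> R); last by field.
  move=> h4; apply: le_trans (_ : t / r * 2 <= _).
    by rewrite ler_wpM2l // divr_ge0 // ltW.
  move: te; rewrite !ler_pdivlMr ?mulr_gt0 // ?ltr_pwDl //.
  have -> : t / r * 2 * (2 * (1 + S)) = t * (4 * (1 + S)) / r by field; rewrite gt_eqF.
  by rewrite ler_pdivrMr.
have -> : circle_mean N r F - F 0 = (circle_mean N r F - circle_mean N r (fun x => F x * cauchy_kernel t%:C%C x)) + ((circle_mean N r (fun x => F x * cauchy_kernel t%:C%C x) - F t%:C%C) + (F t%:C%C - F 0)) by ring.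
apply: le_trans (cmodD _ _) _; rewrite [e]splitr [W + _]addrCA lerD //.
by apply: le_trans (cmodD _ _) _; rewrite lerD.
Qed.

(** Cauchy's formula for F^k yields |F z|^k <= B^k / (1 - |z| / r). The constant does not depend on
    k, so large k rules out |F z| > B. The value at 0 follows by continuity. *)
Lemma maximum_modulus (F : C -> C) (r B : R) z : 0 < r -> 0 < B ->
  (forall x, cmod x <= r -> cdiff F x) ->
  (forall x, cmod x = r -> cmod (F x) <= B) ->
  cmod z < r -> cmod (F z) <= B.
Proof.
move=> r0 B0 Fd FB.
suff H w : w != 0 -> cmod w < r -> cmod (F w) <= B.
  move=> zr; have [z0|z0] := eqVneq z 0; last exact: H.
  apply/ler_addgt0Pr => e e0.
  have [d d0 dP] := cdiff_continuous (Fd z (ltW zr)) e0.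
  pose t := Num.min (r / 2) (d / 2).
  have t0 : 0 < t by rewrite lt_min !divr_gt0.
  have [tr td] : t <= r / 2 /\ t <= d / 2 by rewrite !ge_min !lexx orbT.
  have ct : cmod (t%:C%C : C) = t by rewrite cmod_real gtr0_norm.
  have h1 := H t%:C%C; rewrite -cmod_eq0 ct gt_eqF // in h1.
  have {}h1 : cmod (F t%:C%C) <= B by apply: h1 => //; lra.
  have h2 := dP t%:C%C; rewrite z0 subr0 ct -z0 in h2.
  have {}h2 : cmod (F t%:C%C - F z) <= e by apply: h2; lra.
  have -> : F z = F t%:C%C - (F t%:C%C - F z) by ring.
  by apply: le_trans (cmodB _ _) _; apply: lerD.
move=> w0 wr; rewrite leNgt; apply/negP => FwB.
have u1 : 0 <= B / cmod (F w) < 1.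
  have Fw0 : 0 < cmod (F w) by exact: lt_trans FwB.
  by rewrite divr_ge0 ?ltW //= ltr_pdivrMr ?mul1r.
have c0 : 0 < 1 - cmod w / r by rewrite subr_gt0 ltr_pdivrMr ?mul1r.
have c2 : 0 < (1 - cmod w / r) / 2 by rewrite divr_gt0.
have [k /(_ k (leqnn k)) kP] := expr_small u1 c2.
have Fdk x : cmod x <= r -> cdiff (fun y => F y ^+ k) x by move=> /Fd; exact: cdiffX.
have := cauchy_limit r0 Fdk w0 wr.
move=> /(@ctends_le _ _ (B ^+ k / (1 - cmod w / r))) => h.
have {}h : cmod (F w ^+ k) <= B ^+ k / (1 - cmod w / r).
  apply: h => N; apply: circle_mean_le => [|x xr]; first exact: ltW.
  rewrite cmodM; apply: ler_pM; rewrite ?cmod_ge0 //.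
    by rewrite cmodX lerXn2r ?nnegrE ?cmod_ge0 ?FB // ltW.
  apply: cmod_inv1B_le; first by rewrite cmodM cmodV xr.
  by rewrite -subr_gt0.
move: h; rewrite cmodX ler_pdivlMr // => h.
have Fk0 : 0 < cmod (F w) ^+ k by rewrite exprn_gt0 // (lt_trans B0).
move: kP; rewrite expr_div_n ler_pdivrMr // => kP; nra.
Qed.

End UniformCauchy.

(** * Polynomials and rational functions on the bidisc *)

Section RadialLimits.
Variable R : realType.
Local Notation C := R[i].

Definition rlim (G : R -> C) (l : C) := forall e : R, 0 < e ->
  exists2 d : R, 0 < d & forall r : R, 0 < r < 1 -> 1 - d < r -> cmod (G r - l) <= e.

Lemma rlim_cdiff F : cdiff F 1 -> rlim (fun r => F r%:C%C) (F 1).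
Proof.
move=> /cdiff_continuous Fc e e0; have [d d0 dP] := Fc e e0.
exists d => // r r01 dr; apply: dP.
rewrite -(rmorph1 (real_complex R)) -rmorphB cmod_real ltr_norml; lra.
Qed.

Lemma rlim_cst (c : C) : rlim (fun=> c) c.
Proof. by move=> e e0; exists 1 => // r _ _; rewrite subrr cmod0 ltW. Qed.

Lemma rlimB G G' l l' : rlim G l -> rlim G' l' -> rlim (fun r => G r - G' r) (l - l').
Proof.
move=> Gl Gl' e e0; have e2 : 0 < e / 2 by lra.
have [d d0 dP] := Gl _ e2; have [d' d'0 dP'] := Gl' _ e2.
exists (Num.min d d') => [|r r01]; first by rewrite lt_min d0.
rewrite ltrBlDr -ltrBlDl lt_min => /andP[h h'].
have -> : G r - G' r - (l - l') = (G r - l) - (G' r - l') by ring.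
apply: le_trans (cmodB _ _) _; rewrite [e]splitr lerD //.
  by apply: dP => //; lra.
by apply: dP' => //; lra.
Qed.

Lemma rlimM G G' l l' : rlim G l -> rlim G' l' -> rlim (fun r => G r * G' r) (l * l').
Proof.
move=> Gl Gl' e e0.
have c0 := cmod_ge0 l; have c0' := cmod_ge0 l'.
have k0 : 0 < 2 * (1 + cmod l + cmod l') by lra.
pose t := Num.min 1 (e / (2 * (1 + cmod l + cmod l'))).
have t0 : 0 < t by rewrite lt_min ltr01 divr_gt0.
have [t1 te] : t <= 1 /\ t <= e / (2 * (1 + cmod l + cmod l')).
  by rewrite !ge_min !lexx orbT.
have [d d0 dP] := Gl _ t0; have [d' d'0 dP'] := Gl' _ t0.
exists (Num.min d d') => [|r r01]; first by rewrite lt_min d0.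
rewrite ltrBlDr -ltrBlDl lt_min => /andP[h h'].
have {}h := dP r r01 ltac:(lra); have {}h' := dP' r r01 ltac:(lra).
have -> : G r * G' r - l * l' =
  (G r - l) * (G' r - l') + l * (G' r - l') + l' * (G r - l) by ring.
apply: le_trans (cmodD _ _) _; apply: le_trans (lerD (cmodD _ _) (lexx _)) _.
rewrite !cmodM; move: te; rewrite ler_pdivlMr //.
have := cmod_ge0 (G r - l); have := cmod_ge0 (G' r - l'); nra.
Qed.

Lemma rlimJ G l : rlim G l -> rlim (fun r => (G r)^*) l^*.
Proof.
move=> Gl e /Gl[d d0 dP]; exists d => // r r01 dr.
by rewrite -rmorphB cmodJ; exact: dP.
Qed.

Lemma rlim_Re_ge0 G l : rlim G l -> (forall r, 0 < r < 1 -> 0 <= complex.Re (G r)) ->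
  0 <= complex.Re l.
Proof.
move=> Gl G0; apply/ler_addgt0Pr => e e0; have [d d0 dP] := Gl e e0.
pose r : R := 1 - Num.min d 1 / 2.
have m : 0 < Num.min d 1 <= 1 by rewrite lt_min d0 ltr01 /= ge_min lexx orbT.
have md : Num.min d 1 <= d by rewrite ge_min lexx.
have r01 : 0 < r < 1 by rewrite /r; lra.
have := le_trans (Re_le_cmod _) (dP r r01 ltac:(rewrite /r; lra)).
by have := G0 r r01; rewrite ReB ler_norml; lra.
Qed.

Lemma rlim_cmod_le G G' l l' : rlim G l -> rlim G' l' ->
  (forall r, 0 < r < 1 -> cmod (G r) <= cmod (G' r)) -> cmod l <= cmod l'.
Proof.
move=> Gl Gl' GG'; have := rlimB (rlimM Gl' (rlimJ Gl')) (rlimM Gl (rlimJ Gl)).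
move=> /rlim_Re_ge0 h; rewrite -(@ler_pXn2r _ 2) ?nnegrE ?cmod_ge0 //.
rewrite -subr_ge0; move: h; rewrite !mulcJ -rmorphB /=; apply => r r01.
by rewrite !mulcJ -rmorphB /= subr_ge0 lerXn2r ?nnegrE ?cmod_ge0 ?GG'.
Qed.

End RadialLimits.

Section Specialization.
Variable R : realType.
Local Notation C := R[i].
Implicit Types p q : {poly {poly C}}.

Definition specialize (y : C) p : {poly C} := map_poly (horner_eval y) p.

Lemma specializeE y p x : (specialize y p).[x] = p.[x, y].
Proof.
rewrite /specialize -[x in LHS](hornerC x y) -[x%:P.[y]]/(horner_eval y x%:P).
by rewrite horner_map.
Qed.

Lemma coef_specialize y p i : (specialize y p)`_i = (p`_i).[y].
Proof. by rewrite coef_map. Qed.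

Lemma size_specialize y p : (size (specialize y p) <= size p)%N.
Proof. by rewrite /specialize /map_poly size_poly. Qed.

Lemma specializeM b p q : specialize b (p * q) = specialize b p * specialize b q.
Proof. exact: rmorphM. Qed.

Lemma specializeZ b (c : {poly C}) p : specialize b (c *: p) = c.[b] *: specialize b p.
Proof. exact: map_polyZ. Qed.

Lemma specialize_factor b p : specialize b p = 0 ->
  exists2 p', p = ('X - b%:P) *: p' & size p' = size p.
Proof.
move=> p0; have lin0 : 'X - b%:P != 0 :> {poly C} by rewrite polyXsubC_eq0.
pose p' := \poly_(i < size p) (p`_i %/ ('X - b%:P)); have pE : p = ('X - b%:P) *: p'.
  apply/polyP => i; rewrite coefZ coef_poly; case: ltnP => [_|ip].
    rewrite mulrC divpK // dvdp_XsubCl /root -coef_specialize p0 coef0 //.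
  by rewrite mulr0 nth_default.
by exists p' => //; rewrite [in RHS]pE size_scale.
Qed.

End Specialization.

Section Bivariate.
Variable R : realType.
Local Notation C := R[i].
Implicit Types p : {poly {poly C}}.

Lemma horner2_MXaddC (p : {poly {poly C}}) (c : {poly C}) (x y : C) :
  (p * 'X + c%:P).[x, y] = p.[x, y] * x + c.[y].
Proof. by rewrite hornerMXaddC hornerD hornerM hornerC. Qed.

Lemma differentiable_horner2 (V : normedModType C) p (F G : V -> C^o) (z : V) :
  differentiable F z -> differentiable G z ->
  differentiable (fun z => p.[F z, G z] : C^o) z.
Proof.
move=> dF dG; elim/poly_ind: p => [|p c IH].
  by under eq_fun do rewrite !horner0; exact: differentiable_cst.
under eq_fun do rewrite horner2_MXaddC.
apply: differentiableD; first exact: differentiableM.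
elim/poly_ind: c => [|c a IHc].
  by under eq_fun do rewrite horner0; exact: differentiable_cst.
under eq_fun do rewrite hornerMXaddC.
by apply: differentiableD; [exact: differentiableM | exact: differentiable_cst].
Qed.

Lemma cdiff_horner2 p F G z : cdiff F z -> cdiff G z -> cdiff (fun z : C => p.[F z, G z]) z.
Proof. exact: differentiable_horner2. Qed.

Lemma rlim_horner2_l p (x y : C) : rlim (fun r => p.[r%:C%C * x, y]) p.[x, y].
Proof.
have := @rlim_cdiff R (fun l => p.[l * x, y]); rewrite mul1r; apply.
apply: cdiff_horner2; last exact: cdiff_cst.
by apply: cdiffM; [exact: cdiff_id|exact: cdiff_cst].
Qed.

Lemma rlim_horner2_r p (x y : C) : rlim (fun r => p.[x, r%:C%C * y]) p.[x, y].
Proof.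
have := @rlim_cdiff R (fun l => p.[x, l * y]); rewrite mul1r; apply.
apply: cdiff_horner2; first exact: cdiff_cst.
by apply: cdiffM; [exact: cdiff_id|exact: cdiff_cst].
Qed.

Lemma fst_differentiable (z : C^o * C^o) : differentiable (fst : C^o * C^o -> C^o) z.
Proof.
have H := @linear_differentiable C (C^o * C^o)%type C^o fst z.
by apply: H => w; exact: cvg_fst.
Qed.

Lemma snd_differentiable (z : C^o * C^o) : differentiable (snd : C^o * C^o -> C^o) z.
Proof.
have H := @linear_differentiable C (C^o * C^o)%type C^o snd z.
by apply: H => w; exact: cvg_snd.
Qed.

Lemma cdiff_slice (f : C * C -> C) F G z :
  differentiable (f : C^o * C^o -> C^o) (F z, G z) -> cdiff F z -> cdiff G z ->
  cdiff (fun w => f (F w, G w)) z.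
Proof.
move=> df dF dG; apply: (differentiable_comp (f := fun w : C^o => (F w : C^o, G w : C^o))) => //.
exact: differentiable_pair.
Qed.

(** Restriction to a complex line through the origin, which reduces Schwarz's lemma on the bidisc to
    one variable. *)
Lemma diagonal_poly p (a b : C) : exists P : {poly C}, forall l, P.[l] = p.[l * a, l * b].
Proof.
elim/poly_ind: p => [|p c [P IH]]; first by exists 0 => l; rewrite !horner0.
exists (P * (a *: 'X) + (c \Po (b *: 'X))) => l.
rewrite horner2_MXaddC -IH hornerD hornerM horner_comp !hornerZ !hornerX.
by rewrite (mulrC a) (mulrC b).
Qed.

Lemma horner2_bounded p : exists2 B : R, 0 < B & forall x y : C, cmod x <= 1 -> cmod y <= 1 ->
  cmod p.[x, y] <= B.
Proof.
elim/poly_ind: p => [|p c [B B0 IH]].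
  by exists 1 => // x y _ _; rewrite !horner0 cmod0.
have [D D0 HD] : exists2 D : R, 0 < D & forall y : C, cmod y <= 1 -> cmod c.[y] <= D.
  elim/poly_ind: c => [|c a [D D0 IHc]]; first by exists 1 => // y _; rewrite horner0 cmod0.
  exists (D + cmod a) => [|y y1]; first by rewrite ltr_pwDl // cmod_ge0.
  rewrite hornerMXaddC; apply: le_trans (cmodD _ _) _; rewrite lerD2r cmodM.
  by have := IHc y y1; have := cmod_ge0 c.[y]; have := cmod_ge0 y; nra.
exists (B + D) => [|x y x1 y1]; first exact: addr_gt0.
rewrite horner2_MXaddC; apply: le_trans (cmodD _ _) _; apply: lerD; last exact: HD.
rewrite cmodM; have := IH x y x1 y1; have := cmod_ge0 p.[x, y]; have := cmod_ge0 x; nra.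
Qed.

Lemma horner2_radial p : exists2 K : R, 0 < K & forall (x y : C) (r : R), cmod x = 1 -> cmod y = 1 ->
  0 <= r <= 1 -> cmod (p.[r%:C%C * x, r%:C%C * y] - p.[x, y]) <= K * (1 - r).
Proof.
have step (P Q x y : C) (K B r : R) : cmod x = 1 -> 0 <= r <= 1 ->
    cmod (P - Q) <= K * (1 - r) -> cmod Q <= B ->
    cmod (P * (r%:C%C * x) - Q * x) <= (K + B) * (1 - r).
  move=> x1 /andP[r0 r1] PQ QB.
  have -> : P * (r%:C%C * x) - Q * x = x * (r%:C%C * (P - Q) - (1 - r)%:C%C * Q).
    by rewrite rmorphB /= rmorph1; ring.
  rewrite cmodM x1 mul1r; apply: le_trans (cmodB _ _) _.
  rewrite !cmodM !cmod_real !ger0_norm ?subr_ge0 //.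
  by have := cmod_ge0 (P - Q); have := cmod_ge0 Q; nra.
elim/poly_ind: p => [|p c [K K0 IH]].
  by exists 1 => // x y r _ _ r01; rewrite !horner0 subrr cmod0; lra.
have [B B0 HB] := horner2_bounded p.
have [D D0 HD] : exists2 D : R, 0 < D & forall (y : C) (r : R), cmod y = 1 -> 0 <= r <= 1 ->
    cmod (c.[r%:C%C * y] - c.[y]) <= D * (1 - r).
  have Hc (d : {poly C}) : exists2 D : R, 0 < D & forall y : C, cmod y <= 1 -> cmod d.[y] <= D.
    have [D D0 HD] := horner2_bounded d%:P; exists D => // y y1.
    by have := HD 0 y; rewrite hornerC cmod0; apply.
  elim/poly_ind: c => [|c a [D D0 IHc]].
    by exists 1 => // y r _ r01; rewrite !horner0 subrr cmod0; lra.
  have [E E0 HE] := Hc c; exists (D + E) => [|y r y1 r01]; first exact: addr_gt0.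
  rewrite !hornerMXaddC opprD addrACA subrr addr0; apply: step => //; first exact: IHc.
  by apply: HE; rewrite y1.
exists (K + B + D) => [|x y r x1 y1 r01]; first by rewrite !addr_gt0.
rewrite !horner2_MXaddC opprD addrACA mulrDl; apply: le_trans (cmodD _ _) _.
apply: lerD; last exact: HD.
by apply: step => //; [exact: IH | apply: HB; rewrite ?x1 ?y1].
Qed.

Lemma circle_vanish (P : {poly C}) : (forall x : C, cmod x = 1 -> P.[x] = 0) -> P = 0.
Proof.
move=> H; apply/eqP/negPn/negP => P0.
have [N NP] : exists N, (size P <= 2 ^ N)%N by exists (size P); exact/ltnW/ltn_expl.
pose s := [seq omega R N ^+ k | k <- iota 0 (2 ^ N)].
have /= := max_poly_roots P0 (_ : all (root P) s) _; rewrite size_map size_iota.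
have -> : all (root P) s.
  by apply/allP => _ /mapP[k _ ->]; rewrite /root H ?eqxx // cmod_omegaX.
have -> : uniq s.
  rewrite map_inj_in_uniq ?iota_uniq // => i j; rewrite !mem_iota /= !add0n => iN jN /eqP.
  by rewrite (eq_prim_root_expr (omega_prim R N)) !modn_small // => /eqP.
by move=> /(_ isT isT); rewrite ltnNge NP.
Qed.

Lemma torus_vanish p : (forall x y : C, cmod x = 1 -> cmod y = 1 -> p.[x, y] = 0) -> p = 0.
Proof.
move=> H; apply/polyP => i; rewrite coef0; apply: circle_vanish => y y1.
rewrite -coef_specialize (_ : specialize y p = 0) ?coef0 //.
by apply: circle_vanish => x x1; rewrite specializeE; exact: H.
Qed.

End Bivariate.

(** * The rational inner function [pt / p] and its Cayley transform *)

Section Schur.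
Variable R : realType.
Local Notation C := R[i].
Variable p : {poly {poly C}}.
Local Notation pt := (reflection p).
Hypothesis p_neq0 : forall x y : C, cmod x < 1 -> cmod y < 1 -> p.[x, y] != 0.

Lemma conjc_circle (x : C) : cmod x = 1 -> x^* = x^-1.
Proof.
move=> x1; have x0 : x != 0 by rewrite -cmod_eq0 x1 oner_eq0.
by rewrite conjcV_circle // x1 expr1n mul1r.
Qed.

Lemma conjcR (r : R) : (r%:C%C)^* = r%:C%C :> C.
Proof. exact: conjc_real. Qed.

Lemma neq0_circle (r : R) (x : C) : 0 < r -> cmod x = r -> x != 0.
Proof. by move=> r0 xr; rewrite -cmod_eq0 xr gt_eqF. Qed.

Lemma neq0C (r : R) : 0 < r -> r%:C%C != 0 :> C.
Proof. by move=> r0; rewrite -cmod_eq0 cmod_real gtr0_norm // gt_eqF. Qed.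

Lemma reflection_scaled (x y : C) (r : R) : cmod x = 1 -> cmod y = 1 -> 0 < r ->
  r%:C%C ^+ (deg1 p + deg2 p) * pt.[x / r%:C%C, y / r%:C%C] =
  x ^+ deg1 p * y ^+ deg2 p * (p.[r%:C%C * x, r%:C%C * y])^*.
Proof.
move=> x1 y1 r0; have rn := neq0C r0.
have [x0 y0] := (neq0_circle ltr01 x1, neq0_circle ltr01 y1).
have inv (z : C) : cmod z = 1 -> ((z / r%:C%C)^*)^-1 = r%:C%C * z.
  by move=> z1; rewrite rmorphM fmorphV /= conjcR conjc_circle // -invfM invrK mulrC.
rewrite reflectionE ?mulf_neq0 ?invr_eq0 // !inv // !expr_div_n exprD.
move: (deg1 p) (deg2 p) (_^*) => m n c.
by field; rewrite !expf_neq0.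
Qed.

Lemma reflection_torus (x y : C) : cmod x = 1 -> cmod y = 1 ->
  pt.[x, y] = x ^+ deg1 p * y ^+ deg2 p * (p.[x, y])^*.
Proof.
move=> x1 y1; have := reflection_scaled x1 y1 ltr01.
by rewrite rmorph1 expr1n !mul1r !divr1.
Qed.

Lemma cmod_reflection_torus (x y : C) : cmod x = 1 -> cmod y = 1 ->
  cmod pt.[x, y] = cmod p.[x, y].
Proof.
by move=> x1 y1; rewrite reflection_torus // !cmodM !cmodX x1 y1 !expr1n !mul1r cmodJ.
Qed.

Lemma cmod_scale (r : R) (x : C) : 0 < r -> cmod (r%:C%C * x) = r * cmod x.
Proof. by move=> r0; rewrite cmodM cmod_real gtr0_norm. Qed.

(** Since p may vanish on the torus, [pt / p] need not extend continuously to it. Dilating p by r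
    and [pt] by 1 / r removes these zeros and, by [reflection_scaled], keeps modulus 1 on the torus.
    The maximum principle is applied in each variable separately, and then r tends to 1. *)
Lemma reflection_le (x y : C) : cmod x < 1 -> cmod y < 1 -> cmod pt.[x, y] <= cmod p.[x, y].
Proof.
move=> x1 y1.
pose F (r : R) (z w : C) := r%:C%C ^+ (deg1 p + deg2 p) * pt.[z / r%:C%C, w / r%:C%C] /
  p.[r%:C%C * z, r%:C%C * w].
have pr0 (r : R) (z w : C) : 0 < r < 1 -> cmod z <= 1 -> cmod w <= 1 ->
    p.[r%:C%C * z, r%:C%C * w] != 0.
  by move=> /andP[r0 r1] z1 w1; apply: p_neq0; rewrite cmod_scale //; nra.
have Fd (r : R) z w : 0 < r < 1 -> cmod z <= 1 -> cmod w <= 1 ->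
    cdiff (F r z) w /\ cdiff (fun z => F r z w) z.
  move=> r01 z1 w1; split; apply: cdiffM.
  - apply: cdiffM; [exact: cdiff_cst|apply: cdiff_horner2; first exact: cdiff_cst].
    by apply: cdiffM; [exact: cdiff_id|exact: cdiff_cst].
  - apply: cdiffV; first exact: pr0.
    apply: cdiff_horner2; first exact: cdiff_cst.
    by apply: cdiffM; [exact: cdiff_cst|exact: cdiff_id].
  - apply: cdiffM; [exact: cdiff_cst|apply: cdiff_horner2; last exact: cdiff_cst].
    by apply: cdiffM; [exact: cdiff_id|exact: cdiff_cst].
  - apply: cdiffV; first exact: pr0.
    apply: cdiff_horner2; last exact: cdiff_cst.
    by apply: cdiffM; [exact: cdiff_cst|exact: cdiff_id].
have F1 (r : R) z w : 0 < r < 1 -> cmod z = 1 -> cmod w = 1 -> cmod (F r z w) = 1.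
  move=> r01 z1 w1; have /andP[r0 _] := r01.
  rewrite /F reflection_scaled // !cmodM !cmodX z1 w1 !expr1n !mul1r cmodJ cmodV divff //.
  by rewrite cmod_eq0 pr0 ?z1 ?w1.
have F2 (r : R) z w : 0 < r < 1 -> cmod z < 1 -> cmod w = 1 -> cmod (F r z w) <= 1.
  move=> r01 z1 w1; apply: (@maximum_modulus R (fun z => F r z w) 1 1 z ltr01 ltr01 _ _ z1) => v v1.
    by have [] := Fd r v w r01 v1 ltac:(by rewrite w1).
  by rewrite F1.
have F3 (r : R) : 0 < r < 1 -> cmod (F r x y) <= 1.
  move=> r01; apply: (@maximum_modulus R (F r x) 1 1 y ltr01 ltr01 _ _ y1) => v v1; last exact: F2.
  by have [] := Fd r x v r01 (ltW x1) v1.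
pose A (l : C) := l ^+ (deg1 p + deg2 p) * pt.[x / l, y / l].
pose B (l : C) := p.[l * x, l * y].
have dl (c : C) : cdiff (fun l => c / l) 1.
  apply: cdiffM; [exact: cdiff_cst|apply: cdiffV; [exact: oner_neq0|exact: cdiff_id]].
have -> : pt.[x, y] = A 1 by rewrite /A expr1n mul1r !divr1.
have -> : p.[x, y] = B 1 by rewrite /B !mul1r.
apply: (@rlim_cmod_le _ (fun r => A r%:C%C) (fun r => B r%:C%C)).
- apply: rlim_cdiff; apply: cdiffM; first by apply: cdiffX; exact: cdiff_id.
  by apply: cdiff_horner2.
- apply: rlim_cdiff; apply: cdiff_horner2; apply: cdiffM; by [exact: cdiff_id|exact: cdiff_cst].
move=> r r01; have := F3 r r01; rewrite /F cmodM cmodV ler_pdivrMr ?mul1r //.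
by rewrite cmod_gt0 pr0 // ltW.
Qed.

Hypothesis refl0 : pt.[0, 0] = 0.

(** Schwarz's lemma on the line through (x, y): the numerator vanishes at l = 0, so it can be
    divided by l, and the maximum principle on a radius rho > 1 gains the factor 1 / rho. *)
Lemma reflection_lt (x y : C) : cmod x < 1 -> cmod y < 1 -> cmod pt.[x, y] < cmod p.[x, y].
Proof.
move=> x1 y1; have [P PE] := diagonal_poly pt x y.
have /factor_theorem[U UE] : root P 0 by rewrite /root PE !mul0r refl0.
pose m := Num.max (cmod x) (cmod y).
have m0 : 0 <= m by rewrite le_max cmod_ge0.
have m1 : m < 1 by rewrite gt_max x1.
have [xm ym] : cmod x <= m /\ cmod y <= m by rewrite !le_max !lexx orbT.
(* Both rho > 1 and rho m < 1 follow from m < 1, so the line stays in the bidisc up to |l| = rho. *)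
pose rho := 2 / (1 + m); have m10 : 0 < 1 + m by lra.
have rho1 : 1 < rho by rewrite ltr_pdivlMr //; lra.
have rhom : rho * m < 1 by rewrite mulrAC ltr_pdivrMr //; lra.
have rho0 : 0 < rho by lra.
have in_disc (l : C) z : cmod l <= rho -> cmod z <= m -> cmod (l * z) < 1.
  by move=> lr zm; rewrite cmodM; have := cmod_ge0 l; have := cmod_ge0 z; nra.
have pl0 l : cmod l <= rho -> p.[l * x, l * y] != 0.
  by move=> lr; apply: p_neq0; apply: in_disc.
have := @maximum_modulus R (fun l => U.[l] / p.[l * x, l * y]) rho rho^-1 1 rho0.
rewrite invr_gt0 rho0 cmod1 => /(_ isT) H.
have /= {H} : cmod (U.[1] / p.[1 * x, 1 * y]) <= rho^-1.
  apply: (H _ _ rho1) => l lr.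
    apply: cdiffM; first by apply: cdiff_horner; exact: cdiff_id.
    apply: cdiffV; first exact: pl0.
    by apply: cdiff_horner2; apply: cdiffM; by [exact: cdiff_id|exact: cdiff_cst].
  have l0 : l != 0 by rewrite (neq0_circle rho0).
  have -> : U.[l] = P.[l] / l.
    by rewrite UE hornerM hornerXsubC subr0 mulfK.
  rewrite PE !cmodM !cmodV lr ler_pdivrMr ?cmod_gt0 ?pl0 ?lr //.
  rewrite mulrC ler_wpM2l ?invr_ge0 ?(ltW rho0) //.
  by apply: reflection_le; apply: in_disc => //; rewrite lr.
rewrite !mul1r; have -> : U.[1] = pt.[x, y].
  by rewrite -[x in RHS]mul1r -[y in RHS]mul1r -PE UE hornerM hornerXsubC subr0 mulr1.
have p0 : 0 < cmod p.[x, y] by rewrite cmod_gt0 p_neq0.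
rewrite cmodM cmodV ler_pdivrMr // => h; apply: le_lt_trans h _.
by rewrite gtr_pMl // invf_lt1.
Qed.

Lemma difference_neq0 (x y : C) : cmod x < 1 -> cmod y < 1 -> (p - pt).[x, y] != 0.
Proof.
move=> x1 y1; rewrite !hornerE subr_eq0.
by apply: contraTneq (reflection_lt x1 y1) => ->; rewrite ltxx.
Qed.

Lemma Re_cayley (x y : C) : (p - pt).[x, y] != 0 ->
  complex.Re ((p + pt).[x, y] / (p - pt).[x, y]) =
  (cmod p.[x, y] ^+ 2 - cmod pt.[x, y] ^+ 2) / cmod (p - pt).[x, y] ^+ 2.
Proof.
move=> q0; rewrite [(p - pt).[x, y]]lock.
have E (a b : C) : a - b != 0 -> complex.Re ((a + b) / (a - b)) =
    (cmod a ^+ 2 - cmod b ^+ 2) / cmod (a - b) ^+ 2.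
  move=> ab; have c0 : cmod (a - b) ^+ 2 != 0 by rewrite expf_neq0 // cmod_eq0.
  have -> : (a + b) / (a - b) = ((cmod (a - b) ^+ 2)^-1)%:C%C * ((a + b) * (a - b)^*).
    have d0 : (a - b)^* != 0 by rewrite conjC_eq0.
    by rewrite fmorphV /= -mulcJ; move: (_^*) d0 => d d0; field; rewrite d0 ab.
  rewrite ReM_real mulrC; congr (_ / _).
  (* The cross terms form a number minus its conjugate, which has real part 0. *)
  have -> : (a + b) * (a - b)^* = (cmod a ^+ 2)%:C%C - (cmod b ^+ 2)%:C%C + (b * a^* - (b * a^*)^*).
    by rewrite -!mulcJ rmorphB rmorphM /= conjCK; ring.
  by rewrite ReD (ReB (b * a^*)) ReJ subrr addr0 ReB.
by rewrite -lock; move: q0; rewrite !hornerE => /E.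
Qed.

Lemma cayley_PRP2 :
  PRP2 (fun z : C * C => (p + pt).[z.1, z.2] / (p - pt).[z.1, z.2]).
Proof.
split=> [[x y] [/= x1 y1]|[x y] [/= x1 y1]|].
- rewrite !ltc1_cmod in x1 y1.
  have dh (P : {poly {poly C}}) : differentiable
      (fun z : C^o * C^o => P.[z.1, z.2] : C^o) ((x, y) : C^o * C^o).
    by apply: differentiable_horner2; [exact: fst_differentiable|exact: snd_differentiable].
  apply: differentiableM; first exact: dh.
  by apply: differentiableV; [exact: dh|exact: difference_neq0].
- rewrite !ltc1_cmod in x1 y1; rewrite Re_cayley ?difference_neq0 //.
  rewrite divr_gt0 ?exprn_gt0 ?cmod_gt0 ?difference_neq0 // subr_gt0.
  by rewrite ltrXn2r ?nnegrE ?cmod_ge0 ?reflection_lt.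
rewrite !hornerE refl0 addr0 subr0 divff //.
by apply: p_neq0; rewrite cmod0.
Qed.

End Schur.

(** * Polynomiality of a dominated numerator *)

Section DiscCompactness.
Variable R : realType.
Local Notation C := R[i].

(** Compactness of the closed disc in the form of an induction principle, obtained from
    [subdivision] on the circumscribed square. *)
Lemma disc_induction (rho : R) (B : (C -> Prop) -> Prop) : 0 < rho ->
  (forall S T : C -> Prop, (forall z, S z -> T z) -> B T -> B S) ->
  (forall S T, B S -> B T -> B (fun z => S z \/ T z)) ->
  (forall z, cmod z <= rho ->
     exists2 d : R, 0 < d & B (fun w => cmod (w - z) < d /\ cmod w <= rho)) ->
  B (fun w => cmod w <= rho).
Proof.
move=> rho0 Bsub BU Bloc.
pose pnt (s t : R) : C := ((rho * (2 * s - 1)) +i* (rho * (2 * t - 1)))%C.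
pose P x y h := B (fun w => cmod w <= rho /\
  exists s t, [/\ x <= s <= x + h, y <= t <= y + h & w = pnt s t]).
suff : P 0 0 1.
  apply: (Bsub _ _ _) => w wr; split=> //; have rn : rho != 0 by rewrite gt_eqF.
  have rng (a : R) : `|a| <= cmod w -> 0 <= (a / rho + 1) / 2 <= 0 + 1.
    move=> aw; have : `|a / rho| <= 1.
      by rewrite normrM normfV (gtr0_norm rho0) ler_pdivrMr ?mul1r // (le_trans aw).
    by rewrite ler_norml; lra.
  exists ((complex.Re w / rho + 1) / 2), ((complex.Im w / rho + 1) / 2).
  split; first exact/rng/Re_le_cmod.
    apply: rng; rewrite -(cmodN w).
    have := Re_le_cmod (w * 'i%C); rewrite ReiNIm normrN cmodM cmodN.
    by rewrite (_ : cmod ('i%C : C) = 1) ?mulr1 // /cmod /= expr0n expr1n add0r sqrtr1.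
  by case: w {wr rng} => a b; rewrite /pnt /=; congr Complex; field.
apply: subdivision => [x y h h0 H1 H2 H3 H4|s t _ _].
  apply: (Bsub _ _ _ (BU _ _ (BU _ _ H1 H2) (BU _ _ H3 H4))) => w [wr [s [t [sP tP wE]]]].
  have [sh|sh] := leP s (x + h / 2); have [th|th] := leP t (y + h / 2).
  - by left; left; split=> //; exists s, t; split=> //; lra.
  - by right; left; split=> //; exists s, t; split=> //; lra.
  - by left; right; split=> //; exists s, t; split=> //; lra.
  - by right; right; split=> //; exists s, t; split=> //; lra.
have near_pnt (d : R) : 0 < d -> exists2 d' : R, 0 < d' & forall x y h : R, 0 < h < d' ->
    x <= s <= x + h -> y <= t <= y + h -> forall s' t', x <= s' <= x + h -> y <= t' <= y + h ->
    cmod (pnt s' t' - pnt s t) < d.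
  move=> d0; exists (d / (4 * rho)); first by rewrite divr_gt0 // mulr_gt0.
  move=> x y h /andP[h0]; rewrite ltr_pdivlMr ?mulr_gt0 // => hd xs yt s' t' xs' yt'.
  apply: le_lt_trans (cmod_le_ReIm _) _; rewrite /=.
  rewrite -!mulrBr !normrM (gtr0_norm rho0).
  have E (a b : R) : 2 * a - 1 - (2 * b - 1) = 2 * (a - b) by ring.
  rewrite !E !normrM (@gtr0_norm _ 2) //.
  have hs : `|s' - s| <= h by rewrite ler_norml; lra.
  have ht : `|t' - t| <= h by rewrite ler_norml; lra.
  have := ler_wpM2l (ltW rho0) hs; have := ler_wpM2l (ltW rho0) ht; lra.
have [zr|zr] := leP (cmod (pnt s t)) rho.
  have [d d0 Bd] := Bloc _ zr; have [d' d'0 d'P] := near_pnt d d0.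
  exists d' => // x y h hd _ _ _ _ xs yt; apply: (Bsub _ _ _ Bd) => w [wr [s' [t' [xs' yt' wE]]]].
  by split=> //; rewrite wE; exact: (d'P x y h).
(* Around a point of the square outside the disc, small squares miss the disc; the empty set has the
   property because some neighbourhood of 0 has it. *)
have [d' d'0 d'P] := near_pnt _ (eqbRL (subr_gt0 _ _) zr).
have [d _ B0] := Bloc 0 ltac:(by rewrite cmod0 ltW).
exists d' => // x y h hd _ _ _ _ xs yt; apply: (Bsub _ _ _ B0) => w [wr [s' [t' [xs' yt' wE]]]].
exfalso; have := d'P x y h hd xs yt s' t' xs' yt'; rewrite -wE.
by have := cmodB w (w - pnt s t); rewrite opprB addrC subrK; lra.
Qed.

Lemma differentiable_local_bound (g : C * C -> C) (x y : C) :
  differentiable (g : C^o * C^o -> C^o) ((x, y) : C^o * C^o) ->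
  exists2 d : R, 0 < d & forall x' y', cmod (x' - x) < d -> cmod (y' - y) < d ->
    cmod (g (x', y')) <= cmod (g (x, y)) + 1.
Proof.
move=> /differentiable_continuous /cvgrPdist_le /(_ 1 ltr01) /nbhs_ballP[e /= e0 eP].
have /complex_realP[r rE] : e \is Num.real by rewrite ger0_real // ltW.
rewrite rE in e0 eP; exists r => [|x' y' xr yr]; first by rewrite -ltcR.
have h : cmod (g (x, y) - g (x', y')) <= 1.
  by rewrite -lec_cmod; apply: (eP (x', y')); split; rewrite /= /ball /= ltc_cmod -cmodN opprB.
have -> : g (x', y') = g (x, y) - (g (x, y) - g (x', y')) by ring.
by apply: le_trans (cmodB _ _) _; rewrite lerD2l.
Qed.

(** Two nested compactness arguments, as in the tube lemma: the inner one, in y, bounds g for all x'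
    close to x, and the outer one glues these bounds in x. *)
Lemma bounded_bidisc (g : C * C -> C) (rho : R) : 0 < rho ->
  (forall x y, cmod x <= rho -> cmod y <= rho ->
     differentiable (g : C^o * C^o -> C^o) ((x, y) : C^o * C^o)) ->
  exists2 B : R, 0 < B & forall x y, cmod x <= rho -> cmod y <= rho -> cmod (g (x, y)) <= B.
Proof.
move=> rho0 dg.
apply: (@disc_induction rho (fun S => exists2 B : R, 0 < B & forall x y, S x -> cmod y <= rho -> cmod (g (x, y)) <= B)) => //.
- by move=> S T ST [B B0 BP]; exists B => // x y /ST; exact: BP.
- move=> S T [B B0 BP] [D D0 DP]; exists (B + D) => [|x y]; first exact: addr_gt0.
  by move=> [/BP h|/DP h] /h; lra.
move=> x xr.
have [d d0 [B B0 BP]] : exists2 d : R, 0 < d & exists2 B : R, 0 < B &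
    forall x' y, cmod (x' - x) < d -> cmod y <= rho -> cmod (g (x', y)) <= B.
  suff [d d0 [B B0 BP]] : exists2 d : R, 0 < d & exists2 B : R, 0 < B &
    forall y x', cmod y <= rho -> cmod (x' - x) < d -> cmod (g (x', y)) <= B.
    by exists d => //; exists B => // x' y h1 h2; exact: BP.
  apply: (@disc_induction rho (fun S => exists2 d : R, 0 < d & exists2 B : R, 0 < B &
    forall y x', S y -> cmod (x' - x) < d -> cmod (g (x', y)) <= B)) => //.
  - by move=> S T ST [d d0 [B B0 BP]]; exists d => //; exists B => // y x' /ST; exact: BP.
  - move=> S T [d d0 [B B0 BP]] [e e0 [D D0 DP]]; exists (Num.min d e); first by rewrite lt_min d0.
    exists (B + D) => [|y x']; first exact: addr_gt0.
    rewrite lt_min => -[/BP h|/DP h] /andP[h1 h2]; first by have := h _ h1; lra.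
    by have := h _ h2; lra.
  move=> y yr; have [d d0 dP] := differentiable_local_bound (dg x y xr yr).
  exists d => //; exists d => //; exists (cmod (g (x, y)) + 1).
    by rewrite ltr_pwDr // cmod_ge0.
  by move=> y' x' [yd _] xd; exact: dP.
by exists d => //; exists B => // x' y [xd _]; exact: BP.
Qed.

End DiscCompactness.

(** * Means over products of two circles *)

Section DoubleMeans.
Variable R : realType.
Local Notation C := R[i].
Implicit Types (F G : C -> C -> C) (u v : C -> C -> R).

Definition bimean N r F : C := circle_mean N r (fun x => circle_mean N r (F x)).

Definition rbimean N (r : R) u : R := (2 ^ N)%:R^-1 * \sum_(k < 2 ^ N)
  ((2 ^ N)%:R^-1 * \sum_(j < 2 ^ N) u (r%:C%C * omega R N ^+ k) (r%:C%C * omega R N ^+ j)).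

Lemma bimeanC N r F :
  bimean N r F = circle_mean N r (fun y => circle_mean N r (fun x => F x y)).
Proof.
rewrite /bimean /circle_mean; congr (_ * _).
by rewrite -!mulr_sumr exchange_big.
Qed.

Lemma bimeanD N r F G :
  bimean N r (fun x y => F x y + G x y) = bimean N r F + bimean N r G.
Proof. by rewrite /bimean -circle_meanD; congr circle_mean; apply: funext => x; rewrite circle_meanD. Qed.

Lemma bimeanB N r F G :
  bimean N r (fun x y => F x y - G x y) = bimean N r F - bimean N r G.
Proof. by rewrite /bimean -circle_meanB; congr circle_mean; apply: funext => x; rewrite circle_meanB. Qed.

Lemma bimeanZ N r a F : bimean N r (fun x y => a * F x y) = a * bimean N r F.
Proof. by rewrite /bimean -circle_meanZ; congr circle_mean; apply: funext => x; rewrite circle_meanZ. Qed.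

Lemma bimean_sum N r I (s : seq I) (F : I -> C -> C -> C) :
  bimean N r (fun x y => \sum_(i <- s) F i x y) = \sum_(i <- s) bimean N r (F i).
Proof.
rewrite /bimean -circle_mean_sum; congr circle_mean; apply: funext => x.
by rewrite circle_mean_sum.
Qed.

Lemma eq_bimean N (r : R) F G : 0 <= r ->
  (forall x y, cmod x = r -> cmod y = r -> F x y = G x y) -> bimean N r F = bimean N r G.
Proof.
move=> r0 FG; apply: eq_circle_mean => // x xr; apply: eq_circle_mean => // y yr.
exact: FG.
Qed.

Lemma cmod_bimean_le N r F : cmod (bimean N r F) <= rbimean N r (fun x y => cmod (F x y)).
Proof.
rewrite /bimean /circle_mean cmodM cmodV cmod_nat ler_wpM2l ?invr_ge0 ?ler0n //.
apply: le_trans (cmod_sum _ _ _) _; apply: ler_sum => k _.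
by rewrite cmodM cmodV cmod_nat ler_wpM2l ?invr_ge0 ?ler0n // cmod_sum.
Qed.

Lemma Re_bimean N r F : complex.Re (bimean N r F) = rbimean N r (fun x y => complex.Re (F x y)).
Proof.
have Rsum (I : finType) (H : I -> C) : complex.Re (\sum_i H i) = \sum_i complex.Re (H i).
  by elim/big_rec2: _ => // i x y _ <-; rewrite ReD.
have W : (2 ^ N)%:R^-1 = ((2 ^ N)%:R^-1)%:C%C :> C by rewrite fmorphV rmorph_nat.
rewrite /bimean /circle_mean W ReM_real Rsum; congr (_ * _); apply: eq_bigr => k _.
by rewrite ReM_real Rsum.
Qed.

Lemma rbimean_le N (r : R) u v : 0 <= r ->
  (forall x y, cmod x = r -> cmod y = r -> u x y <= v x y) -> rbimean N r u <= rbimean N r v.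
Proof.
move=> r0 uv; rewrite ler_wpM2l ?invr_ge0 ?ler0n //; apply: ler_sum => k _.
rewrite ler_wpM2l ?invr_ge0 ?ler0n //; apply: ler_sum => j _.
by apply: uv; rewrite cmod_node.
Qed.

Lemma rbimeanD N r u v :
  rbimean N r (fun x y => u x y + v x y) = rbimean N r u + rbimean N r v.
Proof.
rewrite /rbimean -mulrDr -big_split; congr (_ * _); apply: eq_bigr => k _ /=.
by rewrite -mulrDr -big_split.
Qed.

Lemma rbimeanZ N r a u : rbimean N r (fun x y => a * u x y) = a * rbimean N r u.
Proof.
rewrite /rbimean mulrCA; congr (_ * _); rewrite mulr_sumr; apply: eq_bigr => k _ /=.
by rewrite -mulr_sumr mulrCA.
Qed.

Lemma rbimean_cst N r a : rbimean N r (fun _ _ => a) = a.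
Proof.
have W : (2 ^ N)%:R != 0 :> R by rewrite gt_eqF // pow2_gt0.
rewrite /rbimean; under eq_bigr do rewrite sumr_const card_ord -[a *+ _]mulr_natl mulKf //.
by rewrite sumr_const card_ord -[a *+ _]mulr_natl mulKf.
Qed.

Lemma cauchy_kernel_split n (z x : C) : z / x != 1 ->
  cauchy_kernel z x = \sum_(k < n) (z / x) ^+ k + (z / x) ^+ n * cauchy_kernel z x.
Proof.
move=> zx; have n0 : 1 - z / x != 0 by rewrite subr_eq0 eq_sym.
apply: (mulfI n0); rewrite mulrDr mulrCA /cauchy_kernel divff // mulr1.
by rewrite -[1 - _]opprB mulNr -subrX1; ring.
Qed.

Definition cauchy_error (s B : R) N := 2 * B * s ^+ (2 ^ N) / (1 - s) ^+ 2.

Lemma cauchy_error_small (s B e : R) : 0 < s < 1 -> 0 < e ->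
  exists N0, forall N, (N0 <= N)%N -> cauchy_error s B N <= e.
Proof.
move=> /andP[s0 s1] e0; have k0 : 0 < (1 - s) ^+ 2 by rewrite exprn_gt0 // subr_gt0.
have B0 : 0 < 2 * (1 + `|B|) by rewrite mulr_gt0 // ltr_pwDl.
have s01 : 0 <= s < 1 by rewrite ltW.
have [N0 NP] := expr_small s01 (divr_gt0 (mulr_gt0 e0 k0) B0).
exists N0 => N NN; rewrite /cauchy_error ler_pdivrMr //.
have := NP (2 ^ N)%N (leq_trans NN (ltnW (ltn_expl _ _))).
rewrite ler_pdivlMr // => /(_ isT); apply: le_trans.
have := exprn_ge0 (2 ^ N) (ltW s0); have := ler_norm B; nra.
Qed.

(* On the circle |x| = r the conjugate of x is r^2 / x, so the conjugate of the
   integrand extends to a holomorphic function vanishing at 0. *)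
Lemma mean_conj_small (F : C -> C) (rho r s c B : R) z j n N :
  0 < rho <= 1 -> 0 < r -> 0 < s < 1 -> r <= s * rho -> 0 <= c < 1 ->
  cmod z <= c * r ^+ 2 -> (j <= n)%N ->
  (forall x, cmod x <= rho -> cdiff F x) ->
  (forall x, cmod x = rho -> cmod (F x) <= B) ->
  cmod (circle_mean N r (fun x => x ^+ j * (F x)^* * ((z / x) ^+ n.+1 * cauchy_kernel z x)))
    <= cauchy_error s (B / (1 - c)) N.
Proof.
move=> /andP[rho0 rho1] r0 s01 rs /andP[c0 c1] zr jn Fd FB.
pose a x := z^* * x / (r ^+ 2)%:C%C.
have r2 : (r ^+ 2)%:C%C != 0 :> C by rewrite neq0C // exprn_gt0.
have r2' : 0 < r ^+ 2 by rewrite exprn_gt0.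
have r1 : r <= 1 by case/andP: s01 => s0 s1; nra.
have ac x : cmod x <= rho -> cmod (a x) <= c.
  move=> xr; rewrite !cmodM cmodJ cmodV cmod_real gtr0_norm // ler_pdivrMr //.
  by have := cmod_ge0 z; have := cmod_ge0 x; nra.
(* On |x| = r, [a x] is the conjugate of z / x. The factor x^j only turns j powers of [a] into
   powers of the constant conj z, so a positive power n + 1 - j remains and H(0) = 0. *)
pose H x := F x * ((z^*) ^+ j * a x ^+ (n.+1 - j) * (1 - a x)^-1).
have -> : circle_mean N r (fun x => x ^+ j * (F x)^* * ((z / x) ^+ n.+1 * cauchy_kernel z x)) =
    (circle_mean N r (fun x => H x * cauchy_kernel 0 x) - H 0)^*.
  have -> : H 0 = 0.
    by rewrite /H /a mulr0 mul0r expr0n subn_eq0 leqNgt ltnS jn /= mulr0 mul0r mulr0.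
  rewrite subr0 circle_meanJ; apply: eq_circle_mean => [|x xr]; first exact: ltW.
  have x0 : x != 0 by apply: neq0_circle xr.
  have xJ : x^* = (r ^+ 2)%:C%C / x by rewrite conjcV_circle // xr.
  rewrite -[LHS]conjCK; congr (_^*).
  rewrite /H /cauchy_kernel mul0r subr0 invr1 mulr1.
  have zJ : z^* / x^* = a x by rewrite xJ invf_div mulrA.
  rewrite !rmorphM fmorphV rmorphB rmorph1 !rmorphXn !rmorphM fmorphV /= conjCK zJ.
  have -> : a x ^+ n.+1 = a x ^+ j * a x ^+ (n.+1 - j) by rewrite -exprD subnKC // leqW.
  have -> : (z^*) ^+ j = (x^*) ^+ j * a x ^+ j.
    by rewrite -exprMn -zJ; congr (_ ^+ _); rewrite mulrC divfK // conjC_eq0.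
  by ring.
rewrite cmodJ; have sr : cmod (0 : C) <= s * r by rewrite cmod0 mulr_ge0 // ltW //; case/andP: s01.
apply: (@cauchy_uniform R H rho r s _ 0 N rho0 r0 s01 rs sr).
  move=> x xr.
  have da : cdiff a x.
    apply: cdiffM; last exact: cdiff_cst.
    by apply: cdiffM; [exact: cdiff_cst|exact: cdiff_id].
  apply: cdiffM; first exact: Fd.
  apply: cdiffM; first by apply: cdiffM; [exact: cdiff_cst|exact: cdiffX].
  apply: cdiffV; last by apply: cdiffB => //; exact: cdiff_cst.
  rewrite subr_eq0 eq_sym; apply: contraTneq (ac x xr) => ->.
  by rewrite cmod1 -ltNge.
move=> x xr; rewrite /H; rewrite cmodM; apply: ler_pM; rewrite ?cmod_ge0 ?FB //.
have axc : cmod (a x) <= c by apply: ac; rewrite xr.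
rewrite !cmodM -[leRHS]mul1r; apply: ler_pM; rewrite ?mulr_ge0 ?cmod_ge0 //; last first.
  exact: cmod_inv1B_le.
rewrite !cmodX cmodJ; apply: mulr_ile1; rewrite ?exprn_ge0 ?cmod_ge0 //.
  by rewrite exprn_ile1 ?cmod_ge0 //; nra.
by rewrite exprn_ile1 ?cmod_ge0 //; lra.
Qed.

End DoubleMeans.

(** * Approximation of q g by polynomials of bounded bidegree *)

Section Rigidity.
Variable R : realType.
Local Notation C := R[i].
Implicit Types P : {poly {poly C}}.

Definition bidegree_le (n1 n2 : nat) P :=
  (size P <= n1.+1)%N /\ forall i, (size (P`_i)%R <= n2.+1)%N.

Lemma horner2_sum n1 n2 P x y : bidegree_le n1 n2 P ->
  P.[x, y] = \sum_(i < n1.+1) \sum_(j < n2.+1) P`_i`_j * (x ^+ i * y ^+ j).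
Proof.
move=> [s1 s2]; rewrite (horner_coef_wide _ s1) horner_sum; apply: eq_bigr => i _.
rewrite hornerM -polyC_exp hornerC (horner_coef_wide _ (s2 i)) mulr_suml.
by apply: eq_bigr => j _; ring.
Qed.

Definition coef_norm n1 n2 P : R := \sum_(i < n1.+1) \sum_(j < n2.+1) cmod P`_i`_j.

Lemma coef_norm_ge0 n1 n2 P : 0 <= coef_norm n1 n2 P.
Proof. by apply: sumr_ge0 => i _; apply: sumr_ge0 => j _; exact: cmod_ge0. Qed.

Lemma coef_sum_le n1 n2 P (F : nat -> nat -> C) (B : R) :
  (forall i j, (i <= n1)%N -> (j <= n2)%N -> cmod (F i j) <= B) ->
  cmod (\sum_(i < n1.+1) \sum_(j < n2.+1) P`_i`_j * F i j) <= coef_norm n1 n2 P * B.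
Proof.
move=> FB; apply: le_trans (cmod_sum _ _ _) _; rewrite mulr_suml.
apply: ler_sum => i _; apply: le_trans (cmod_sum _ _ _) _; rewrite mulr_suml.
by apply: ler_sum => j _; rewrite cmodM ler_wpM2l ?cmod_ge0 // FB // -ltnS ltn_ord.
Qed.

(** For fixed b the mean in a is a combination of means against monomials a^i with i <= n1;
    [mean_conj_small] applies to each of them. *)
Lemma bimean_product_le1 n1 n2 P (g : C -> C -> C) (T S : C -> C) N (r k E : R) :
  bidegree_le n1 n2 P -> 0 <= r <= 1 -> (forall b, cmod b = r -> cmod (S b) <= k) ->
  (forall i b, (i <= n1)%N -> cmod b = r ->
     cmod (circle_mean N r (fun a => a ^+ i * g a b * T a)) <= E) ->
  cmod (bimean N r (fun a b => P.[a, b] * g a b * (T a * S b))) <=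
    coef_norm n1 n2 P * (k * E).
Proof.
move=> Pn /andP[r0 r1] Sk TE; rewrite bimeanC; apply: circle_mean_le => // b br.
have -> : circle_mean N r (fun a => P.[a, b] * g a b * (T a * S b)) =
    S b * \sum_(i < n1.+1) \sum_(j < n2.+1) P`_i`_j *
      (b ^+ j * circle_mean N r (fun a => a ^+ i * g a b * T a)).
  rewrite mulr_sumr; under [RHS]eq_bigr => i _ do under eq_bigr => j _ do
    rewrite -circle_meanZ -circle_meanZ.
  under [RHS]eq_bigr => i _ do rewrite -circle_mean_sum.
  under [RHS]eq_bigr => i _ do rewrite -circle_meanZ.
  rewrite -circle_mean_sum; apply: eq_circle_mean => // a ar.
  rewrite (horner2_sum _ _ Pn) !mulr_suml; apply: eq_bigr => i _.
  rewrite !mulr_suml mulr_sumr; apply: eq_bigr => j _.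
  by move: (g a b) (T a) (S b) (P`_i`_j) (a ^+ i) (b ^+ j) => u v w x y z; ring.
rewrite cmodM [coef_norm _ _ _ * _]mulrCA; apply: ler_pM; rewrite ?cmod_ge0 ?Sk //.
apply: (coef_sum_le _ (F := fun i j => b ^+ j * circle_mean N r (fun a => a ^+ i * g a b * T a))).
move=> i j i1 _; rewrite cmodM cmodX br -[leRHS]mul1r.
by apply: ler_pM; rewrite ?exprn_ge0 ?cmod_ge0 ?TE // exprn_ile1.
Qed.

Lemma bimean_product_le2 n1 n2 P (g : C -> C -> C) (T S : C -> C) N (r k E : R) :
  bidegree_le n1 n2 P -> 0 <= r <= 1 -> (forall a, cmod a = r -> cmod (S a) <= k) ->
  (forall j a, (j <= n2)%N -> cmod a = r ->
     cmod (circle_mean N r (fun b => b ^+ j * g a b * T b)) <= E) ->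
  cmod (bimean N r (fun a b => P.[a, b] * g a b * (S a * T b))) <=
    coef_norm n1 n2 P * (k * E).
Proof.
move=> Pn /andP[r0 r1] Sk TE; apply: circle_mean_le => // a ar.
have -> : circle_mean N r (fun b => P.[a, b] * g a b * (S a * T b)) =
    S a * \sum_(i < n1.+1) \sum_(j < n2.+1) P`_i`_j *
      (a ^+ i * circle_mean N r (fun b => b ^+ j * g a b * T b)).
  rewrite mulr_sumr; under [RHS]eq_bigr => i _ do under eq_bigr => j _ do
    rewrite -circle_meanZ -circle_meanZ.
  under [RHS]eq_bigr => i _ do rewrite -circle_mean_sum.
  under [RHS]eq_bigr => i _ do rewrite -circle_meanZ.
  rewrite -circle_mean_sum; apply: eq_circle_mean => // b br.
  rewrite (horner2_sum _ _ Pn) !mulr_suml; apply: eq_bigr => i _.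
  rewrite !mulr_suml mulr_sumr; apply: eq_bigr => j _.
  by move: (g a b) (T b) (S a) (P`_i`_j) (a ^+ i) (b ^+ j) => u v w x y z; ring.
rewrite cmodM [coef_norm _ _ _ * _]mulrCA; apply: ler_pM; rewrite ?cmod_ge0 ?Sk //.
apply: (coef_sum_le _ (F := fun i j => a ^+ i * circle_mean N r (fun b => b ^+ j * g a b * T b))).
move=> i j _ j1; rewrite cmodM cmodX ar -[leRHS]mul1r.
by apply: ler_pM; rewrite ?exprn_ge0 ?cmod_ge0 ?TE // exprn_ile1.
Qed.

Lemma geometric_sum_le (v : C) (c : R) n : cmod v <= c -> 0 <= c < 1 ->
  cmod (\sum_(k < n) v ^+ k) <= (1 - c)^-1.
Proof.
move=> vc /andP[c0 c1]; apply: le_trans (cmod_sum _ _ _) _.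
apply: (@le_trans _ _ (\sum_(k < n) c ^+ k)).
  by apply: ler_sum => k _; rewrite cmodX lerXn2r ?nnegrE ?cmod_ge0.
have k0 : 0 < 1 - c by rewrite subr_gt0.
rewrite -(ler_pM2l k0) divff ?gt_eqF // -[1 - c]opprB mulNr -subrX1 opprB.
by rewrite gerBl exprn_ge0.
Qed.

(* The Cauchy kernels split as k = s + t into a partial geometric sum and its tail.
   Against k1 k2 - s1 s2 = t1 k2 + s1 t2 the mean of q (conj g) is negligible, so g
   may be replaced there by 2 Re g, and |q| Re g is dominated by a small multiple of
   Re f plus a large multiple of |q|^2 Re f. *)
Lemma approx_of_dominated (n1 n2 : nat) (q : {poly {poly C}}) (f g : C * C -> C) (t K m e : R) :
  bidegree_le n1 n2 q ->
  (forall x y : C, cmod x < 1 -> cmod y < 1 ->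
     differentiable (f : C^o * C^o -> C^o) ((x, y) : C^o * C^o)) ->
  (forall x y : C, cmod x < 1 -> cmod y < 1 ->
     differentiable (g : C^o * C^o -> C^o) ((x, y) : C^o * C^o)) ->
  f (0, 0) = 1 -> 0 < t -> 0 < K -> 0 < m < 1 -> 0 < e ->
  (forall x y, cmod x < 1 -> cmod y < 1 ->
     0 <= complex.Re (g (x, y)) /\ t * complex.Re (g (x, y)) <= complex.Re (f (x, y))) ->
  (forall r x y, 0 < r < 1 -> cmod x = r -> cmod y = r ->
     cmod q.[x, y] ^+ 2 * complex.Re (f (x, y)) <= K * (1 - r)) ->
  exists2 P, bidegree_le n1 n2 P & forall x y, cmod x <= m -> cmod y <= m ->
    cmod (P.[x, y] - q.[x, y] * g (x, y)) <= e.
Proof.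
move=> qn df dg f0 t0 K0 /andP[m0 m1] e0 gf qf.
pose c := (1 + m) / 2; have c01 : 0 <= c < 1 by rewrite /c; lra.
have /andP[c0 c1] := c01; have mc : m < c by rewrite /c; lra.
pose k := (1 - c)^-1; have k0 : 0 < k by rewrite invr_gt0; lra.
pose Q := coef_norm n1 n2 q; have Q0 : 0 <= Q by exact: coef_norm_ge0.
have qQ (x y : C) : cmod x <= 1 -> cmod y <= 1 -> cmod q.[x, y] <= Q.
  move=> x1 y1; rewrite (horner2_sum _ _ qn) -[Q]mulr1; apply: (coef_sum_le _ (F := fun i j => x ^+ i * y ^+ j)) => i j _ _.
  by rewrite cmodM !cmodX mulr_ile1 ?exprn_ge0 ?cmod_ge0 // exprn_ile1 ?cmod_ge0.
(* Twice |q| is at most al + |q|^2 / al. The first term carries the weight A0 al = e / 8 and meets a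
   mean of Re f of at most 2; the second contributes at most A0 K (1 - r) / al. The constant A0
   combines the bound 2 k^2 on the kernels with 1 / t. *)
pose A0 := 2 * k ^+ 2 / t; have A00 : 0 < A0 by rewrite divr_gt0 // mulr_gt0 // exprn_gt0.
pose al := e / (8 * A0); have al0 : 0 < al by rewrite divr_gt0 // mulr_gt0.
have A0E : 2 * k ^+ 2 = A0 * t by rewrite /A0 divfK // gt_eqF.
have alE : A0 * al = e / 8 by rewrite /al; field; rewrite gt_eqF.
clearbody A0 al.
(* The first entry ensures m <= c r^2, as [mean_conj_small] requires; the second makes A0 K (1 - r)
   / al at most e / 4. *)
pose d := Num.min ((1 - m) / 4) (e * al / (4 * A0 * K)).
have d0 : 0 < d.
  rewrite lt_min; apply/andP; split; first by lra.
  exact: divr_gt0 (mulr_gt0 e0 al0) (mulr_gt0 (mulr_gt0 (ltr0n R 4) A00) K0).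
have [d1 d2] : d <= (1 - m) / 4 /\ d <= e * al / (4 * A0 * K) by rewrite !ge_min !lexx orbT.
pose r := 1 - d; have r01 : 0 < r < 1 by rewrite /r; lra.
have /andP[r0 r1] := r01.
have mr2 : m <= c * r ^+ 2 by rewrite /r /c; nra.
have mr : m <= c * r by apply: le_trans mr2 _; rewrite ler_wpM2l // expr2 ler_piMl // ltW.
have dK : A0 * (K * (1 - r) / al) <= e / 4.
  have -> : 1 - r = d by rewrite /r; ring.
  move: d2; rewrite !ler_pdivlMr ?mulr_gt0 // => d2.
  have -> : A0 * (K * d / al) * 4 = d * (4 * A0 * K) / al by field; rewrite gt_eqF.
  by rewrite ler_pdivrMr.
pose rho := (1 + r) / 2; have rho01 : 0 < rho < 1 by rewrite /rho; lra.
have /andP[rho0 rho1] := rho01.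
(* One ratio for both requirements of [cauchy_uniform]: r <= s rho and m <= s r. *)
pose s := Num.max (r / rho) c.
have s01 : 0 < s < 1.
  by rewrite lt_max gt_max c1 ltr_pdivrMr // mul1r divr_gt0 //= andbT /rho; lra.
have rs : r <= s * rho by rewrite -ler_pdivrMr // le_max lexx.
have cs : c <= s by rewrite le_max lexx orbT.
have msr : m <= s * r by apply: le_trans mr _; rewrite ler_wpM2r // ltW.
have [Bg Bg0 HBg] : exists2 B : R, 0 < B & forall x y, cmod x <= rho -> cmod y <= rho -> cmod (g (x, y)) <= B.
  by apply: bounded_bidisc => // x y xr yr; apply: dg; exact: le_lt_trans rho1.
have [Bf Bf0 HBf] : exists2 B : R, 0 < B & forall x y, cmod x <= rho -> cmod y <= rho -> cmod (f (x, y)) <= B.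
  by apply: bounded_bidisc => // x y xr yr; apply: df; exact: le_lt_trans rho1.
have e1 : 0 < e / (4 * (k + 1)) by rewrite divr_gt0 // mulr_gt0 // addr_gt0.
have [N1 HN1] := cauchy_error_small (Q * Bg) s01 e1.
have e2 : 0 < e / (8 * ((Q + 1) * k)) by rewrite divr_gt0 // !mulr_gt0 // ltr_wpDl.
have [N2 HN2] := cauchy_error_small (Bg * k) s01 e2.
have e3 : 0 < (2^-1 : R) by rewrite invr_gt0.
have [N3 HN3] := cauchy_error_small Bf s01 e3; pose N := (N1 + N2 + N3)%N.
have {}HN1 := HN1 N ltac:(by rewrite /N -addnA leq_addr).
have {}HN2 := HN2 N ltac:(by rewrite /N addnAC leq_addl).
have {}HN3 := HN3 N ltac:(by rewrite /N leq_addl).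
clearbody N.
(* Discrete Fourier coefficients of q g on the torus of radius r. They do not depend on the point
   (x, y), and P(x, y) is the mean of q g against s1 s2. *)
pose P := \poly_(i < n1.+1) \poly_(j < n2.+1)
  bimean N r (fun a b => q.[a, b] * g (a, b) * (a ^- i * b ^- j)).
exists P.
  split=> [|i]; first exact: size_poly.
  by rewrite coef_poly; case: ifP => _; [exact: size_poly|rewrite size_poly0].
move=> x y xm ym; have r0' := ltW r0.
have rlerho : r <= rho by rewrite ler_pdivlMr // mulr_natr mulr2n lerD2r ltW.
pose G (a b : C) := q.[a, b] * g (a, b).
pose k1 := cauchy_kernel x; pose k2 := cauchy_kernel y.
pose s1 a := \sum_(i < n1.+1) (x / a) ^+ i; pose s2 b := \sum_(j < n2.+1) (y / b) ^+ j.
pose t1 a := (x / a) ^+ n1.+1 * k1 a; pose t2 b := (y / b) ^+ n2.+1 * k2 b.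
have quot (z a : C) : cmod z <= m -> cmod a = r -> cmod (z / a) <= c.
  by move=> zm ar; rewrite cmodM cmodV ar ler_pdivrMr // (le_trans zm).
have quot1 (z a : C) : cmod z <= m -> cmod a = r -> z / a != 1.
  move=> zm ar; apply: contraTneq (quot z a zm ar) => ->.
  by rewrite cmod1 -ltNge.
have kk (z a : C) : cmod z <= m -> cmod a = r -> cmod (cauchy_kernel z a) <= k.
  by move=> zm ar; apply: cmod_inv1B_le c1; exact: quot.
have split1 a : cmod a = r -> k1 a = s1 a + t1 a.
  by move=> ar; apply: cauchy_kernel_split; exact: quot1.
have split2 a : cmod a = r -> k2 a = s2 a + t2 a.
  by move=> ar; apply: cauchy_kernel_split; exact: quot1.
have s1k a : cmod a = r -> cmod (s1 a) <= k.
  by move=> ar; apply: geometric_sum_le c01; exact: quot.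
have s2k a : cmod a = r -> cmod (s2 a) <= k.
  by move=> ar; apply: geometric_sum_le c01; exact: quot.
have PE : P.[x, y] = bimean N r (fun a b => G a b * (s1 a * s2 b)).
  have Pn : bidegree_le n1 n2 P.
    split=> [|i]; first exact: size_poly.
    by rewrite coef_poly; case: ifP => _; [exact: size_poly|rewrite size_poly0].
  rewrite (horner2_sum _ _ Pn).
  under eq_bigr => i _ do under eq_bigr => j _ do
    rewrite !coef_poly ltn_ord coef_poly ltn_ord mulrC -bimeanZ.
  under eq_bigr => i _ do rewrite -bimean_sum.
  rewrite -bimean_sum; apply: eq_bimean => // a b ar br.
  rewrite mulr_suml mulr_sumr; apply: eq_bigr => i _.
  rewrite mulr_sumr mulr_sumr; apply: eq_bigr => j _.
  rewrite !expr_div_n /G; ring.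
have xs : cmod x <= s * r by exact: le_trans msr.
have ys : cmod y <= s * r by exact: le_trans msr.
have dsl (F : C * C -> C) a b : (forall x y : C, cmod x < 1 -> cmod y < 1 ->
     differentiable (F : C^o * C^o -> C^o) ((x, y) : C^o * C^o)) ->
    cmod a <= rho -> cmod b <= rho -> cdiff (fun b => F (a, b)) b /\ cdiff (fun a => F (a, b)) a.
  move=> dF ar br; have dF' := dF _ _ (le_lt_trans ar rho1) (le_lt_trans br rho1).
  split; first by apply: cdiff_slice dF' _ _; [exact: cdiff_cst|exact: cdiff_id].
  by apply: cdiff_slice dF' _ _; [exact: cdiff_id|exact: cdiff_cst].
have Gd a b : cmod a <= rho -> cmod b <= rho -> cdiff (G a) b /\ cdiff (fun a => G a b) a.
  move=> ar br; have [h1 h2] := dsl g a b dg ar br.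
  split.
    by apply: cdiffM h1; apply: cdiff_horner2; [exact: cdiff_cst|exact: cdiff_id].
  by apply: cdiffM h2; apply: cdiff_horner2; [exact: cdiff_id|exact: cdiff_cst].
have GB a b : cmod a <= rho -> cmod b <= rho -> cmod (G a b) <= Q * Bg.
  move=> ar br; rewrite cmodM.
  by apply: ler_pM (cmod_ge0 _) (cmod_ge0 _) (qQ _ _ _ _) (HBg _ _ ar br); exact: le_trans (ltW rho1).
have mrho : m <= rho by apply: le_trans mr (le_trans _ rlerho); rewrite ler_piMl // ltW.
have xrho : cmod x <= rho := le_trans xm mrho.
have yrho : cmod y <= rho := le_trans ym mrho.
have HA : cmod (bimean N r (fun a b => G a b * (k1 a * k2 b)) - G x y) <= e / 4.
  apply: (@le_trans _ _ ((k + 1) * cauchy_error s (Q * Bg) N)); last first.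
    by rewrite mulrC -ler_pdivlMr ?addr_gt0 // -mulrA -invfM.
  rewrite mulrDl mul1r.
  have -> : bimean N r (fun a b => G a b * (k1 a * k2 b)) - G x y =
    circle_mean N r (fun a => k1 a * (circle_mean N r (fun b => G a b * k2 b) - G a y)) +
    (circle_mean N r (fun a => G a y * k1 a) - G x y).
    rewrite addrA; congr (_ - _); rewrite -circle_meanD; apply: eq_circle_mean => // a ar.
    have -> : circle_mean N r (fun b => G a b * (k1 a * k2 b)) =
        k1 a * circle_mean N r (fun b => G a b * k2 b).
      by rewrite -circle_meanZ; apply: eq_circle_mean => // b br; ring.
    ring.
  apply: le_trans (cmodD _ _) _; apply: lerD.
    apply: circle_mean_le => // a ar; rewrite cmodM; apply: ler_pM; rewrite ?cmod_ge0 ?kk //.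
    apply: (@cauchy_uniform R (G a) rho r s _ y N rho0 r0 s01 rs ys) => b br.
      by have [] := Gd a b ltac:(by rewrite ar) br.
    by rewrite GB ?ar ?br.
  apply: (@cauchy_uniform R (fun a => G a y) rho r s _ x N rho0 r0 s01 rs xs) => a ar.
    by have [] := Gd a y ar yrho.
  by rewrite GB ?ar.
have E20 : 0 <= cauchy_error s (Bg * k) N.
  rewrite /cauchy_error divr_ge0 ?sqr_ge0 // mulr_ge0 ?exprn_ge0 ?mulr_ge0 // ?ltW //.
  by case/andP: s01.
have E2 : Q * (k * cauchy_error s (Bg * k) N) <= e / 8.
  apply: (@le_trans _ _ ((Q + 1) * k * cauchy_error s (Bg * k) N)).
    by rewrite mulrA ler_wpM2r // ler_wpM2r ?lerDl ?ler01 // ltW.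
  by rewrite mulrC -ler_pdivlMr ?mulr_gt0 ?ltr_wpDl // -mulrA -invfM.
have xr2 : cmod x <= c * r ^+ 2 by exact: le_trans mr2.
have yr2 : cmod y <= c * r ^+ 2 by exact: le_trans mr2.
have rho1' : 0 < rho <= 1 by rewrite rho0 ltW.
have r01' : 0 <= r <= 1 by rewrite r0' ltW.
have HB : cmod (bimean N r (fun a b => q.[a, b] * (g (a, b))^* * (t1 a * k2 b))) <= e / 8.
  apply: le_trans E2; apply: (bimean_product_le1 (g := fun a b => (g (a, b))^*)) => //.
    by move=> b br; exact: kk.
  move=> i b i1 br; apply: (mean_conj_small (F := fun a => g (a, b)) (rho := rho)) => // a ar.
    by have [] := dsl g a b dg ar ltac:(by rewrite br).
  by apply: HBg; rewrite ?ar ?br.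
have HB' : cmod (bimean N r (fun a b => q.[a, b] * (g (a, b))^* * (s1 a * t2 b))) <= e / 8.
  apply: le_trans E2; apply: (bimean_product_le2 (g := fun a b => (g (a, b))^*)) => //.
  move=> j a j1 ar; apply: (mean_conj_small (F := fun b => g (a, b)) (rho := rho)) => // b br.
    by have [] := dsl g a b dg ltac:(by rewrite ar) br.
  by apply: HBg; rewrite ?ar ?br.
(* By the mean value property in each variable, this mean is within 1 of Re f(0, 0) = 1. *)
have Ref2 : rbimean N r (fun a b => complex.Re (f (a, b))) <= 2.
  rewrite -(Re_bimean N r (fun a b => f (a, b))).
  have -> : bimean N r (fun a b => f (a, b)) =
    1 + (circle_mean N r (fun a => circle_mean N r (fun b => f (a, b)) - f (a, 0)) +
         (circle_mean N r (fun a => f (a, 0)) - f (0, 0))).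
    by rewrite circle_meanB f0 /bimean; ring.
  rewrite ReD /=; suff : cmod (circle_mean N r (fun a => circle_mean N r (fun b => f (a, b)) - f (a, 0)) +
         (circle_mean N r (fun a => f (a, 0)) - f (0, 0))) <= 1.
    move=> h; rewrite [leRHS](_ : 2 = 1 + 1) // lerD2l.
    exact: le_trans (le_trans (ler_norm _) (Re_le_cmod _)) h.
  have ck0 F : circle_mean N r F = circle_mean N r (fun a => F a * cauchy_kernel 0 a).
    by congr circle_mean; apply: funext => a; rewrite /cauchy_kernel mul0r subr0 invr1 mulr1.
  have sr0 : cmod (0 : C) <= s * r by rewrite cmod0 mulr_ge0 // ltW //; case/andP: s01.
  have z0 : cmod (0 : C) <= rho by rewrite cmod0 ltW.
  apply: le_trans (cmodD _ _) _; rewrite [leRHS](_ : _ = 2^-1 + 2^-1); last by field.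
  apply: lerD.
    apply: circle_mean_le => // a ar; rewrite ck0; apply: le_trans HN3.
    apply: (@cauchy_uniform R (fun b => f (a, b)) rho) => // b br; last by rewrite HBf ?ar ?br.
    by have [] := dsl f a b df ltac:(by rewrite ar) br.
  rewrite ck0; apply: le_trans HN3.
  apply: (@cauchy_uniform R (fun a => f (a, 0)) rho) => // a ar; last by rewrite HBf ?ar.
  by have [] := dsl f a 0 df ar z0.
have HC : cmod (bimean N r (fun a b => q.[a, b] * (2 * complex.Re (g (a, b)))%:C%C *
    (k1 a * k2 b - s1 a * s2 b))) <= e / 2.
  apply: le_trans (cmod_bimean_le _ _ _) _.
  apply: (@le_trans _ _ (rbimean N r (fun a b => A0 * al * complex.Re (f (a, b)) +
      A0 * (K * (1 - r) / al)))); last first.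
    rewrite rbimeanD rbimeanZ rbimean_cst.
    rewrite alE; have : e / 8 * rbimean N r (fun a b => complex.Re (f (a, b))) <= e / 4.
      have e8 : 0 < e / 8 by rewrite divr_gt0.
      apply: le_trans (ler_wpM2l (ltW e8) Ref2) _.
      by have -> : e / 8 * 2 = e / 4 by field.
    move=> h; have -> : e / 2 = e / 4 + e / 4 by field.
    exact: lerD.
  apply: rbimean_le => // a b ar br.
  have [g0 gfab] := gf a b ltac:(by rewrite ar) ltac:(by rewrite br).
  have fq := qf r a b r01 ar br.
  rewrite !cmodM cmod_real ger0_norm; last by rewrite mulr_ge0.
  have kb : cmod (k1 a * k2 b - s1 a * s2 b) <= 2 * k ^+ 2.
    apply: le_trans (cmodB _ _) _; rewrite !cmodM mulr_natl mulr2n expr2.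
    by apply: lerD; apply: ler_pM; rewrite ?cmod_ge0 ?kk ?s1k ?s2k.
  have f0' : 0 <= complex.Re (f (a, b)) by apply: le_trans gfab; rewrite mulr_ge0 // ltW.
  apply: (@le_trans _ _ (cmod q.[a, b] * (2 * (complex.Re (f (a, b)) / t)) * (2 * k ^+ 2))).
    apply: ler_pM; rewrite ?mulr_ge0 ?cmod_ge0 //.
    by rewrite ler_wpM2l ?cmod_ge0 // ler_wpM2l // ler_pdivlMr // mulrC.
  have -> : cmod q.[a, b] * (2 * (complex.Re (f (a, b)) / t)) * (2 * k ^+ 2) =
    A0 * (2 * cmod q.[a, b] * complex.Re (f (a, b))).
    by rewrite A0E; field; rewrite gt_eqF.
  rewrite -(mulrA A0 al) -mulrDr ler_wpM2l ?(ltW A00) //.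
  apply: le_trans (_ : al * complex.Re (f (a, b)) + cmod q.[a, b] ^+ 2 * complex.Re (f (a, b)) / al <= _); last first.
    by rewrite lerD2l ler_wpM2r // invr_ge0 ltW.
  have -> : al * complex.Re (f (a, b)) + cmod q.[a, b] ^+ 2 * complex.Re (f (a, b)) / al =
    (al + cmod q.[a, b] ^+ 2 / al) * complex.Re (f (a, b)) by field; rewrite gt_eqF.
  rewrite ler_wpM2r // -subr_ge0.
  have -> : al + cmod q.[a, b] ^+ 2 / al - 2 * cmod q.[a, b] = (al - cmod q.[a, b]) ^+ 2 / al.
    by field; rewrite gt_eqF.
  by rewrite divr_ge0 ?sqr_ge0 // ltW.
rewrite PE; have -> : bimean N r (fun a b => G a b * (s1 a * s2 b)) =
  bimean N r (fun a b => G a b * (k1 a * k2 b)) -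
  bimean N r (fun a b => q.[a, b] * (2 * complex.Re (g (a, b)))%:C%C * (k1 a * k2 b - s1 a * s2 b)) +
  (bimean N r (fun a b => q.[a, b] * (g (a, b))^* * (t1 a * k2 b)) +
   bimean N r (fun a b => q.[a, b] * (g (a, b))^* * (s1 a * t2 b))).
  rewrite -bimeanB -!bimeanD; apply: eq_bimean => // a b ar br.
  by rewrite -addcJ2 (split1 a ar) (split2 b br) /G; ring.
rewrite -/(G x y).
have sum4 (u v w z o : C) : cmod (u - o) <= e / 4 -> cmod v <= e / 2 -> cmod w <= e / 8 ->
    cmod z <= e / 8 -> cmod (u - v + (w + z) - o) <= e.
  move=> hu hv hw hz; have -> : u - v + (w + z) - o = (u - o) + (- v + (w + z)) by ring.
  have -> : e = e / 4 + (e / 2 + (e / 8 + e / 8)) by field.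
  apply: le_trans (cmodD _ _) _; apply: lerD hu _; apply: le_trans (cmodD _ _) _.
  by rewrite cmodN; apply: lerD hv _; apply: le_trans (cmodD _ _) _; exact: lerD.
exact: sum4.
Qed.

End Rigidity.

(** * From approximation to equality by interpolation *)

Section Interpolation.
Variable R : realType.
Local Notation C := R[i].
Implicit Types P : {poly {poly C}}.

Definition sample (k : nat) : C := ((2 + k%:R)^-1)%:C%C.

Lemma sample_inj : injective sample.
Proof.
by move=> i j /complexI /invr_inj /addrI /eqP; rewrite eqr_nat => /eqP.
Qed.

Lemma cmod_sample k : cmod (sample k) <= 2^-1.
Proof.
have k0 : 0 < 2 + k%:R :> R by rewrite ltr_pwDl.
by rewrite cmod_real gtr0_norm ?invr_gt0 // lef_pV2 ?posrE // lerDl.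
Qed.

Definition lagrange_basis n (i : 'I_n) : {poly C} := tnth (lagrange n sample) i.

Lemma lagrange_interpolation n (p : {poly C}) x : (size p <= n.+1)%N ->
  p.[x] = \sum_(i < n.+1) p.[sample i] * (lagrange_basis i).[x].
Proof.
move=> pn; rewrite {1}(lagrange_gen (ltn0Sn n) sample_inj pn) horner_sum.
by apply: eq_bigr => i _; rewrite hornerM hornerC.
Qed.

Lemma lagrange_interpolation2 n1 n2 P x y : bidegree_le n1 n2 P ->
  P.[x, y] = \sum_(i < n1.+1) \sum_(j < n2.+1) P.[sample i, sample j] *
    ((lagrange_basis i).[x] * (lagrange_basis j).[y]).
Proof.
move=> [P1 P2]; rewrite -specializeE (@lagrange_interpolation n1); last first.
  exact: leq_trans (size_specialize _ _) P1.
apply: eq_bigr => i _; rewrite specializeE (@lagrange_interpolation n2).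
  by rewrite mulr_suml; apply: eq_bigr => j _; rewrite -mulrA [X in _ * X]mulrC.
rewrite horner_coef; apply: leq_trans (size_sum _ _ _) _.
apply/bigmax_leqP => k _; rewrite -polyC_exp mulrC mul_polyC.
by apply: leq_trans (size_scale_leq _ _) (P2 k).
Qed.

Lemma exists_interpolant n1 n2 (G : C -> C -> C) : exists2 P, bidegree_le n1 n2 P &
  forall x y, P.[x, y] = \sum_(i < n1.+1) \sum_(j < n2.+1) G (sample i) (sample j) *
    ((lagrange_basis i).[x] * (lagrange_basis j).[y]).
Proof.
have sl n (i : 'I_n.+1) : size (lagrange_basis i) = n.+1.
  by rewrite size_lagrange_ //; exact: sample_inj.
pose P : {poly {poly C}} := \poly_(a < n1.+1) \sum_(i < n1.+1) \sum_(j < n2.+1)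
  (G (sample i) (sample j) * (lagrange_basis i)`_a) *: lagrange_basis j.
exists P => [|x y].
  split=> [|a]; first exact: size_poly.
  rewrite coef_poly; case: ifP => _; last by rewrite size_poly0.
  apply: leq_trans (size_sum _ _ _) _; apply/bigmax_leqP => i _.
  apply: leq_trans (size_sum _ _ _) _; apply/bigmax_leqP => j _.
  by apply: leq_trans (size_scale_leq _ _) _; rewrite sl.
rewrite horner_poly horner_sum.
under eq_bigr => a _ do rewrite hornerM -polyC_exp hornerC horner_sum mulr_suml.
rewrite exchange_big; apply: eq_bigr => i _ /=.
under eq_bigr => a _ do rewrite horner_sum mulr_suml.
rewrite exchange_big; apply: eq_bigr => j _ /=.
rewrite (@horner_coef_wide _ n1.+1 (lagrange_basis i)) ?sl // mulr_suml mulr_sumr.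
by apply: eq_bigr => a _; rewrite hornerZ; ring.
Qed.

(** P interpolates q g at finitely many points of the bidisc. An approximant Q has the same bidegree
    bound, so P - Q is governed by its values at these nodes, where Q is close to q g; hence P = q g
    without any limit of polynomials. *)
Lemma polynomial_of_dominated (n1 n2 : nat) (q : {poly {poly C}}) (f g : C * C -> C) (t K : R) :
  bidegree_le n1 n2 q ->
  (forall x y : C, cmod x < 1 -> cmod y < 1 ->
     differentiable (f : C^o * C^o -> C^o) ((x, y) : C^o * C^o)) ->
  (forall x y : C, cmod x < 1 -> cmod y < 1 ->
     differentiable (g : C^o * C^o -> C^o) ((x, y) : C^o * C^o)) ->
  f (0, 0) = 1 -> 0 < t -> 0 < K ->
  (forall x y, cmod x < 1 -> cmod y < 1 ->
     0 <= complex.Re (g (x, y)) /\ t * complex.Re (g (x, y)) <= complex.Re (f (x, y))) ->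
  (forall r x y, 0 < r < 1 -> cmod x = r -> cmod y = r ->
     cmod q.[x, y] ^+ 2 * complex.Re (f (x, y)) <= K * (1 - r)) ->
  exists2 P, bidegree_le n1 n2 P & forall x y, cmod x < 1 -> cmod y < 1 ->
    P.[x, y] = q.[x, y] * g (x, y).
Proof.
move=> qn df dg f0 t0 K0 gf qf.
have [P Pn PE] := exists_interpolant n1 n2 (fun x y => q.[x, y] * g (x, y)).
exists P => // x y x1 y1; apply/eqP; rewrite -subr_eq0 -cmod_eq0; apply/eqP/le_anti.
rewrite cmod_ge0 andbT.
pose S := \sum_(i < n1.+1) \sum_(j < n2.+1)
  cmod ((lagrange_basis i).[x] * (lagrange_basis j).[y]).
have S0 : 0 <= S by apply: sumr_ge0 => i _; apply: sumr_ge0 => j _; exact: cmod_ge0.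
(* The value 1/2 is included so that the sample points lie in the region where Q is controlled. *)
pose m := Num.max (2^-1) (Num.max (cmod x) (cmod y)).
have [hm xm ym] : [/\ 2^-1 <= m, cmod x <= m & cmod y <= m].
  by rewrite /m !le_max !lexx !orbT.
have m01 : 0 < m < 1.
  by rewrite (lt_le_trans _ hm) ?invr_gt0 //= !gt_max x1 y1 !andbT invf_lt1 // ltr1n.
apply/ler_addgt0Pr => e e0; rewrite add0r.
have S1 : 0 < 1 + S by rewrite ltr_pwDl.
have e1 : 0 < e / (1 + S) by rewrite divr_gt0.
have [Q Qn QP] := approx_of_dominated qn df dg f0 t0 K0 m01 e1 gf qf.
have -> : P.[x, y] - q.[x, y] * g (x, y) =
    (Q.[x, y] - q.[x, y] * g (x, y)) + (P.[x, y] - Q.[x, y]) by ring.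
apply: le_trans (cmodD _ _) _.
have -> : e = e / (1 + S) + e / (1 + S) * S by field; rewrite gt_eqF.
apply: lerD; first exact: QP.
rewrite PE (lagrange_interpolation2 _ _ Qn) -sumrB; apply: le_trans (cmod_sum _ _ _) _.
rewrite mulr_sumr; apply: ler_sum => i _; rewrite -sumrB; apply: le_trans (cmod_sum _ _ _) _.
rewrite mulr_sumr; apply: ler_sum => j _; rewrite -mulrBl cmodM ler_wpM2r ?cmod_ge0 //.
by rewrite -cmodN opprB QP // (le_trans (cmod_sample _)).
Qed.

End Interpolation.

(** * Resultants and intersection multiplicities *)

Section Primality.
Variable R : realType.
Local Notation C := R[i].
Implicit Types p q g h : {poly {poly C}}.

(** Gauss's lemma over C[y], one root of c at a time: if b is a root of c, the slice of g h at b
    vanishes, so y - b divides g or h. The degrees in z1 are unchanged. *)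
Lemma cancel_scalar (c : {poly C}) q g h : c != 0 -> c *: q = g * h ->
  exists g' h', [/\ q = g' * h', size g' = size g & size h' = size h].
Proof.
elim: {c}(size c) {-2}c (leqnn (size c)) q g h => [|n IH] c.
  by rewrite leqn0 size_poly_eq0 => ->.
move=> cn q g h c0 E; have [c1|c1] := eqVneq (size c) 1%N.
  have [a a0 cE] : exists2 a, a != 0 & c = a%:P.
    by have /eqP/size_poly1P[a a0 ->] := c1; exists a.
  exists (a^-1%:P *: g), h; split=> //; last by rewrite size_scale // polyC_eq0 invr_eq0.
  by rewrite -scalerAl -E cE scalerA -polyCM mulVf // scale1r.
have /closed_rootP[b /factor_theorem[d dE]] := c1.
have d0 : d != 0 by apply: contraNneq c0 => d0; rewrite dE d0 mul0r.
have dn : (size d <= n)%N.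
  by move: cn; rewrite dE size_mul ?polyXsubC_eq0 // size_XsubC addn2.
have bgh : specialize b g * specialize b h = 0.
  by rewrite -specializeM -E specializeZ dE hornerM hornerXsubC subrr mulr0 scale0r.
have lin0 : 'X - b%:P != 0 :> {poly C} by rewrite polyXsubC_eq0.
have canc X Y : ('X - b%:P) *: X = ('X - b%:P) *: Y :> {poly {poly C}} -> X = Y.
  by rewrite -!mul_polyC; apply: mulfI; rewrite polyC_eq0.
move: bgh => /eqP; rewrite mulf_eq0 => /orP[] /eqP /specialize_factor[k kE ks].
  have [g' [h' [qE sg sh]]] := IH d dn q k h d0 ltac:(
    by apply: canc; rewrite scalerA mulrC -dE E kE scalerAl).
  by exists g', h'; rewrite sg ks.
have [g' [h' [qE sg sh]]] := IH d dn q g k d0 ltac:(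
    by apply: canc; rewrite scalerA mulrC -dE E kE scalerAr).
by exists g', h'; rewrite sh ks.
Qed.

Lemma unit_size q : q \is a GRing.unit -> size q = 1%N.
Proof. by rewrite poly_unitE => /andP[/eqP]. Qed.

Lemma irreducible_specialize b q : irreducible_elt q -> (1 < size q)%N -> specialize b q != 0.
Proof.
move=> [_ _ irr] q1; apply/eqP => /specialize_factor[q' qE qs].
have /irr[] : q = ('X - b%:P)%:P * q' by rewrite mul_polyC.
  rewrite poly_unitE coefC /= => /andP[_]; rewrite poly_unitE size_XsubC //.
by move/unit_size => q'1; move: q1; rewrite -qs q'1.
Qed.

(** No slice of q vanishes, so each linear factor of d must divide W. *)
Lemma cancel_irreducible (d : {poly C}) q E W : irreducible_elt q -> (1 < size q)%N ->
  d != 0 -> d *: E = q * W -> exists e, E = q * e.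
Proof.
move=> irr q1; elim: {d}(size d) {-2}d (leqnn (size d)) W => [|n IH] d.
  by rewrite leqn0 size_poly_eq0 => ->.
move=> dn W d0 EW; have [d1|d1] := eqVneq (size d) 1%N.
  have [a a0 dE] : exists2 a, a != 0 & d = a%:P.
    by have /eqP/size_poly1P[a a0 ->] := d1; exists a.
  exists (a^-1%:P *: W).
  by rewrite -scalerAr -EW dE scalerA -polyCM mulVf // scale1r.
have /closed_rootP[b /factor_theorem[d' dE]] := d1.
have d'0 : d' != 0 by apply: contraNneq d0 => d'0; rewrite dE d'0 mul0r.
have d'n : (size d' <= n)%N.
  by move: dn; rewrite dE size_mul ?polyXsubC_eq0 // size_XsubC addn2.
have : specialize b q * specialize b W = 0.
  by rewrite -specializeM -EW specializeZ dE hornerM hornerXsubC subrr mulr0 scale0r.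
move=> /eqP; rewrite mulf_eq0 (negbTE (irreducible_specialize b irr q1)) /=.
move=> /eqP /specialize_factor[W' WE _]; apply: (IH d' d'n W' d'0).
have lin0 : ('X - b%:P)%:P != 0 :> {poly {poly C}} by rewrite polyC_eq0 polyXsubC_eq0.
by apply: (mulfI lin0); rewrite !mul_polyC scalerA mulrC -dE EW WE scalerAr.
Qed.

(** Euclid's lemma by descent on the degree of U in z1: the pseudo-remainder of q by U satisfies a
    relation of the same kind. A zero remainder would factor q, by Gauss's lemma. *)
Lemma irreducible_dvd (q U E W : {poly {poly C}}) : irreducible_elt q -> (1 < size q)%N ->
  U != 0 -> (size U < size q)%N -> U * E = q * W -> exists e, E = q * e.
Proof.
move=> irr q1; elim: {U}(size U) {-2}U (leqnn (size U)) W => [|n IH] U.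
  by rewrite leqn0 size_poly_eq0 => ->.
move=> Un W U0 Uq UE.
have [U1|U1] := eqVneq (size U) 1%N.
  have [d d0 dE] : exists2 d, d != 0 & U = d%:P.
    by have /eqP/size_poly1P[a a0 ->] := U1; exists a.
  by apply: (@cancel_irreducible d _ _ W) => //; rewrite -mul_polyC -dE.
have qdiv := Pdiv.Idomain.divp_eq q U.
set S := (q %/ U)%R in qdiv; set T := (q %% U)%R in qdiv.
have c0 : lead_coef U ^+ scalp q U != 0 by rewrite expf_neq0 // lead_coef_eq0.
have [T0|T0] := eqVneq T 0.
  move: qdiv; rewrite T0 addr0 => /(cancel_scalar c0)[g [h [qE gs hs]]].
  have [_ _ /(_ _ _ qE)[]] := irr; move=> /unit_size.
    rewrite gs => S1; have : size q = size U.
      by rewrite qE size_mul -?size_poly_gt0 ?gs ?hs ?S1 // size_poly_gt0.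
    by move=> e; move: Uq; rewrite e ltnn.
  by rewrite hs => /eqP; rewrite (negbTE U1).
have TU : (size T < size U)%N by rewrite Pdiv.Idomain.ltn_modp.
apply: (IH T _ (lead_coef U ^+ scalp q U *: E - S * W) T0) => //.
- by rewrite -ltnS (leq_trans TU).
- exact: ltn_trans Uq.
have -> : T = lead_coef U ^+ scalp q U *: q - S * U by rewrite qdiv addrAC subrr add0r.
by rewrite mulrBl mulrBr -!scalerAl -scalerAr -mulrA UE mulrCA.
Qed.

End Primality.

(** * Sylvester determinants *)

Section Sylvester.
Variable A : idomainType.
Implicit Types E q : {poly A}.

Definition shift_rows n E : 'M[A]_(n, n + n) := \matrix_(i, j) ('X^i * E)`_j.

(* Here [n] is a formal degree: the actual degrees may be smaller. *)
Definition sylvester n E q : 'M[A]_(n + n) := col_mx (shift_rows n E) (shift_rows n q).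

Lemma mul_shift_rows n (u : 'rV[A]_n) E j : (u *m shift_rows n E) 0 j = (rVpoly u * E)`_j.
Proof.
rewrite mxE (_ : rVpoly u = \sum_(i < n) u 0 i *: 'X^i); last first.
  by rewrite [LHS]poly_def; apply: eq_bigr => i _; rewrite -coef_rVpoly_ord coef_poly ltn_ord.
rewrite mulr_suml coef_sum; apply: eq_bigr => i _.
by rewrite mxE -scalerAl coefZ.
Qed.

Lemma mul_sylvester n (u : 'rV[A]_(n + n)) E q j :
  (u *m sylvester n E q) 0 j = (rVpoly (lsubmx u) * E + rVpoly (rsubmx u) * q)`_j.
Proof.
rewrite -{1}(hsubmxK u) mul_row_col mxE !mul_shift_rows coefD //.
Qed.

(** A left null vector encodes a pair of polynomials of degree below n; its first half is nonzero,
    since otherwise q would annihilate the second. *)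
Lemma sylvester_det0 n E q : size q = n.+1 -> (size E <= n.+1)%N ->
  \det (sylvester n E q) = 0 ->
  exists U W : {poly A}, [/\ U != 0, (size U <= n)%N & U * E = q * W].
Proof.
move=> qn En /eqP/det0P[u u0 uS]; set U := rVpoly (lsubmx u); set W := rVpoly (rsubmx u).
have su (v : 'rV[A]_n) : (size (rVpoly v) <= n)%N by exact: size_poly.
have UW : U * E + W * q = 0.
  apply/polyP => j; rewrite coef0; have [jn|jn] := ltnP j (n + n).
    by have := mul_sylvester u E q (Ordinal jn); rewrite uS mxE.
  have sz (v : 'rV[A]_n) (F : {poly A}) : (size F <= n.+1)%N -> (size (rVpoly v * F)%R <= n + n)%N.
    move=> Fn; apply: leq_trans (size_polyMleq _ _) _.
    by have := leq_add (su v) Fn; rewrite addnS; case: (_ + _)%N.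
  rewrite nth_default //; apply: leq_trans (size_polyD _ _) _; rewrite geq_max.
  by rewrite !(leq_trans _ jn) // sz // qn.
have q0 : q != 0 by rewrite -size_poly_gt0 qn.
have U0 : U != 0.
  apply: contraNneq u0 => U0; have W0 : W = 0.
    by move: UW; rewrite U0 mul0r add0r => /eqP; rewrite mulf_eq0 (negbTE q0) orbF => /eqP.
  rewrite -[u]hsubmxK -[lsubmx u]rVpolyK -[rsubmx u]rVpolyK -/U -/W U0 W0 linear0.
  by rewrite row_mx0.
exists U, (- W); split=> //; first exact: su.
by rewrite mulrN mulrC; apply/eqP; rewrite -addr_eq0 mulrC (mulrC q) UW.
Qed.

Lemma shift_rows_eval n E (a : A) (i : 'I_n) : (size E <= n.+1)%N ->
  \sum_(k < n + n) shift_rows n E i k * a ^+ k = a ^+ i * E.[a].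
Proof.
move=> En; rewrite -[a ^+ i]hornerXn -hornerM.
have s : (size ('X^i * E)%R <= n + n)%N.
  apply: leq_trans (size_polyMleq _ _) _; rewrite size_polyXn /=.
  by rewrite -[leqRHS]/(n + n)%N; have := leq_add (ltn_ord i) En; rewrite addSn addnS.
by rewrite [RHS](horner_coef_wide _ s); apply: eq_bigr => k _; rewrite mxE.
Qed.

Lemma det_sylvester_common_root n E q a : (0 < n)%N -> (size E <= n.+1)%N ->
  (size q <= n.+1)%N -> E.[a] = 0 -> q.[a] = 0 -> \det (sylvester n E q) = 0.
Proof.
move=> n0 En qn Ea qa; apply/eqP; rewrite -det_tr; apply/det0P.
exists (\row_(k < n + n) a ^+ k).
  have i0 : (0 < n + n)%N by rewrite addn_gt0 n0.
  apply/eqP => /matrixP /(_ 0 (Ordinal i0)); rewrite !mxE /= => /eqP.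
  by rewrite oner_eq0.
apply/rowP => i; rewrite !mxE; under eq_bigr do rewrite !mxE mulrC.
case: (fintype.split i) => j.
  by rewrite shift_rows_eval // Ea mulr0.
by rewrite shift_rows_eval // qa mulr0.
Qed.

Lemma det_sylvester_roots n E q (a : 'rV[A]_n) : (size E <= n.+1)%N -> (size q <= n.+1)%N ->
  (forall j, q.[a 0 j] = 0) ->
  \det (sylvester n E q) * \det (Vandermonde n a) =
  \det (Vandermonde n a) * \prod_(j < n) E.[a 0 j] * q`_n ^+ n.
Proof.
move=> En qn qa.
pose Vb : 'M[A]_(n, n) := \matrix_(i, j) a 0 j ^+ (n + i).
pose W := block_mx (Vandermonde n a) 0 Vb 1%:M.
have WE k j : W k (lshift n j) = a 0 j ^+ k.
  rewrite -[k]splitK; case: (fintype.split k) => i /=.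
    by rewrite block_mxEul mxE.
  by rewrite block_mxEdl mxE.
have WE2 k j : W k (rshift n j) = (k == rshift n j)%:R.
  rewrite -[k]splitK; case: (fintype.split k) => i /=.
    by rewrite block_mxEur mxE eq_lrshift.
  by rewrite block_mxEdr mxE (inj_eq (@rshift_inj _ _)).
have detW : \det W = \det (Vandermonde n a) by rewrite det_lblock det1 mulr1.
have shiftW (F : {poly A}) : (size F <= n.+1)%N -> shift_rows n F *m W =
    row_mx (\matrix_(i, j) (a 0 j ^+ i * F.[a 0 j])) (\matrix_(i, j) ('X^i * F)`_(n + j)).
  move=> Fn; apply/matrixP => i j; rewrite -[j]splitK; case: (fintype.split j) => l /=.
    rewrite row_mxEl !mxE; under eq_bigr do rewrite WE.
    exact: shift_rows_eval.
  rewrite row_mxEr !mxE; under eq_bigr do rewrite WE2.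
  rewrite (bigD1 (rshift n l)) //= eqxx mulr1 big1 ?addr0 ?mxE //.
  by move=> k kl; rewrite (negbTE kl) mulr0.
rewrite -detW -det_mulmx mul_col_mx !shiftW // detW.
have -> : (\matrix_(i < n, j < n) (a 0 j ^+ i * q.[a 0 j])) = 0.
  by apply/matrixP => i j; rewrite !mxE qa mulr0.
have -> : (\matrix_(i < n, j < n) (a 0 j ^+ i * E.[a 0 j])) =
    Vandermonde n a *m diag_mx (\row_j E.[a 0 j]).
  by apply/matrixP => i j; rewrite mul_mx_diag !mxE.
rewrite -/(block_mx _ _ _ _) det_ublock det_mulmx det_diag.
congr (_ * _ * _); first by apply: eq_bigr => j _; rewrite mxE.
rewrite det_trig.
  rewrite (eq_bigr (fun=> q`_n)) ?prodr_const ?card_ord // => i _.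
  by rewrite mxE coefXnM ltnNge leq_addl /= addnK.
apply/is_trig_mxP => i j ij; rewrite mxE coefXnM ltnNge.
rewrite (leq_trans (ltnW (ltn_ord i)) (leq_addr _ _)) /= nth_default //.
by apply: leq_trans qn _; rewrite -addnBA ?(ltnW ij) // -[n.+1]addn1 leq_add2l subn_gt0.
Qed.

End Sylvester.

Section SylvesterSpecialization.
Variable R : realType.
Local Notation C := R[i].

Lemma sylvester_specialize n (E q : {poly {poly C}}) b :
  (\det (sylvester n E q)).[b] = \det (sylvester n (specialize b E) (specialize b q)).
Proof.
rewrite -[LHS]/(horner_eval b _) -det_map_mx; congr (\det _).
have sh F : map_mx (horner_eval b) (shift_rows n F) = shift_rows n (specialize b F).
  apply/matrixP => i j; rewrite !mxE !coefXnM coef_specialize.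
  by case: ifP => // _; rewrite /horner_eval horner0.
by rewrite map_col_mx !sh.
Qed.

End SylvesterSpecialization.

Section SylvesterDegree.
Variable R : realType.
Local Notation C := R[i].

Lemma size_prod_le_card m d (F : 'I_m -> {poly C}) : (forall i, (size (F i) <= d.+1)%N) ->
  (size (\prod_i F i)%R <= (m * d).+1)%N.
Proof.
move=> Fd; have H : forall r : seq 'I_m, (size (\prod_(i <- r) F i)%R <= (size r * d).+1)%N.
  elim=> [|i r IH]; first by rewrite big_nil size_poly1.
  rewrite big_cons; apply: leq_trans (size_polyMleq _ _) _.
  by have := Fd i; move: IH; rewrite /= mulSn; lia.
by have := H (enum 'I_m); rewrite big_enum size_enum_ord.
Qed.

Lemma size_det_le m d (M : 'M[{poly C}]_m) : (forall i j, (size (M i j) <= d.+1)%N) ->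
  (size (\det M) <= (m * d).+1)%N.
Proof.
move=> Md; apply: leq_trans (size_sum _ _ _) _; apply/bigmax_leqP => s _.
rewrite -signr_odd; have -> (e : bool) (P : {poly C}) : size ((-1) ^+ e * P) = size P.
  by case: e; rewrite ?expr0 ?mul1r // expr1 mulN1r size_polyN.
exact: size_prod_le_card.
Qed.

Lemma size_det_sylvester n1 n2 (E q : {poly {poly C}}) :
  bidegree_le n1 n2 E -> bidegree_le n1 n2 q ->
  (size (\det (sylvester n1 E q)) <= (2 * n1 * n2).+1)%N.
Proof.
move=> [_ En] [_ qn]; rewrite mul2n -addnn; apply: size_det_le => i j.
have sh (F : {poly {poly C}}) : (forall i, (size (F`_i)%R <= n2.+1)%N) -> forall (i : 'I_n1) j, (size (shift_rows n1 F i j) <= n2.+1)%N.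
  by move=> Fn k l; rewrite mxE coefXnM; case: ifP => _ //; rewrite size_poly0.
by rewrite mxE; case: (fintype.split i) => k; exact: sh.
Qed.

End SylvesterDegree.

(** * Rows modulo a polynomial lattice *)

Section Lattice.
Variable R : realType.
Local Notation C := R[i].

(* Each root b of the determinant lets a left null vector of S(b) divide one row of S
   by X - b, at the cost of at most one dimension for A. *)
Lemma lattice_codimension m n (bs : seq C) (Z : C -> Prop) (S : 'M[{poly C}]_m)
    (w : {poly C}) (Y : 'M[{poly C}]_(n, m)) :
  \det S = \prod_(b <- bs) ('X - b%:P) * w -> (forall z, Z z -> w.[z] != 0) ->
  exists (A : 'M[C]_n) (h : {poly C}) (U : 'M[{poly C}]_(n, m)),
    [/\ (n <= \rank A + size bs)%N, forall z, Z z -> h.[z] != 0 &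
        h *: (map_mx polyC A *m Y) = U *m S].
Proof.
elim: bs S w => [|b bs IH] S w dS wZ.
  (* With no roots left, det S = w, and the adjugate gives w Y = (Y adj S) S. *)
  exists 1%:M, w, (Y *m \adj S); split=> //; first by rewrite mxrank1 addn0.
  rewrite map_mx1 mul1mx -mulmxA mul_adj_mx dS big_nil mul1r.
  by rewrite mul_mx_scalar.
have : \det (map_mx (horner_eval b) S) == 0.
  have -> : \det (map_mx (horner_eval b) S) = (\det S).[b] by rewrite det_map_mx.
  by rewrite dS big_cons !hornerM hornerXsubC subrr !mul0r.
move=> /det0P[w0 w0n w0S].
have [i0 w0i] : exists i0, w0 0 i0 != 0.
  by apply/existsP; apply: contraNT w0n => /existsPn H; apply/eqP/rowP => i;
     rewrite mxE; apply/eqP; have := H i; rewrite negbK.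
pose lin : {poly C} := 'X - b%:P.
have lin0 : lin != 0 by rewrite polyXsubC_eq0.
have [s sE] : exists s : 'rV[{poly C}]_m, map_mx polyC w0 *m S = lin *: s.
  exists (\row_k ((map_mx polyC w0 *m S) 0 k %/ lin)); apply/rowP => k.
  rewrite [in RHS]mxE [X in _ * X]mxE mulrC divpK // dvdp_XsubCl /root.
  have := congr1 (fun M : 'rV[C]_m => M 0 k) w0S; rewrite !mxE => /= E.
  apply/eqP; rewrite -E horner_sum; apply: eq_bigr => i _.
  by rewrite !mxE hornerM hornerC.
(* [M0] is the identity with row i0 replaced by w0, invertible because w0 is nonzero at i0. As M0 S
   equals S' with row i0 multiplied by y - b, det S' loses the root b up to a nonzero constant. *)
pose S' : 'M[{poly C}]_m := \matrix_(i, k) if i == i0 then s 0 k else S i k.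
pose M0 : 'M[C]_m := \matrix_(i, k) if i == i0 then w0 0 k else (i == k)%:R.
have dM0 : \det M0 != 0.
  apply/negP => /det0P[u u0 uM]; move/negP: u0; apply; apply/eqP/rowP => j; rewrite mxE.
  have uE k : u 0 i0 * w0 0 k + (if k == i0 then 0 else u 0 k) = 0.
    have := congr1 (fun M : 'rV[C]_m => M 0 k) uM; rewrite !mxE (bigD1 i0) //= mxE eqxx => E.
    rewrite -[RHS]E; congr (_ + _); case: eqVneq => [->|ki].
      by rewrite big1 // => i ii; rewrite mxE (negbTE ii) mulr0.
    rewrite (bigD1 k) //= mxE (negbTE ki) eqxx mulr1 big1 ?addr0 // => i /andP[ii ik].
    by rewrite mxE (negbTE ii) (negbTE ik) mulr0.
  have ui0 : u 0 i0 = 0.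
    by have := uE i0; rewrite eqxx addr0 => /eqP; rewrite mulf_eq0 (negbTE w0i) orbF => /eqP.
  by have := uE j; rewrite ui0 mul0r add0r; case: eqVneq => [->|].
pose D : 'rV[{poly C}]_m := \row_k if k == i0 then lin else 1.
have MS : map_mx polyC M0 *m S = diag_mx D *m S'.
  apply/matrixP => i k; rewrite mul_diag_mx !mxE; case: eqVneq => [->|ii].
    have := congr1 (fun M : 'rV[{poly C}]_m => M 0 k) sE; rewrite !mxE => <-.
    by apply: eq_bigr => j _; rewrite !mxE eqxx.
  rewrite mul1r (bigD1 i) //= !mxE (negbTE ii) eqxx mul1r big1 ?addr0 // => j ji.
  by rewrite !mxE (negbTE ii) eq_sym (negbTE ji) mul0r.
have dS' : \det S' = \prod_(b <- bs) ('X - b%:P) * ((\det M0)%:P * w).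
  apply: (mulfI lin0); have := congr1 determinant MS; rewrite !det_mulmx det_diag.
  rewrite (bigD1 i0) //= mxE eqxx big1 ?mulr1; last by move=> k ki; rewrite mxE (negbTE ki).
  by move=> <-; rewrite det_map_mx dS big_cons -!mulrA mulrCA [in LHS](mulrCA _ (\prod_(b <- bs) _)).
have wZ' z : Z z -> ((\det M0)%:P * w).[z] != 0.
  by move=> /wZ wz; rewrite hornerM hornerC mulf_neq0.
have [A [h [U [rA hZ hU]]]] := IH S' _ dS' wZ'.
(* A combination of rows of S' is turned into one of rows of S when its coefficient at i0 is
   divisible by y - b, because (y - b) s = w0 S. This condition is the vanishing of the single
   column [la], so the rank drops by at most one. *)
pose la : 'cV[C]_n := \col_i (U i i0).[b].
pose K := kermx la; pose U1 := map_mx polyC K *m U.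
have [c cE] : exists c : 'I_n -> {poly C}, forall i, U1 i i0 = lin * c i.
  exists (fun i => U1 i i0 %/ lin) => i; rewrite mulrC divpK // dvdp_XsubCl /root.
  have := congr1 (fun M : 'cV[C]_n => M i 0) (mulmx_ker la); rewrite !mxE => E.
  apply/eqP; rewrite -E horner_sum; apply: eq_bigr => j _.
  by rewrite !mxE hornerM hornerC.
exists (K *m A), h, (\matrix_(i, j) ((if j == i0 then 0 else U1 i j) + c i * (w0 0 j)%:P)).
split=> //.
  have r1 : (\rank la <= 1)%N by exact: rank_leq_col.
  have r2 := mxrank_ker la; have r3 := mxrank_mul_min K A.
  have r4 : (\rank A <= n)%N by exact: rank_leq_row.
  have r5 : (\rank la <= n)%N by exact: rank_leq_row.
  rewrite -/K in r2; move: (\rank (K *m A)) (\rank K) (\rank A) (\rank la) rA r1 r2 r3 r4 r5.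
  by move=> a k e l /=; clear; lia.
rewrite map_mxM -mulmxA scalemxAr hU mulmxA -/U1; clearbody U1.
apply/matrixP => i k; rewrite !mxE (bigD1 i0) //= [RHS](bigD1 i0) //= !mxE !eqxx add0r.
have := congr1 (fun M : 'rV[{poly C}]_m => c i * M 0 k) sE.
rewrite !mxE (bigD1 i0) //= mxE mulrDr mulr_sumr => E.
rewrite cE [lin * c i]mulrC -(mulrA (c i) lin) -E -addrA mulrA; congr (_ + _).
rewrite -big_split; apply: eq_bigr => j ji /=.
by rewrite !mxE (negbTE ji); ring.
Qed.

End Lattice.

Section Fractions.
Variable A : idomainType.
Local Notation "x %:F" := (tofrac x).
Implicit Types a b u v P Q : A.

Lemma field_comb (G : fieldType) (u1 u2 v1 v2 p q : G) : u2 != 0 -> v2 != 0 ->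
  u2 * v2 * (u1 / u2 * p + v1 / v2 * q) = u1 * v2 * p + v1 * u2 * q.
Proof. by move=> u0 v0; field; rewrite u0 v0. Qed.

Lemma field_comb_div (G : fieldType) (a b g u v p q : G) : g != 0 -> b != 0 ->
  g * a = u * p + v * q -> a / b = u / (g * b) * p + v / (g * b) * q.
Proof.
move=> g0 b0 E; have -> : a = (u * p + v * q) / g by rewrite -E mulrAC divff // mul1r.
by field; rewrite g0 b0.
Qed.

Lemma tofrac_comb a u1 u2 v1 v2 P Q : u2 != 0 -> v2 != 0 ->
  a%:F = u1%:F / u2%:F * P%:F + v1%:F / v2%:F * Q%:F ->
  u2 * v2 * a = u1 * v2 * P + v1 * u2 * Q.
Proof.
rewrite -!(tofrac_eq0 u2) -(tofrac_eq0 v2) => u0 v0 E; apply/eqP.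
by rewrite -tofrac_eq tofracD !tofracM E field_comb.
Qed.

Lemma frac_comb a b g u v P Q : g != 0 -> b != 0 -> g * a = u * P + v * Q ->
  a%:F / b%:F = u%:F / (g * b)%:F * P%:F + v%:F / (g * b)%:F * Q%:F.
Proof.
rewrite -(tofrac_eq0 g) -(tofrac_eq0 b) => g0 b0 /(congr1 (@tofrac A)).
by rewrite tofracD !tofracM => /field_comb_div ->.
Qed.

Lemma frac_sum d (c e : 'I_d -> A) a b : b != 0 ->
  a%:F / b%:F - \sum_(i < d) (c i)%:F * (e i)%:F = (a - \sum_(i < d) c i * (b * e i))%:F / b%:F.
Proof.
rewrite -(tofrac_eq0 b) => b0; rewrite tofracB mulrBl; congr (_ - _).
rewrite rmorph_sum mulr_suml; apply: eq_bigr => i _ /=.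
by rewrite !tofracM mulrCA [b%:F * _]mulrC mulfK.
Qed.

End Fractions.

(** * Local ideals and multiplicities through polynomials *)

Section LocalAlgebra.
Variable K : fieldType.
Local Notation B := {poly {poly K}}.
Local Notation "x %:F" := (tofrac x).
Implicit Types (z : K * K) (a b P Q : B).

(* Membership in the ideal generated by [P] and [Q] in the local ring at [z],
   for a polynomial [a], with the denominators cleared. *)
Definition locally_in z P Q a :=
  exists g u v, g.[z.1, z.2] != 0 /\ g * a = u * P + v * Q.

Definition locally_free z P Q d (e : 'I_d -> B) := forall c : 'I_d -> K,
  locally_in z P Q (\sum_(i < d) (c i)%:P%:P * e i) -> forall i, c i = 0.

Lemma value_neq0 z a : a.[z.1, z.2] != 0 -> a != 0.
Proof. by apply: contraNneq => ->; rewrite !horner0. Qed.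

Lemma local_ring_poly z a : local_ring z a%:F.
Proof.
exists a, 1; rewrite tofrac1 divr1; split=> //.
by rewrite !hornerC oner_eq0.
Qed.

Lemma local_ideal_locally_in z P Q a : local_ideal z P Q a%:F -> locally_in z P Q a.
Proof.
move=> [u [v [[u1 [u2 [u20 uE]]] [v1 [v2 [v20 vE]]] aE]]].
exists (u2 * v2), (u1 * v2), (v1 * u2); split; first by rewrite !hornerM mulf_neq0.
by apply: tofrac_comb (value_neq0 u20) (value_neq0 v20) _; rewrite -uE -vE.
Qed.

Lemma locally_in_local_ideal z P Q a b : b.[z.1, z.2] != 0 -> locally_in z P Q a ->
  local_ideal z P Q (a%:F / b%:F).
Proof.
move=> b0 [g [u [v [g0 gE]]]].
have gb : (g * b).[z.1, z.2] != 0 by rewrite !hornerM mulf_neq0.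
exists (u%:F / (g * b)%:F), (v%:F / (g * b)%:F); split.
- by exists u, (g * b).
- by exists v, (g * b).
- exact: frac_comb (value_neq0 g0) (value_neq0 b0) gE.
Qed.

Lemma locally_in_cancel z P Q a b : b.[z.1, z.2] != 0 -> locally_in z P Q (b * a) ->
  locally_in z P Q a.
Proof.
move=> b0 [g [u [v [g0 gE]]]]; exists (g * b), u, v.
by split; [rewrite !hornerM mulf_neq0|rewrite -mulrA].
Qed.

Lemma locally_inZ z P Q a b : locally_in z P Q a -> locally_in z P Q (b * a).
Proof.
move=> [g [u [v [g0 gE]]]]; exists g, (b * u), (b * v).
by split=> //; rewrite mulrCA gE mulrDr !mulrA.
Qed.

(** A free family of maximal length is a basis of the local quotient, even though only polynomial
    families are considered: denominators are units at z. *)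
Lemma intersection_multiplicity_le (R : realType) z P Q k :
  (forall d (e : 'I_d -> B), locally_free z P Q e -> (d <= k)%N) ->
  exists d (e : 'I_d -> B), locally_free z P Q e /\
    (intersection_multiplicity R z P Q <= (d%:R)%:E)%E.
Proof.
move=> bounded; pose S d := `[< exists e : 'I_d -> B, locally_free z P Q e >].
have S0 : exists d, S d.
  by exists 0%N; apply/asboolP; exists (fun=> 0) => c _; case.
have Sk d : S d -> (d <= k)%N by move=> /asboolP[e /bounded].
have [d /asboolP[e efree] dmax] := ex_maxnP S0 Sk.
exists d, e; split=> //; apply: ereal_inf_lbound; exists d => //.
exists (fun i => (e i)%:F); split=> [i||c].
- exact: local_ring_poly.
- move=> x [a [b [b0 xE]]].
  (* To express a / b, the numerator a is adjoined to the family b e. By maximality the result is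
     dependent, and the coefficient of a is nonzero because e is free and b is a unit at z. *)
  pose e' (i : 'I_d.+1) := if unlift ord0 i is Some j then b * e j else a.
  have : ~ locally_free z P Q e'.
    by move=> h; have := dmax d.+1; rewrite ltnn => /(_ (asboolT (ex_intro _ e' h))).
  move=> /existsNP[c /not_implyP[cI /existsNP[i0 ci0]]].
  move: cI; rewrite big_ord_recl /e' unlift_none.
  under eq_bigr do rewrite liftK.
  move=> cI; have [c0|c0] := eqVneq (c ord0) 0.
    exfalso; have : locally_in z P Q (\sum_(i < d) (c (lift ord0 i))%:P%:P * e i).
      apply: locally_in_cancel b0 _; move: cI; rewrite c0 !polyC0 mul0r add0r.
      by rewrite mulr_sumr; under eq_bigr do rewrite mulrCA.
    by move=> /efree H; apply: ci0; case: (unliftP ord0 i0) => [j ->|->//]; exact: H.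
  exists (fun i => - (c (lift ord0 i) / c ord0)); rewrite xE.
  rewrite (frac_sum (fun i => (- (c (lift ord0 i) / c ord0))%:P%:P)); last exact: value_neq0 b0.
  apply: locally_in_local_ideal => //.
  have cc0 : (c ord0)%:P%:P.[z.1, z.2] != 0 :> K by rewrite !hornerC.
  apply: locally_in_cancel cc0 _; congr (locally_in _ _ _ _): cI.
  rewrite mulrBr; congr (_ + _); rewrite mulr_sumr -sumrN; apply: eq_bigr => i _.
  rewrite [X in - X]mulrA -mulNr; congr (_ * _).
  by rewrite -!polyCM -!polyCN mulrN opprK mulrCA divff // mulr1.
- under eq_bigr do rewrite -tofracM; rewrite -rmorph_sum.
  by move=> /local_ideal_locally_in /efree.
Qed.

End LocalAlgebra.

Section SylvesterIdeal.
Variable A : idomainType.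
Implicit Types E q F : {poly A}.

Lemma sylvester_combination n E q F (u : 'rV[A]_(n + n)) :
  (size E <= n.+1)%N -> (size q <= n.+1)%N -> (size F <= n + n)%N ->
  u *m sylvester n E q = poly_rV F ->
  F = rVpoly (lsubmx u) * E + rVpoly (rsubmx u) * q.
Proof.
move=> En qn Fn uF; apply/polyP => j; have [jn|jn] := ltnP j (n + n).
  by have := mul_sylvester u E q (Ordinal jn); rewrite uF mxE.
have su (v : 'rV[A]_n) : (size (rVpoly v) <= n)%N by exact: size_poly.
have sz (v : 'rV[A]_n) (G : {poly A}) : (size G <= n.+1)%N -> (size (rVpoly v * G)%R <= n + n)%N.
  move=> Gn; apply: leq_trans (size_polyMleq _ _) _.
  by have := leq_add (su v) Gn; rewrite addnS; case: (_ + _)%N.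
rewrite !nth_default ?(leq_trans Fn) //; apply: leq_trans (size_polyD _ _) _.
by rewrite geq_max !(leq_trans _ jn) // sz.
Qed.

(** Row 0 of the adjugate times the matrix is the determinant times the first unit row, which
    encodes the constant polynomial. *)
Lemma det_sylvester_combination n E q : (0 < n)%N -> (size E <= n.+1)%N ->
  (size q <= n.+1)%N -> exists u v, (\det (sylvester n E q))%:P = u * E + v * q.
Proof.
move=> n0 En qn; have i0 : (0 < n + n)%N by rewrite addn_gt0 n0.
set S := sylvester n E q; pose r := row (Ordinal i0) (\adj S).
exists (rVpoly (lsubmx r)), (rVpoly (rsubmx r)).
apply: sylvester_combination => //; first by rewrite (leq_trans (size_polyC_leq1 _)).
rewrite -row_mul mul_adj_mx; apply/rowP => j; rewrite !mxE coefC eq_sym -val_eqE /=.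
by case: eqP.
Qed.

(** The exponent must be common to all i, so that constant linear combinations of the E i and of the
    T i correspond. *)
Lemma uniform_pseudo_division N q (E : 'I_N -> {poly A}) : q != 0 ->
  exists k (S T : 'I_N -> {poly A}), forall i,
    lead_coef q ^+ k *: E i = S i * q + T i /\ (size (T i) < size q)%N.
Proof.
move=> q0; pose k i := scalp (E i) q; pose l i := lead_coef q ^+ ((\sum_i k i)%N - k i).
exists (\sum_i k i)%N, (fun i => l i *: (E i %/ q)), (fun i => l i *: (E i %% q)) => i.
split; last by apply: leq_ltn_trans (size_scale_leq _ _) _; rewrite Pdiv.Idomain.ltn_modp.
rewrite -scalerAl -scalerDr -Pdiv.Idomain.divp_eq scalerA -exprD subnK //.
by rewrite (bigD1 i) //= leq_addr.
Qed.

End SylvesterIdeal.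

(** * A Bezout bound for families attached to several points *)

Section BezoutBound.
Variable R : realType.
Local Notation C := R[i].
Implicit Types (z : C * C) (a b P q : {poly {poly C}}).

Lemma locally_inD z P q a b : locally_in z P q a -> locally_in z P q b -> locally_in z P q (a + b).
Proof.
move=> [g [u [v [g0 gE]]]] [g' [u' [v' [g'0 gE']]]].
exists (g * g'), (u * g' + u' * g), (v * g' + v' * g); split.
  by rewrite !hornerM mulf_neq0.
by rewrite mulrDr mulrAC gE -mulrA gE'; ring.
Qed.

Lemma locally_in_comb z P q u v : locally_in z P q (u * P + v * q).
Proof. by exists 1, u, v; rewrite mul1r !hornerC oner_neq0. Qed.

Lemma locally_in_sum z P q (I : finType) (D : pred I) (G : I -> {poly {poly C}}) :
  (forall i, D i -> locally_in z P q (G i)) -> locally_in z P q (\sum_(i | D i) G i).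
Proof.
move=> GI; elim/big_ind: _ => //; last by move=> x y; exact: locally_inD.
by have := locally_in_comb z P q 0 0; rewrite !mul0r addr0.
Qed.

Lemma locally_free_sub z p q d (e : 'I_d -> {poly {poly C}}) :
  locally_free z p q e -> locally_free z p (p - q) e.
Proof.
move=> H c [g [u [v [g0 gE]]]]; apply: H; exists g, (u + v), (- v).
by split=> //; rewrite gE; ring.
Qed.

Lemma polynomial_unit_factor (f : {poly C}) x : f != 0 ->
  exists k (g : {poly C}), f = ('X - x%:P) ^+ k * g /\ g.[x] != 0.
Proof.
move=> f0; have [k [g gx fE]] := multiplicity_XsubC f x.
by exists k, g; rewrite mulrC; split=> //; move: gx; rewrite f0 /root.
Qed.

(** The resultant lies in the ideal, and all of it but a power of y - z.2 is a unit at z. *)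
Lemma separating_power_y z P q n : (0 < n)%N -> (size P <= n.+1)%N -> (size q <= n.+1)%N ->
  \det (sylvester n P q) != 0 -> exists k, locally_in z P q (('X - z.2%:P) ^+ k)%:P.
Proof.
move=> n0 Pn qn /(polynomial_unit_factor z.2)[k [g [dE g0]]].
have [u [v E]] := det_sylvester_combination n0 Pn qn.
exists k, g%:P, u, v; split; first by rewrite hornerC.
by rewrite -E dE -polyCM mulrC.
Qed.

(** Modulo y - z.2, q is its slice, that is a power of x - z.1 times a unit; the slice is nonzero
    because its top coefficient is. Raising to the power k pushes the error into the ideal through
    (y - z.2)^k. *)
Lemma separating_power_x z P q n : (0 < n)%N -> (size P <= n.+1)%N -> (size q <= n.+1)%N ->
  \det (sylvester n P q) != 0 -> (q`_n).[z.2] != 0 ->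
  exists k, locally_in z P q (('X - z.1%:P%:P) ^+ k).
Proof.
move=> n0 Pn qn d0 qz; have [k yk] := separating_power_y z n0 Pn qn d0.
have Q0 : specialize z.2 q != 0.
  by apply: contraNneq qz => /(congr1 (fun f : {poly C} => f`_n)); rewrite coef_specialize coef0 => ->.
have [m [Q1 [QE Q1z]]] := polynomial_unit_factor z.1 Q0.
pose L (f : {poly C}) : {poly {poly C}} := map_poly polyC f.
have LE f x y : (L f).[x, y] = f.[x] by rewrite /L horner_map hornerC.
have [R1 qE _] : exists2 R1, q - L (specialize z.2 q) = ('X - z.2%:P) *: R1 &
    size R1 = size (q - L (specialize z.2 q)).
  apply: specialize_factor; apply/polyP => i; rewrite coef_specialize coefB coef_map /=.
  by rewrite hornerD hornerN hornerC coef_specialize subrr coef0.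
exists (m * k)%N; apply: (@locally_in_cancel _ _ _ _ _ (L Q1 ^+ k)).
  by rewrite -[L Q1 ^+ k]rmorphXn LE horner_exp expf_neq0.
have -> : L Q1 ^+ k * ('X - z.1%:P%:P) ^+ (m * k) = L (specialize z.2 q) ^+ k.
  rewrite exprM -exprMn QE; congr (_ ^+ k); rewrite /L rmorphM rmorphXn rmorphB /=.
  by rewrite map_polyX map_polyC mulrC.
have -> : L (specialize z.2 q) = - (('X - z.2%:P)%:P * R1) + q by rewrite mul_polyC -qE; ring.
set Y : {poly {poly C}} := ('X - z.2%:P)%:P.
have [T ->] : exists T, (- (Y * R1) + q) ^+ k = (- R1) ^+ k * Y ^+ k + T * q.
  exists (\sum_(i < k) (- (Y * R1) + q) ^+ (k.-1 - i) * (- (Y * R1)) ^+ i).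
  rewrite -exprMn mulNr [R1 * Y]mulrC -[LHS](subrK ((- (Y * R1)) ^+ k)) [LHS]addrC.
  by congr (_ + _); rewrite subrXX addrAC subrr add0r mulrC.
apply: locally_inD; last by have := locally_in_comb z P q 0 T; rewrite mul0r add0r.
by apply: locally_inZ; rewrite /Y -rmorphXn.
Qed.

Lemma separating_function z z' P q n : z <> z' -> (0 < n)%N ->
  (size P <= n.+1)%N -> (size q <= n.+1)%N ->
  \det (sylvester n P q) != 0 -> (q`_n).[z'.2] != 0 ->
  exists2 g, locally_in z' P q g & g.[z.1, z.2] != 0.
Proof.
move=> zz n0 Pn qn d0 qz; have [e2|n2] := eqVneq z.2 z'.2.
  have [k kI] := separating_power_x n0 Pn qn d0 qz.
  exists (('X - z'.1%:P%:P) ^+ k) => //; rewrite !horner_exp expf_neq0 //.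
  rewrite !hornerE subr_eq0; apply: contra_notN zz => /eqP e1.
  by rewrite [z]surjective_pairing [z']surjective_pairing e1 e2.
have [k kI] := separating_power_y z' n0 Pn qn d0.
exists (('X - z'.2%:P) ^+ k)%:P => //.
by rewrite hornerC horner_exp expf_neq0 // hornerXsubC subr_eq0.
Qed.

(** Replaces the Chinese remainder theorem: a product of separating functions is a unit at one point
    and lies in the local ideals at the others. *)
Lemma isolating_function s (z : 'I_s -> C * C) P q n : injective z -> (0 < n)%N ->
  (size P <= n.+1)%N -> (size q <= n.+1)%N -> \det (sylvester n P q) != 0 ->
  (forall i, (q`_n).[(z i).2] != 0) ->
  exists H : 'I_s -> {poly {poly C}}, forall i, (H i).[(z i).1, (z i).2] != 0 /\
    forall j, j != i -> locally_in (z j) P q (H i).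
Proof.
move=> zi n0 Pn qn d0 qz.
have /choice[g gP] : forall ij : 'I_s * 'I_s, exists g, ij.2 != ij.1 ->
    locally_in (z ij.2) P q g /\ g.[(z ij.1).1, (z ij.1).2] != 0.
  move=> [i j] /=; have [->|ji] := eqVneq j i; first by exists 0.
  have zz : z i <> z j by move/zi => e; rewrite e eqxx in ji.
  by have [g ? ?] := separating_function zz n0 Pn qn d0 (qz j); exists g.
exists (fun i => \prod_(j | j != i) g (i, j)) => i; split=> [|j ji].
  elim/big_ind: _ => [|a b|j ji]; first by rewrite !hornerC oner_neq0.
    by move=> ? ?; rewrite !hornerM mulf_neq0.
  by have [] := gP (i, j) ji.
by rewrite (bigD1 j) //= mulrC; apply: locally_inZ; have [] := gP (i, j) ji.
Qed.

(* Multiplied by isolating functions and reduced modulo q, the families at the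
   different points become rows of length 2n, to which the lattice lemma applies. *)
Lemma independent_family_bound n P q (bs : seq C) (w : {poly C}) s (z : 'I_s -> C * C)
    N (o : 'I_N -> 'I_s) (E : 'I_N -> {poly {poly C}}) :
  injective z -> (0 < n)%N -> (size P <= n.+1)%N -> size q = n.+1 ->
  (forall i, (q`_n).[(z i).2] != 0) ->
  \det (sylvester n P q) = \prod_(b <- bs) ('X - b%:P) * w ->
  (forall i, w.[(z i).2] != 0) ->
  (forall i (c : 'I_N -> C),
     locally_in (z i) P q (\sum_(j | o j == i) (c j)%:P%:P * E j) ->
     forall j, o j = i -> c j = 0) ->
  (N <= size bs)%N.
Proof.
move=> zi n0 Pn qn qz dE wz free; case: (posnP N) => [->//|N0].
have d0 : \det (sylvester n P q) != 0.
  rewrite dE mulf_neq0 //; first exact: monic_neq0 (monic_prod_XsubC _ _ _).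
  by apply: contraNneq (wz (o (Ordinal N0))) => ->; rewrite horner0.
have qn' : (size q <= n.+1)%N by rewrite qn.
have q0 : q != 0 by rewrite -size_poly_gt0 qn.
have [H HP] := isolating_function zi n0 Pn qn' d0 qz.
have [k [S [T ST]]] := uniform_pseudo_division (fun j => H (o j) * E j) q0.
have Tn j : (size (T j) <= n + n)%N.
  by have [_] := ST j; rewrite qn ltnS => /leq_trans; apply; exact: leq_addr.
pose Y : 'M[{poly C}]_(N, n + n) := \matrix_(j, i) (T j)`_i.
pose Z (y : C) := exists i, y = (z i).2.
have wZ y : Z y -> w.[y] != 0 by move=> [i ->].
have [A [h [U [rA hZ hU]]]] := lattice_codimension Y dE wZ.
(* If N exceeded the number of roots, A would have a nonzero row, that is a nontrivial relation
   modulo (P, q) among the reduced rows. *)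
rewrite leqNgt; apply/negP => Nbs.
have rA0 : (0 < \rank A)%N by rewrite lt0n; apply: contraTneq rA => ->; rewrite add0n -ltnNge.
have [i0 /existsP[j0 Aij]] : exists i0, [exists j0, A i0 j0 != 0].
  apply/existsP; apply: contraTT rA0 => /existsPn A0; rewrite -eqn0Ngt mxrank_eq0.
  apply/eqP/matrixP => i j; rewrite mxE; apply/eqP.
  by have /existsPn /(_ j) := A0 i; rewrite negbK.
pose F := h%:P * \sum_j (A i0 j)%:P%:P * T j.
have [u [v FE]] : exists u v, F = u * P + v * q.
  exists (rVpoly (lsubmx (row i0 U))), (rVpoly (rsubmx (row i0 U))).
  apply: sylvester_combination => //.
    rewrite /F mul_polyC; apply: leq_trans (size_scale_leq _ _) _.
    apply: leq_trans (size_sum _ _ _) _; apply/bigmax_leqP => j _.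
    by rewrite mul_polyC; apply: leq_trans (size_scale_leq _ _) (Tn j).
  rewrite -row_mul -hU; apply/rowP => i; rewrite !mxE /F mul_polyC coefZ coef_sum.
  by congr (_ * _); apply: eq_bigr => j _; rewrite !mxE [in RHS]mul_polyC coefZ.
move/eqP: Aij; apply; apply: (free (o j0)) => //.
set i := o j0; apply: (@locally_in_cancel _ _ _ _ _ (h%:P * (lead_coef q ^+ k)%:P * H i)).
  rewrite !hornerM !hornerC !mulf_neq0 //; [by apply: hZ; exists i| |by have [] := HP i].
  by rewrite horner_exp expf_neq0 // lead_coefE qn.
(* Modulo q, F is h lc(q)^k times the full combination of the H (o j) E j. At z i the terms attached
   to other points lie in the ideal, because H (o j) does. *)
have -> : h%:P * (lead_coef q ^+ k)%:P * H i * \sum_(j | o j == i) (A i0 j)%:P%:P * E j =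
    F + (\sum_j h%:P * (A i0 j)%:P%:P * S j) * q
    - \sum_(j | o j != i) (h%:P * (lead_coef q ^+ k)%:P * (A i0 j)%:P%:P * E j) * H (o j).
  have ST' j : h%:P * ((A i0 j)%:P%:P * T j) + h%:P * (A i0 j)%:P%:P * S j * q =
      h%:P * (lead_coef q ^+ k)%:P * (A i0 j)%:P%:P * E j * H (o j).
    have [E1 _] := ST j; move: E1; rewrite -mul_polyC => E1.
    have -> : T j = (lead_coef q ^+ k)%:P * (H (o j) * E j) - S j * q.
      by rewrite E1 addrAC subrr add0r.
    by ring.
  apply/eqP; rewrite eq_sym subr_eq; apply/eqP.
  rewrite [X in X + _]mulr_sumr mulr_suml -big_split /=.
  under eq_bigr do rewrite ST'.
  rewrite (bigID (fun j => o j == i)) /=; congr (_ + _).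
  rewrite mulr_sumr; apply: eq_bigr => j /eqP ->.
  by ring.
rewrite FE; apply: locally_inD.
  have -> : u * P + v * q + (\sum_j h%:P * (A i0 j)%:P%:P * S j) * q =
    u * P + (v + \sum_j h%:P * (A i0 j)%:P%:P * S j) * q by rewrite -addrA mulrDl.
  exact: locally_in_comb.
rewrite -sumrN; apply: locally_in_sum => j oj; rewrite -mulNr.
by apply: locally_inZ; have [_] := HP (o j); apply; rewrite eq_sym.
Qed.

End BezoutBound.

(** * Summation of the multiplicities *)

Section Saturation.
Variable R : realType.
Local Notation C := R[i].
Implicit Types (z : C * C) (P q : {poly {poly C}}).

Lemma sum_free_le n P q (bs : seq C) (w : {poly C}) s (z : 'I_s -> C * C)
    (d : 'I_s -> nat) (e : forall i, 'I_(d i) -> {poly {poly C}}) :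
  injective z -> (0 < n)%N -> (size P <= n.+1)%N -> size q = n.+1 ->
  (forall i, (q`_n).[(z i).2] != 0) ->
  \det (sylvester n P q) = \prod_(b <- bs) ('X - b%:P) * w ->
  (forall i, w.[(z i).2] != 0) ->
  (forall i, locally_free (z i) P q (e i)) ->
  (\sum_i d i <= size bs)%N.
Proof.
move=> zi n0 Pn qn qz dE wz free; pose T := {i : 'I_s & 'I_(d i)}.
have -> : (\sum_i d i)%N = #|{: T}|.
  by rewrite card_tagged sumnE big_map big_enum; apply: eq_bigr => i _; rewrite card_ord.
pose o (j : 'I_#|{: T}|) := tag (enum_val j).
pose E (j : 'I_#|{: T}|) := e (tag (enum_val j)) (tagged (enum_val j)).
apply: (independent_family_bound (o := o) (E := E) zi n0 Pn qn qz dE wz) => i c cI j oj.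
pose c' (l : 'I_(d i)) := c (enum_rank (Tagged (fun i => 'I_(d i)) l : T)).
have cE : \sum_(j | o j == i) (c j)%:P%:P * E j = \sum_(l < d i) (c' l)%:P%:P * e i l.
  transitivity (\sum_(k | k == i) \sum_(l < d k)
    (c (enum_rank (Tagged (fun i => 'I_(d i)) l : T)))%:P%:P * e k l); last by rewrite big_pred1_eq.
  rewrite sig_big_dep /= (reindex _ (onW_bij _ (@enum_val_bij T))) /=.
  apply: eq_big => [k|k _]; first by rewrite /o andbT.
  by rewrite /E -{1}(enum_valK k); congr ((c (enum_rank _))%:P%:P * _); case: (enum_val k).
rewrite -(enum_valK j); move: cI; rewrite cE => /free H; move: oj; rewrite /o.
by case: (enum_val j) => i' l /= ei; subst i'; exact: H.
Qed.

(** Stated for P and P - q because the multiplicities concern p and p~, whereas the resultant is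
    taken with q = p - p~; the ideals agree. *)
Lemma esum_multiplicity_le n P q (bs : seq C) (w : {poly C}) (D : set (C * C)) :
  (0 < n)%N -> (size P <= n.+1)%N -> size q = n.+1 ->
  (forall z, D z -> (q`_n).[z.2] != 0) ->
  \det (sylvester n P q) = \prod_(b <- bs) ('X - b%:P) * w ->
  (forall z, D z -> w.[z.2] != 0) ->
  (\esum_(z in D) intersection_multiplicity R z P (P - q) <= ((size bs)%:R)%:E)%E.
Proof.
move=> n0 Pn qn qz dE wz.
have freeB z d (e : 'I_d -> {poly {poly C}}) : locally_free z P (P - q) e -> locally_free z P q e.
  by move=> /locally_free_sub; rewrite opprB addrCA subrr addr0.
have /choice[d dP] : forall z, exists d, D z -> exists e : 'I_d -> {poly {poly C}},
    locally_free z P q e /\ (intersection_multiplicity R z P (P - q) <= (d%:R)%:E)%E.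
  move=> z; have [Dz|nDz] := pselect (D z); last by exists 0%N.
  (* The bound applied to the single point z limits the length of free families there, so the
     multiplicity is finite. *)
  have [|d [e [/freeB ef eI]]] := @intersection_multiplicity_le C R z P (P - q) (size bs).
    move=> d e /freeB ef; have zi : injective (fun _ : 'I_1 => z) by move=> i j _; rewrite !ord1.
    have := sum_free_le zi n0 Pn qn (fun=> qz z Dz) dE (fun=> wz z Dz) (fun=> ef).
    by rewrite big_ord1.
  by exists d => _; exists e.
apply: ge_ereal_sup => _ [X [Xfin XD] <-]; rewrite fsbig_finite //=.
set s := (X in \sum_(_ <- X) _); have us : uniq s := finmap.fset_uniq _.
have sD z : z \in s -> D z.
  by rewrite (_ : (z \in s) = (z \in X)) ?in_fset_set // inE => /XD.
move: us sD; move: (s : seq _) => {}s us sD.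
have zD i : D (tnth (in_tuple s) i) by apply: sD; exact: mem_tnth.
pose e i := projT1 (cid (dP _ (zD i))).
have eP i : locally_free (tnth (in_tuple s) i) P q (e i).
  by have [] := projT2 (cid (dP _ (zD i))).
have zi : injective (tnth (in_tuple s)) by apply/tuple_uniqP.
have := sum_free_le zi n0 Pn qn (fun i => qz _ (zD i)) dE (fun i => wz _ (zD i)) eP.
rewrite -(ler_nat R) -lee_fin; apply: le_trans.
rewrite natr_sum -sumEFin big_tnth; apply: lee_sum => i _.
by have [e' [_]] := dP _ (zD i).
Qed.

End Saturation.

(** * Slices over the unit circle *)

Section RootRatio.
Variable R : realType.
Local Notation C := R[i].

(* Each linear factor of a polynomial without zeros in the disc varies by a
   bounded factor between two points of the disc. *)
Lemma zero_free_ratio (Q : {poly C}) n (x c : C) : (size Q <= n.+1)%N ->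
  (forall a, cmod a < 1 -> Q.[a] != 0) -> cmod x < 1 -> cmod c < 1 ->
  cmod Q.[c] <= (2 / (1 - cmod x)) ^+ n * cmod Q.[x].
Proof.
move=> Qn Q0 x1 c1; have [s sE] := closed_field_poly_normal Q.
have lQ : lead_coef Q != 0.
  by rewrite lead_coef_eq0; apply: contraNneq (Q0 x x1) => ->; rewrite horner0.
set k := 2 / (1 - cmod x); have x0 := cmod_ge0 x.
have k1 : 1 <= k by rewrite /k ler_pdivlMr; lra.
have k0 : 0 <= k by apply: le_trans k1.
have sn : (size s <= n)%N.
  by move: Qn; rewrite sE size_scale // size_prod_XsubC.
have s1 a : a \in s -> 1 <= cmod a.
  move=> sa; rewrite leNgt; apply/negP => /Q0; rewrite sE hornerZ horner_prod.
  by rewrite (big_rem a) //= hornerXsubC subrr mul0r mulr0 eqxx.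
rewrite sE !hornerZ !cmodM mulrCA ler_wpM2l ?cmod_ge0 // !horner_prod !cmod_prod.
apply: (@le_trans _ _ (k ^+ size s * \prod_(a <- s) cmod ('X - a%:P).[x])); last first.
  by rewrite ler_wpM2r ?ler_weXn2l // prodr_ge0 // => i _; exact: cmod_ge0.
elim: s s1 {sE sn} => [|a s IH] s1; first by rewrite !big_nil expr0 mulr1.
rewrite !big_cons exprS mulrACA; apply: ler_pM; rewrite ?cmod_ge0 //.
- by rewrite prodr_ge0 // => i _; exact: cmod_ge0.
- have a1 := s1 a (mem_head _ _); rewrite !hornerXsubC.
  apply: le_trans (cmodB _ _) _; have := cmodD (a - x) x; rewrite subrK -opprB cmodN.
  rewrite /k mulrAC ler_pdivlMr; last lra.
  by move: c1 a1 x1 x0 (cmod_ge0 c); clear; nra.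
- by apply: IH => b bs; apply: s1; rewrite inE bs orbT.
Qed.

End RootRatio.

Section Slices.
Variable R : realType.
Local Notation C := R[i].
Variable p : {poly {poly C}}.
Local Notation pt := (reflection p).
Local Notation n1 := (deg1 p).
Local Notation n2 := (deg2 p).
Local Notation q := (p - pt).
Hypothesis p_neq0 : forall x y : C, cmod x < 1 -> cmod y < 1 -> p.[x, y] != 0.
Hypothesis refl0 : pt.[0, 0] = 0.
Hypothesis q_irr : irreducible_elt q.

Lemma horner2_00 (P : {poly {poly C}}) : P.[0, 0] = P`_0`_0.
Proof. by rewrite polyC0 !horner_coef0. Qed.

Lemma coef_reflection i j : (i <= n1)%N -> (j <= n2)%N ->
  pt`_i`_j = (p`_(n1 - i)`_(n2 - j))^*.
Proof. by move=> i1 j2; rewrite /reflection !coef_poly !ltnS i1 coef_poly ltnS j2. Qed.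

Lemma bidegree_poly : bidegree_le n1 n2 p.
Proof.
split=> [|i]; first exact: leqSpred.
exact: leq_trans (max_size_coefXY _ _) (leqSpred _).
Qed.

Lemma bidegree_reflection : bidegree_le n1 n2 pt.
Proof.
split=> [|i]; first exact: size_poly.
by rewrite coef_poly; case: ifP => _; rewrite ?size_poly0 ?size_poly.
Qed.

Lemma bidegreeB (P Q : {poly {poly C}}) m1 m2 :
  bidegree_le m1 m2 P -> bidegree_le m1 m2 Q -> bidegree_le m1 m2 (P - Q).
Proof.
move=> [P1 P2] [Q1 Q2]; split=> [|i]; last rewrite coefB.
  by rewrite (leq_trans (size_polyD _ _)) // geq_max P1 size_polyN.
by rewrite (leq_trans (size_polyD _ _)) // geq_max P2 size_polyN Q2.
Qed.

Lemma bidegree_difference : bidegree_le n1 n2 q.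
Proof. exact: bidegreeB bidegree_poly bidegree_reflection. Qed.

Lemma coef00_neq0 : p`_0`_0 != 0.
Proof. by rewrite -horner2_00; apply: p_neq0; rewrite cmod0. Qed.

Lemma top_coef0 : p`_n1`_n2 = 0.
Proof.
apply/eqP; have := refl0; rewrite horner2_00 coef_reflection // !subn0 => /eqP.
by rewrite conjC_eq0.
Qed.

Lemma deg1_gt0 : (0 < n1)%N.
Proof.
have p0 : p != 0 by apply: contraNneq coef00_neq0 => ->; rewrite !coef0.
rewrite lt0n; apply/negP => /eqP n10; have := top_coef0; rewrite n10 /deg2 /sizeY.
have p1 : size p = 1%N.
  by move: n10; rewrite /deg1; case: (size p) (size_poly_gt0 p) => [|[]//]; rewrite p0.
rewrite p1 big_ord1 -lead_coefE => /eqP; rewrite lead_coef_eq0 => /eqP p00.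
by have := coef00_neq0; rewrite p00 coef0 eqxx.
Qed.

(** The value p~(0, 0) = 0 is the conjugate of the top coefficient of p, so only - conj p(0, 0)
    remains. *)
Lemma top_coef_difference : q`_n1`_n2 != 0.
Proof.
rewrite !coefB coef_reflection // !subnn top_coef0 sub0r oppr_eq0 conjC_eq0.
exact: coef00_neq0.
Qed.

Lemma size_difference : size q = n1.+1.
Proof.
apply/anti_leq; rewrite bidegree_difference.1 /= ltnNge; apply/negP => h.
by have := top_coef_difference; rewrite [q`_n1]nth_default // coef0 eqxx.
Qed.

Lemma reflection_coef_circle (b : C) i : cmod b = 1 -> (i <= n1)%N ->
  (pt`_i).[b] = b ^+ n2 * ((p`_(n1 - i)).[b])^*.
Proof.
move=> b1 i1; have b0 := neq0_circle ltr01 b1.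
rewrite (horner_coef_wide _ (bidegree_reflection.2 i)).
rewrite (horner_coef_wide _ (bidegree_poly.2 (n1 - i)%N)) rmorph_sum mulr_sumr.
rewrite (reindex_inj rev_ord_inj); apply: eq_bigr => j _ /=.
have jn : (j <= n2)%N by rewrite -ltnS.
rewrite subSS coef_reflection ?leq_subr // subKn // rmorphM rmorphXn /= (conjc_circle b1).
by rewrite mulrCA exprVn expfB_cond ?(negbTE b0) ?add0n // mulrC.
Qed.

Lemma lead_coef_circle (b : C) : cmod b = 1 -> (q`_n1).[b] = - (b ^+ n2 * ((q`_0).[b])^*).
Proof.
move=> b1; have b0 := neq0_circle ltr01 b1.
rewrite !coefB !hornerD !hornerN !reflection_coef_circle // subnn subn0 rmorphB rmorphM /=.
rewrite conjCK rmorphXn /= (conjc_circle b1); move: (_.[b]) (_.[b]^*) => u v.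
by move: (n2) => m; rewrite exprVn; field; rewrite expf_neq0.
Qed.

(** The reflection of q is - q, and b is fixed by inversion in the circle; so the nonzero roots of
    the slice are symmetric with respect to the unit circle. *)
Lemma slice_symmetry (x b : C) : cmod b = 1 -> x != 0 ->
  q.[x, b] = - (x ^+ n1 * b ^+ n2 * (q.[(x^*)^-1, b])^*).
Proof.
move=> b1 x0; have b0 := neq0_circle ltr01 b1.
have cx0 : x^* != 0 by rewrite conjC_eq0.
have bb : (b^*)^-1 = b by rewrite (conjc_circle b1) invrK.
rewrite !hornerD !hornerN !reflectionE ?invr_eq0 // bb !fmorphV /= !conjCK !invrK.
rewrite rmorphB !rmorphM !rmorphXn /= !fmorphV /= !conjCK (conjc_circle b1).
move: (_.[x, b]) (_^*) => u v; move: (n1) (n2) => k m; rewrite !exprVn.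
by field; rewrite !expf_neq0.
Qed.

(** Hurwitz's theorem made explicit: q(., r b) has no zero in the disc for r < 1, and
    [zero_free_ratio] bounds it by a constant times its value at x, uniformly in r. A zero of q(.,
    b) at x would thus annihilate the whole slice. *)
Lemma slice_neq0 (x b : C) : cmod b = 1 -> cmod x < 1 -> q.[x, b] != 0.
Proof.
move=> b1 x1; have q1 : (1 < size q)%N by rewrite size_difference ltnS deg1_gt0.
have Q0 := irreducible_specialize b q_irr q1.
apply: contra_neq Q0 => qx; apply/polyP => i; rewrite coef0.
have bound (c : C) : cmod c < 1 -> q.[c, b] = 0.
  move=> c1; apply/eqP; rewrite -cmod_eq0; apply/eqP/le_anti; rewrite cmod_ge0 andbT.
  pose k := (2 / (1 - cmod x)) ^+ n1.
  have k0 : 0 <= k by rewrite exprn_ge0 // divr_ge0 //; lra.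
  have := rlim_cmod_le (rlim_horner2_r q c b) (rlimM (rlim_cst k%:C%C) (rlim_horner2_r q x b)); rewrite qx mulr0 cmod0; apply => r r01.
  rewrite cmodM cmod_real ger0_norm // -!specializeE; apply: zero_free_ratio => //.
    by rewrite -size_difference; exact: size_specialize.
  move=> a a1; rewrite specializeE; apply: difference_neq0 => //.
  by rewrite cmod_scale ?b1; lra.
suff -> : specialize b q = 0 by rewrite coef0.
apply/eqP/negPn/negP => Q0.
have /(_ [seq ((k.+2)%:R^-1)%:C%C | k <- iota 0 (size (specialize b q))]) := max_poly_roots Q0.
rewrite size_map size_iota ltnn => H; suff : false by [].
apply: H.
  apply/allP => _ /mapP[k _ ->]; rewrite /root specializeE bound //.
  by rewrite cmod_real ger0_norm ?invr_ge0 // invf_lt1 ?ltr1n // ltr0n.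
rewrite map_inj_uniq ?iota_uniq // => k l /complexI /invr_inj /eqP.
by rewrite eqr_nat => /eqP [].
Qed.

Lemma slice_lead_neq0 (b : C) : cmod b = 1 -> (q`_n1).[b] != 0.
Proof.
move=> b1; rewrite lead_coef_circle // oppr_eq0 mulf_neq0 //.
  by rewrite expf_neq0 // (neq0_circle ltr01 b1).
by rewrite conjC_eq0 -horner_coef0 -polyC0 slice_neq0 // cmod0.
Qed.

Lemma slice_root_circle (x b : C) : cmod b = 1 -> q.[x, b] = 0 -> cmod x = 1.
Proof.
move=> b1 qx; apply/eqP; rewrite eq_le; apply/andP; split; rewrite leNgt; apply/negP => x1.
  have x0 : x != 0 by rewrite -cmod_eq0 gt_eqF // (lt_trans ltr01).
  have := slice_symmetry b1 x0; rewrite qx => /esym/eqP; rewrite oppr_eq0 !mulf_eq0 conjC_eq0.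
  rewrite (negbTE (expf_neq0 _ x0)) (negbTE (expf_neq0 _ (neq0_circle ltr01 b1))) /=.
  rewrite (negbTE (slice_neq0 b1 _)) // cmodV cmodJ invf_lt1 //.
  by rewrite (lt_trans ltr01).
by have := slice_neq0 b1 x1; rewrite qx eqxx.
Qed.

End Slices.

(** * A bound at simple roots on the circle *)

Section SimpleRoots.
Variable R : realType.
Local Notation C := R[i].

Lemma cmod_sqr (z : C) : cmod z ^+ 2 = complex.Re z ^+ 2 + complex.Im z ^+ 2.
Proof. by case: z => x y; rewrite sqr_sqrtr // addr_ge0 // sqr_ge0. Qed.

(** The division-free form passes to limits at which the denominator vanishes. *)
Lemma Re_divr_ge0 (x y : C) : (0 <= complex.Re (x / y)) = (0 <= complex.Re (x * y^*)).
Proof.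
have [->|y0] := eqVneq y 0; first by rewrite invr0 conjC0 mulr0.
have -> : x * y^* = (cmod y ^+ 2)%:C%C * (x / y).
  by rewrite -mulcJ; move: (y^*) => w; field.
by rewrite ReM_real pmulr_rge0 // exprn_gt0 // cmod_gt0.
Qed.

(* Approaching the root along [a (1 - e u)], the quotient [N / Q] behaves like
   [N(a) / (- a e u S(a))]. *)
Lemma simple_root_direction (N Q S : {poly C}) (a u : C) : cmod a = 1 ->
  Q = ('X - a%:P) * S ->
  (forall x, cmod x < 1 -> 0 <= complex.Re (N.[x] * Q.[x]^*)) ->
  (forall e : R, 0 < e < 1 -> cmod (1 - e%:C%C * u) < 1) ->
  0 <= complex.Re (N.[a] * (- (a * u * S.[a]))^*).
Proof.
move=> a1 QE NQ ue; pose X (l : C) := a * (1 - (1 - l) * u).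
have dX : cdiff X 1.
  apply: cdiffM; first exact: cdiff_cst.
  apply: cdiffB; first exact: cdiff_cst.
  apply: cdiffM; last exact: cdiff_cst.
  by apply: cdiffB; [exact: cdiff_cst|exact: cdiff_id].
have X1 : X 1 = a by rewrite /X subrr mul0r subr0 mulr1.
have rN : rlim (fun r => N.[X r%:C%C]) N.[a].
  by rewrite -X1; apply: (@rlim_cdiff R (fun l => N.[X l])); exact: cdiff_horner.
have rS : rlim (fun r => - (a * u * S.[X r%:C%C])) (- (a * u * S.[a])).
  rewrite -[in S.[a]]X1; apply: (@rlim_cdiff R (fun l => - (a * u * S.[X l]))).
  by apply: cdiffN; apply: cdiffM; [exact: cdiff_cst|exact: cdiff_horner].
apply: rlim_Re_ge0 (rlimM rN (rlimJ rS)) _ => r r01.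
have Xr : cmod (X r%:C%C) < 1.
  rewrite cmodM a1 mul1r; have := ue (1 - r) ltac:(lra).
  by rewrite rmorphB rmorph1.
have := NQ _ Xr; have -> : Q.[X r%:C%C] = (1 - r)%:C%C * - (a * u * S.[X r%:C%C]).
  by rewrite QE hornerM hornerXsubC {1}/X rmorphB rmorph1 /=; ring.
rewrite rmorphM /= conjcR mulrCA ReM_real pmulr_rge0 //; lra.
Qed.

(** The directions 1 + i and 1 - i, at 45 degrees to the inner normal, together with both signs of
    D, give |Re B| <= Re A and |Im B| <= Re A. The normal direction alone would control only Re
    B. *)
Lemma simple_root_bound (N D Q S : {poly C}) (s : R) (a : C) : cmod a = 1 -> 0 < s ->
  Q = ('X - a%:P) * S -> S.[a] != 0 ->
  (forall x, cmod x < 1 -> 0 <= complex.Re ((N + s%:C%C *: D).[x] * Q.[x]^*)) ->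
  (forall x, cmod x < 1 -> 0 <= complex.Re ((N - s%:C%C *: D).[x] * Q.[x]^*)) ->
  s * cmod D.[a] <= 2 * cmod N.[a].
Proof.
move=> a1 s0 QE Sa HP HM.
have dir (u : C) : complex.Re u = 1 -> complex.Im u ^+ 2 = 1 ->
    forall e : R, 0 < e < 1 -> cmod (1 - e%:C%C * u) < 1.
  move=> u1 u2 e /andP[e0 e1]; rewrite -(@ltr_pXn2r _ 2) ?nnegrE ?cmod_ge0 // expr1n cmod_sqr.
  case: u u1 u2 => x y /= -> y1.
  have -> : (1 - (e * 1 - 0 * y)) ^+ 2 + (0 - (e * y + 0 * 1)) ^+ 2 =
    (1 - e) ^+ 2 + e ^+ 2 * y ^+ 2 by ring.
  by rewrite y1; nra.
pose up : C := (1 +i* 1)%C; pose um : C := (1 +i* -1)%C.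
have dp := dir up erefl ltac:(by rewrite /= expr1n).
have dm := dir um erefl ltac:(by rewrite /= sqrrN expr1n).
have a0 : a != 0 by rewrite (neq0_circle ltr01).
pose W := - (a * S.[a]); have W0 : 0 < cmod W by rewrite cmod_gt0 oppr_eq0 mulf_neq0.
have WE (u : C) : - (a * u * S.[a]) = u * W by rewrite /W; ring.
have := simple_root_direction a1 QE HP dp; have := simple_root_direction a1 QE HP dm.
have := simple_root_direction a1 QE HM dp; have := simple_root_direction a1 QE HM dm.
rewrite !WE !rmorphM /= hornerD hornerN hornerD hornerZ.
set A := N.[a] * W^*; set B := s%:C%C * D.[a] * W^*.
have expand (c d v w : C) : (c + d) * (v * w) = (c * w + d * w) * v by ring.
have expandm (c d v w : C) : (c - d) * (v * w) = (c * w - d * w) * v by ring.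
rewrite !expandm !expand -/A -/B => h1 h2 h3 h4.
have BA : `|complex.Re B| + `|complex.Im B| <= 2 * complex.Re A.
  move: h1 h2 h3 h4; case: (A) (B) => [x y] [v w] /=.
  rewrite !(mulr1, mulrN1, opprK) => h1 h2 h3 h4.
  have : `|v| <= x by rewrite ler_norml; lra.
  have : `|w| <= x by rewrite ler_norml; lra.
  lra.
have cA : complex.Re A <= cmod A by apply: le_trans (ler_norm _) (Re_le_cmod _).
have cB := le_trans (cmod_le_ReIm B) BA.
have : cmod B <= 2 * cmod A by lra.
rewrite /A /B !cmodM cmodJ cmod_real gtr0_norm // [leRHS]mulrA.
by rewrite ler_pM2r.
Qed.

End SimpleRoots.

(** * Domination of polynomials on the unit circle *)

Section CircleDomination.
Variable R : realType.
Local Notation C := R[i].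
Implicit Types F G H : {poly C}.

Definition circle_dominated (K : R) F G :=
  forall b : C, cmod b = 1 -> cmod F.[b] <= K * cmod G.[b].

(* At the root itself the bound is recovered in the limit along the curve
   [b (1 + i (1 - r)) / (1 - i (1 - r))] of the circle. *)
Lemma circle_dominated_cancel (K : R) (b1 : C) F G : 0 <= K ->
  circle_dominated K (('X - b1%:P) * F) (('X - b1%:P) * G) -> circle_dominated K F G.
Proof.
move=> K0 FG; have away (b : C) : cmod b = 1 -> b != b1 -> cmod F.[b] <= K * cmod G.[b].
  move=> b_1 bb; have := FG b b_1; rewrite !hornerM !hornerXsubC !cmodM mulrCA.
  by rewrite ler_pM2l // cmod_gt0 subr_eq0.
move=> b b_1; have [bb|/(away b b_1)//] := eqVneq b b1.
pose X (l : C) := b * ((1 + 'i%C * (1 - l)) / (1 - 'i%C * (1 - l))).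
have X1 : X 1 = b by rewrite /X subrr mulr0 subr0 addr0 divr1 mulr1.
have dlin : cdiff (fun l : C => 'i%C * (1 - l)) 1.
  apply: cdiffM; first exact: cdiff_cst.
  by apply: cdiffB; [exact: cdiff_cst|exact: cdiff_id].
have dX : cdiff X 1.
  apply: cdiffM; first exact: cdiff_cst.
  apply: cdiffM; first by apply: cdiffD; [exact: cdiff_cst|].
  apply: cdiffV; first by rewrite subrr mulr0 subr0 oner_neq0.
  by apply: cdiffB; [exact: cdiff_cst|].
have rl (P : {poly C}) : rlim (fun r => P.[X r%:C%C]) P.[b].
  by rewrite -X1; apply: (@rlim_cdiff R (fun l => P.[X l])); exact: cdiff_horner.
have := rlim_cmod_le (rl F) (rlimM (rlim_cst K%:C%C) (rl G)); rewrite cmodM cmod_real ger0_norm //; apply => r r01.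
rewrite cmodM cmod_real ger0_norm //; set e := 1 - r.
have e0 : 0 < e by rewrite /e; lra.
have XE : X r%:C%C = b * ((1 +i* e) / (1 -i* e))%C.
  rewrite /X -(rmorph1 (real_complex R)) -rmorphB -/e; congr (_ * (_ / _)).
    by apply/eqP; rewrite eq_complex /=; apply/andP; split; apply/eqP; ring.
  by apply/eqP; rewrite eq_complex /=; apply/andP; split; apply/eqP; ring.
have d0 : (1 -i* e)%C != 0 :> C by rewrite eq_complex /= oner_eq0.
apply: away.
  have cE : cmod (1 +i* e)%C = cmod (1 -i* e)%C by rewrite -[RHS]cmodJ /= opprK.
  by rewrite XE !cmodM b_1 mul1r cmodV cE divff // cmod_eq0.
rewrite XE -bb -subr_eq0 -[X in _ - X]mulr1 -mulrBr mulf_neq0 //.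
  by rewrite (neq0_circle ltr01).
rewrite subr_eq0; apply/eqP => h; have := congr1 (fun z => z * (1 -i* e)%C) h.
rewrite mulfVK // mul1r => /eqP; rewrite eq_complex /= eqxx /= => /eqP; lra.
Qed.

(** Meant for H = N(q'): the bound on resultants is first known only where N(q') does not vanish. *)
Lemma circle_dominated_factor (K : R) F G H : 0 <= K -> H != 0 ->
  circle_dominated K (H * F) (H * G) -> circle_dominated K F G.
Proof.
move=> K0 H0; have [s ->] := closed_field_poly_normal H.
have l0 : lead_coef H != 0 by rewrite lead_coef_eq0.
rewrite -!scalerAl => FG.
have {FG} : circle_dominated K (\prod_(z <- s) ('X - z%:P) * F) (\prod_(z <- s) ('X - z%:P) * G).
  by move=> b b1; have := FG b b1; rewrite !(hornerZ (lead_coef H)) !(cmodM (lead_coef H)) mulrCA ler_pM2l ?cmod_gt0.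
elim: s => [|z s IH]; first by rewrite big_nil !mul1r.
by rewrite big_cons -!mulrA => /(circle_dominated_cancel K0).
Qed.

Lemma circle_dominated_dvd (K : R) (s : seq C) F G : 0 <= K ->
  (forall b, b \in s -> cmod b = 1) ->
  circle_dominated K F (\prod_(b <- s) ('X - b%:P) * G) ->
  exists F1, F = \prod_(b <- s) ('X - b%:P) * F1.
Proof.
move=> K0; elim: s F => [|b s IH] F s1 FG; first by exists F; rewrite big_nil mul1r.
have /factor_theorem[F1 FE] : root F b.
  rewrite /root -cmod_eq0 eq_le cmod_ge0 andbT; have := FG b (s1 b (mem_head _ _)).
  by rewrite big_cons !hornerM hornerXsubC subrr !mul0r cmod0 mulr0.
have [|F2 F1E] := IH F1 (fun c cs => s1 c (mem_behead (s := b :: s) cs)).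
  by apply: (circle_dominated_cancel (b1 := b)) => //; move: FG; rewrite big_cons -mulrA FE mulrC.
by exists F2; rewrite FE F1E big_cons mulrC mulrA.
Qed.

End CircleDomination.

(** * Extremality *)

Section Resultant.
Variable R : realType.
Local Notation C := R[i].
Variable p : {poly {poly C}}.
Local Notation pt := (reflection p).
Local Notation n1 := (deg1 p).
Local Notation n2 := (deg2 p).
Local Notation q := (p - pt).
Local Notation N E := (\det (sylvester n1 E q)).
Hypothesis p_neq0 : forall x y : C, cmod x < 1 -> cmod y < 1 -> p.[x, y] != 0.
Hypothesis refl0 : pt.[0, 0] = 0.
Hypothesis q_irr : irreducible_elt q.

Let n1_gt0 : (0 < n1)%N := deg1_gt0 p_neq0 refl0.
Let size_q : size q = n1.+1 := size_difference p_neq0 refl0.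

Lemma resultant_eq0_dvd (E : {poly {poly C}}) : (size E <= n1.+1)%N -> N E = 0 -> exists e, E = q * e.
Proof.
move=> En /(sylvester_det0 size_q En)[U [W [U0 Un UE]]].
by apply: (irreducible_dvd q_irr _ U0 _ UE); rewrite size_q ltnS.
Qed.

(** If q divided p it would also divide p - q = p~ and hence be constant, against n1 > 0. *)
Lemma resultant_neq0 : no_common_factor p pt -> N p != 0.
Proof.
move=> coprime; apply/eqP => /(resultant_eq0_dvd (bidegree_poly p).1)[e pE].
have [] := coprime q; first by exists e; rewrite mulrC.
  by exists (e - 1); rewrite mulrBl mul1r mulrC -pE opprB addrCA subrr addr0.
by move=> c qc; have := size_q; rewrite qc size_polyC; case: (_ != 0); move: n1_gt0; case: (n1).
Qed.

Lemma resultant_circle_roots : no_common_factor p pt -> torus_saturated p ->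
  exists (k : C) (bs : seq C), [/\ k != 0, forall b, b \in bs -> cmod b = 1,
    size bs = (2 * n1 * n2)%N & N p = k *: \prod_(b <- bs) ('X - b%:P)].
Proof.
move=> /resultant_neq0 Np0 sat; have [s sE] := closed_field_poly_normal (N p).
have k0 : lead_coef (N p) != 0 by rewrite lead_coef_eq0.
(* [w] gathers the leading coefficient and the roots off the circle, so it vanishes at no second
   coordinate of a torus point. *)
pose P (b : C) : bool := cmod b == 1; pose w := lead_coef (N p) *: \prod_(b <- [seq b <- s | ~~ P b]) ('X - b%:P).
have NE : N p = \prod_(b <- [seq b <- s | P b]) ('X - b%:P) * w.
  by rewrite {1}sE -scalerAr -big_cat; congr (_ *: _); apply: perm_big; rewrite perm_sym perm_filterC.
have torus1 (z : C * C) : torus z -> cmod z.2 = 1 by move=> [_ /eqc1_cmod].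
have := @esum_multiplicity_le R n1 p q _ w (@torus R) n1_gt0 (bidegree_poly p).1 size_q
  (fun z zT => slice_lead_neq0 p_neq0 refl0 q_irr (torus1 z zT)) NE.
have -> : p - q = pt by rewrite opprB addrCA subrr addr0.
rewrite sat lee_fin ler_nat => count_ge.
have {count_ge} : (2 * n1 * n2 <= size [seq b <- s | P b])%N.
  apply: count_ge => z /torus1 z1; rewrite hornerZ mulf_neq0 // horner_prod.
  rewrite prodf_seq_neq0; apply/allP => b; rewrite mem_filter => /andP[Pb _] /=.
  by rewrite hornerXsubC subr_eq0; apply: contraNneq Pb => <-; rewrite /P z1.
have := size_det_sylvester (bidegree_poly p) (bidegree_difference p).
rewrite {1}sE size_scale // size_prod_XsubC ltnS size_filter => h1 h2.
have h3 := count_size P s; have sz : size s = (2 * n1 * n2)%N by apply/anti_leq; rewrite h1 (leq_trans h2).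
exists (lead_coef (N p)), s; split=> // b bs; apply/eqP.
have : all P s by rewrite all_count eqn_leq h3 sz.
by move/allP; apply.
Qed.

(** The derivative has smaller degree in z1, so q could divide it only if it were 0, which is
    impossible in characteristic 0 with n1 > 0. *)
Lemma deriv_resultant_neq0 : N q^`() != 0.
Proof.
have q'n : (size q^`() <= n1)%N by rewrite -ltnS -size_q lt_size_deriv // -size_poly_gt0 size_q.
apply/eqP => /(resultant_eq0_dvd (leqW q'n))[e qE].
have e0 : e = 0.
  apply/eqP; apply: contraTT q'n => e0; rewrite -ltnNge qE.
  rewrite size_mul // -?size_poly_gt0 ?size_q // addSn /=.
  by rewrite -[X in (X < _)%N]addn0 ltn_add2l size_poly_gt0.
have := congr1 (fun P : {poly {poly C}} => P`_n1.-1) qE; rewrite e0 mulr0 coef0 coef_deriv.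
rewrite prednK // => /eqP; rewrite -mulr_natr mulf_eq0.
have -> : q`_n1 == 0 = false.
  by apply/negbTE; apply: contraNneq (top_coef_difference p_neq0 refl0) => ->; rewrite coef0.
by rewrite /= -polyC_natr polyC_eq0 pnatr_eq0 eqn0Ngt n1_gt0.
Qed.

(** N(q') plays the role of the discriminant: a multiple root of the slice would be a common root
    with the derivative and make it vanish at b. *)
Lemma generic_slice (b : C) : cmod b = 1 -> (N q^`()).[b] != 0 ->
  exists a : 'rV[C]_n1, [/\ \det (Vandermonde n1 a) != 0, forall j, q.[a 0 j, b] = 0 &
    forall x, q.[x, b] = 0 -> exists S : {poly C},
      specialize b q = ('X - x%:P) * S /\ S.[x] != 0].
Proof.
move=> b1 Nb; pose Q := specialize b q.
have lb := slice_lead_neq0 p_neq0 refl0 q_irr b1.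
have sQ : size Q = n1.+1.
  apply/anti_leq; rewrite -{1}size_q size_specialize /=.
  by rewrite ltnNge; apply: contraNN lb => /(nth_default 0); rewrite coef_specialize => ->.
have sQ' : specialize b q^`() = Q^`() by rewrite /specialize deriv_map.
have simple x : root Q x -> ~~ root Q^`() x.
  move=> /rootP Qx; apply/negP => /rootP Q'x; move/eqP: Nb; apply.
  rewrite sylvester_specialize sQ'; apply: (det_sylvester_common_root (a := x)) => //.
    by rewrite -sQ ltnW // lt_size_deriv // -size_poly_gt0 sQ.
  by rewrite sQ.
have [s sE] := closed_field_poly_normal Q.
have l0 : lead_coef Q != 0 by rewrite lead_coef_eq0 -size_poly_gt0 sQ.
have ss : size s = n1 by have := sQ; rewrite sE size_scale // size_prod_XsubC => -[].
have fac x : q.[x, b] = 0 -> exists S : {poly C}, Q = ('X - x%:P) * S /\ S.[x] != 0.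
  rewrite -specializeE => Qx; have rQ : root Q x by apply/rootP.
  have /factor_theorem[S SE] := rQ; exists S; split; first by rewrite mulrC.
  have := simple x rQ; rewrite SE derivM derivXsubC /root hornerD !hornerM hornerXsubC subrr.
  by rewrite mulr0 add0r hornerC mulr1.
have us : uniq s.
  apply: count_mem_uniq => x; have [sx|/count_memPn ->//] := boolP (x \in s).
  have [S [QE Sx]] : exists S : {poly C}, Q = ('X - x%:P) * S /\ S.[x] != 0.
    apply: fac; rewrite -specializeE -/Q sE hornerZ horner_prod (big_rem x) //=.
    by rewrite hornerXsubC subrr mul0r mulr0.
  have SE : S = lead_coef Q *: \prod_(z <- rem x s) ('X - z%:P).
    have lin0 : 'X - x%:P != 0 :> {poly C} by rewrite polyXsubC_eq0.
    by apply: (mulfI lin0); rewrite -QE {1}sE (big_rem x) //= scalerAr.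
  rewrite (permP (perm_to_rem sx)) /= eqxx; apply/eqP; rewrite eqSS.
  apply/eqP/count_memPn; apply: contraNN Sx => rx; rewrite SE hornerZ horner_prod.
  by rewrite (big_rem x) //= hornerXsubC subrr mul0r mulr0.
exists (\row_j s`_j); split=> //.
  rewrite det_Vandermonde; apply/prodf_neq0 => i _; apply/prodf_neq0 => j ij.
  rewrite !mxE subr_eq0 nth_uniq ?ss //; by rewrite gtn_eqF.
move=> j; rewrite mxE -specializeE -/Q sE hornerZ horner_prod.
have js : s`_j \in s by rewrite mem_nth // ss.
by rewrite (big_rem _ js) /= hornerXsubC subrr mul0r mulr0.
Qed.

(** By the product formula N(E)(b) and N(p)(b) are products over the same n1 roots with the same
    leading factor, so they are compared factor by factor. *)
Lemma generic_resultant_bound (b : C) (M : R) (E : {poly {poly C}}) : cmod b = 1 ->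
  (N q^`()).[b] != 0 -> (size E <= n1.+1)%N ->
  (forall x, q.[x, b] = 0 -> cmod E.[x, b] <= M * cmod p.[x, b]) ->
  cmod (N E).[b] <= M ^+ n1 * cmod (N p).[b].
Proof.
move=> b1 Nb En EM; have [a [V0 aQ _]] := generic_slice b1 Nb.
have sp (F : {poly {poly C}}) : (size F <= n1.+1)%N -> (size (specialize b F) <= n1.+1)%N.
  exact/leq_trans/size_specialize.
have NE (F : {poly {poly C}}) : (size F <= n1.+1)%N ->
    (N F).[b] = \prod_(j < n1) F.[a 0 j, b] * (specialize b q)`_n1 ^+ n1.
  move=> Fn; rewrite sylvester_specialize; apply: (mulIf V0).
  rewrite det_sylvester_roots ?sp ?size_q //; last by move=> j; rewrite specializeE.
  rewrite -mulrA mulrC; congr (_ * _ * _); apply: eq_bigr => j _.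
  by rewrite specializeE.
rewrite !NE ?(bidegree_poly p).1 // !cmodM mulrA ler_wpM2r ?cmod_ge0 // !cmod_prod.
rewrite -[in M ^+ _](card_ord n1) -prodr_const -big_split /=.
by apply: ler_prod => j _; rewrite cmod_ge0 EM.
Qed.

End Resultant.

(** * Vanishing of the numerator D and conclusion *)

Section Extremality.
Variable R : realType.
Local Notation C := R[i].
Variable p : {poly {poly C}}.
Local Notation pt := (reflection p).
Local Notation n1 := (deg1 p).
Local Notation n2 := (deg2 p).
Local Notation q := (p - pt).
Local Notation N E := (\det (sylvester n1 E q)).
Hypothesis p_neq0 : forall x y : C, cmod x < 1 -> cmod y < 1 -> p.[x, y] != 0.
Hypothesis refl0 : pt.[0, 0] = 0.
Hypothesis q_irr : irreducible_elt q.

Lemma horner2D (P Q : {poly {poly C}}) (x y : C) : (P + Q).[x, y] = P.[x, y] + Q.[x, y].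
Proof. by rewrite !hornerD. Qed.

Lemma horner2B (P Q : {poly {poly C}}) (x y : C) : (P - Q).[x, y] = P.[x, y] - Q.[x, y].
Proof. by rewrite !hornerD !hornerN. Qed.

Lemma horner2Z (k : C) (P : {poly {poly C}}) (x y : C) :
  (k%:P *: P).[x, y] = k * P.[x, y].
Proof. by rewrite hornerZ hornerM hornerC. Qed.

(** The left side is (|p| - |p~|) (|p| + |p~|); the first factor vanishes on the torus and varies by
    a multiple of 1 - r along radii. *)
Lemma defect_radial : exists2 K : R, 0 < K & forall (r : R) (x y : C), 0 < r < 1 ->
  cmod x = r -> cmod y = r ->
  cmod q.[x, y] ^+ 2 * complex.Re ((p + pt).[x, y] / q.[x, y]) <= K * (1 - r).
Proof.
have [K K0 HK] := horner2_radial p; have [L L0 HL] := horner2_radial pt.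
have [B B0 HB] := horner2_bounded p; have [D D0 HD] := horner2_bounded pt.
exists ((K + L) * (B + D)) => [|r x y r01 xr yr]; first by rewrite mulr_gt0 ?addr_gt0.
have /andP[r0 r1] := r01; have rC := neq0C r0.
have [x1 y1] : cmod x < 1 /\ cmod y < 1 by rewrite xr yr.
have unit (z : C) : cmod z = r -> cmod (z / r%:C%C) = 1 /\ z = r%:C%C * (z / r%:C%C).
  move=> zr; rewrite cmodM cmodV zr cmod_real gtr0_norm // divff ?gt_eqF //.
  by rewrite mulrC divfK.
have [u1 xE] := unit x xr; have [v1 yE] := unit y yr.
rewrite Re_cayley ?difference_neq0 // mulrC divfK; last first.
  by rewrite expf_eq0 /= cmod_eq0 difference_neq0.
have := HK _ _ r u1 v1 ltac:(by rewrite !ltW); have := HL _ _ r u1 v1 ltac:(by rewrite !ltW).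
rewrite -xE -yE; have := cmod_reflection_torus p u1 v1.
have := HB x y (ltW x1) (ltW y1); have := HD x y (ltW x1) (ltW y1).
have := reflection_le p_neq0 x1 y1; have := cmod_ge0 pt.[x, y].
set a := p.[x, y]; set b := pt.[x, y]; set c := p.[_, _]; set d := pt.[_, _].
have := cmodD (a - c) c; rewrite subrK; have := cmodD (d - b) b; rewrite subrK -[cmod (d - b)]cmodN opprB.
move: (cmod (a - c)) (cmod (b - d)) (cmod a) (cmod b) (cmod c) (cmod d) => ac bd a' b' c' d'.
move: r01 K0 L0 B0 D0; clear => /andP[r0 r1] K0 L0 B0 D0 h1 h2 b0 ba bD aB dc h3 h4.
have s1 : a' - b' <= (K + L) * (1 - r) by lra.
have s2 : a' + b' <= B + D by lra.
rewrite subr_sqr [leRHS]mulrAC; apply: ler_pM; lra.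
Qed.

Lemma exists_generic : no_common_factor p pt ->
  exists b : C, [/\ cmod b = 1, (N q^`()).[b] != 0 & (N p).[b] != 0].
Proof.
move=> coprime; have := mulf_neq0 (deriv_resultant_neq0 p_neq0 refl0 q_irr)
  (resultant_neq0 p_neq0 refl0 q_irr coprime).
move=> /eqP h; apply: contra_notP h => h; apply: circle_vanish => b b1.
apply/eqP; apply: contra_notT h; rewrite hornerM mulf_eq0 negb_or => /andP[h1 h2].
by exists b.
Qed.

(** q attains degree n1 in z1, and its top coefficient attains degree n2, which leaves no room for a
    nonconstant quotient. *)
Lemma bidegree_quotient (E e : {poly {poly C}}) : bidegree_le n1 n2 E -> E = q * e ->
  exists k : C, E = k%:P *: q.
Proof.
move=> [E1 E2] EE; have sq := size_difference p_neq0 refl0.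
have q0 : q != 0 by rewrite -size_poly_gt0 sq.
have [e0|e0] := eqVneq e 0; first by exists 0; rewrite EE e0 mulr0 polyC0 scale0r.
have /size_poly1P[d d0 eE] : size e == 1%N.
  rewrite eqn_leq size_poly_gt0 e0 andbT; move: E1; rewrite EE size_mul // sq addSn /=.
  by rewrite -addn1 leq_add2l.
have top : q`_n1 != 0.
  by apply: contraNneq (top_coef_difference p_neq0 refl0) => ->; rewrite coef0.
have stop : size q`_n1 = n2.+1.
  apply/anti_leq; rewrite (bidegree_difference p).2 /= ltnNge; apply/negP => h.
  by have := top_coef_difference p_neq0 refl0; rewrite [(q`_n1)`_n2]nth_default // eqxx.
have /size_poly1P[k k0 dE] : size d == 1%N.
  rewrite eqn_leq size_poly_gt0 d0 andbT; have := E2 n1; rewrite EE eE coefMC size_mul //.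
  by rewrite stop addSn /= -addn1 leq_add2l.
by exists k; rewrite EE eE dE -mul_polyC mulrC.
Qed.

Lemma slice_Re_ge0 (P : {poly {poly C}}) (b x : C) :
  (forall x y, cmod x < 1 -> cmod y < 1 -> 0 <= complex.Re (P.[x, y] / q.[x, y])) ->
  cmod b = 1 -> cmod x < 1 -> 0 <= complex.Re (P.[x, b] * q.[x, b]^*).
Proof.
move=> HP b1 x1.
apply: rlim_Re_ge0 (rlimM (rlim_horner2_r P x b) (rlimJ (rlim_horner2_r q x b))) _ => r r01.
by rewrite -Re_divr_ge0; apply: HP => //; rewrite cmod_scale ?b1; lra.
Qed.

Lemma torus_Re_ge0 (P : {poly {poly C}}) (x y : C) :
  (forall x y, cmod x < 1 -> cmod y < 1 -> 0 <= complex.Re (P.[x, y] / q.[x, y])) ->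
  cmod x = 1 -> cmod y = 1 -> 0 <= complex.Re (P.[x, y] * q.[x, y]^*).
Proof.
move=> HP x1 y1.
apply: rlim_Re_ge0 (rlimM (rlim_horner2_l P x y) (rlimJ (rlim_horner2_l q x y))) _ => r r01.
by apply: slice_Re_ge0 => //; rewrite cmod_scale ?x1; lra.
Qed.

(* On the torus the real part of [c * pt / q] vanishes, which forces
   [conj c * p = c * pt]. *)
Lemma multiple_of_reflection_eq0 (s : R) (c : C) : 0 < s ->
  (forall x y, cmod x < 1 -> cmod y < 1 ->
     0 <= complex.Re ((p + pt + (s%:C%C * c)%:P *: pt).[x, y] / q.[x, y])) ->
  (forall x y, cmod x < 1 -> cmod y < 1 ->
     0 <= complex.Re ((p + pt - (s%:C%C * c)%:P *: pt).[x, y] / q.[x, y])) ->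
  c = 0.
Proof.
move=> s0 HP HM; have q0 : q != 0.
  by rewrite -size_poly_gt0 (size_difference p_neq0 refl0).
suff : q * (c^*%:P *: p - c%:P *: pt) = 0.
  move=> /eqP; rewrite mulf_eq0 (negbTE q0) subr_eq0 /= => /eqP E.
  have := congr1 (fun P : {poly {poly C}} => P.[0, 0]) E; rewrite !horner2Z refl0 mulr0.
  move=> /eqP; rewrite mulf_eq0 conjC_eq0 orbC (negbTE (p_neq0 _ _)) ?cmod0 // => /eqP.
  by [].
apply: torus_vanish => x y x1 y1.
have := torus_Re_ge0 HP x1 y1; have := torus_Re_ge0 HM x1 y1.
have xy : (x ^+ n1 * y ^+ n2)^* * (x ^+ n1 * y ^+ n2) = 1.
  by rewrite mulrC mulcJ cmodM !cmodX x1 y1 !expr1n mulr1 expr1n.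
rewrite 2!hornerM -/(q.[x, y]) (horner2B (_ *: _)) !(horner2B _ (_ *: _)) horner2D.
rewrite (horner2D (p + pt)) (horner2D p pt) !horner2B !horner2Z reflection_torus //.
move: (x ^+ n1 * y ^+ n2) xy => m mm; move: (p.[x, y]) => a.
rewrite -!mulrA; set B := m * a^*; have mB : m * B^* = a.
  by rewrite /B rmorphM /= conjCK mulrA [m * _]mulrC mm mul1r.
have BB : B * B^* = a * a^*.
  by rewrite {1}/B [m * _]mulrC -mulrA mB mulrC.
have BE : m * a^* = B by [].
(* Here a = p and B = p~ at a torus point, so Z = c p~ conj q. Multiplication by the unimodular m
   turns conjugates into reflections, and Re Z = 0 becomes the vanishing of q (conj c p - c p~). *)
clearbody B; pose Z := c * B * (a - B)^*.
have ZE : m * (Z + Z^*) = (a - B) * (c^* * a - c * B).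
  rewrite /Z !rmorphM !rmorphB /= !conjCK.
  have -> : m * (c * B * (a^* - B^*) + c^* * B^* * (a - B)) =
    c * (m * a^*) * B - c * B * (m * B^*) + c^* * (m * B^*) * (a - B) by ring.
  by rewrite mB BE; ring.
have Re0 : complex.Re ((a + B) * (a - B)^*) = 0.
  have -> : (a + B) * (a - B)^* = (a * a^* - B * B^*) + (B * a^* - (B * a^*)^*).
    by rewrite rmorphB rmorphM /= conjCK; ring.
  by rewrite BB subrr add0r ReB ReJ subrr.
have E1 : (a + B - s%:C%C * (c * B)) * (a - B)^* = (a + B) * (a - B)^* - s%:C%C * Z.
  by rewrite /Z; ring.
have E2 : (a + B + s%:C%C * (c * B)) * (a - B)^* = (a + B) * (a - B)^* + s%:C%C * Z.
  by rewrite /Z; ring.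
rewrite E1 E2 ReB ReD !ReM_real Re0 => h1 h2; rewrite -ZE addcJ2.
have /eqP : s * complex.Re Z = 0 by apply/le_anti; rewrite -oppr_ge0 -[- _]add0r h1 -[s * _]add0r h2.
by rewrite mulf_eq0 gt_eqF //= => /eqP ->; rewrite mulr0 rmorph0 mulr0.
Qed.


Lemma numerator_eq0 (D : {poly {poly C}}) (s : R) : no_common_factor p pt -> torus_saturated p ->
  0 < s -> bidegree_le n1 n2 D -> D.[0, 0] = 0 ->
  (forall x y, cmod x < 1 -> cmod y < 1 ->
     0 <= complex.Re ((p + pt + s%:C%C%:P *: D).[x, y] / q.[x, y])) ->
  (forall x y, cmod x < 1 -> cmod y < 1 ->
     0 <= complex.Re ((p + pt - s%:C%C%:P *: D).[x, y] / q.[x, y])) ->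
  D = 0.
Proof.
move=> coprime sat s0 Dn D00 HP HM.
have n1_gt0 := deg1_gt0 p_neq0 refl0; have sq := size_difference p_neq0 refl0.
have p00 := p_neq0 (x := 0) (y := 0); rewrite cmod0 in p00.
have {}p00 := p00 ltr01 ltr01.
have [b0 [b01 Nq' Np]] := exists_generic coprime.
have [a [_ aQ _]] := generic_slice p_neq0 refl0 q_irr b01 Nq'.
set a0 := a 0 (Ordinal n1_gt0); have a0Q : q.[a0, b0] = 0 := aQ _.
have sp (F : {poly {poly C}}) : (size F <= n1.+1)%N -> (size (specialize b0 F) <= n1.+1)%N.
  exact/leq_trans/size_specialize.
have common (F : {poly {poly C}}) : (size F <= n1.+1)%N -> F.[a0, b0] = 0 -> (N F).[b0] = 0.
  move=> Fn Fa; rewrite sylvester_specialize.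
  by apply: (det_sylvester_common_root (a := a0)); rewrite ?specializeE ?sp ?sq.
have pa0 : p.[a0, b0] != 0.
  by apply: contra_neq Np => /common ->; rewrite ?(bidegree_poly p).1.
(* Then N(E) vanishes at b0 and N(p) does not, which forces the constant quotient of the two to be
   0. *)
pose c := D.[a0, b0] / p.[a0, b0]; pose E := D - c%:P *: p.
have bZ k (P : {poly {poly C}}) : bidegree_le n1 n2 P -> bidegree_le n1 n2 (k%:P *: P).
  move=> [P1 P2]; split=> [|i]; first exact: leq_trans (size_scale_leq _ _) P1.
  by rewrite coefZ mul_polyC; exact: leq_trans (size_scale_leq _ _) (P2 i).
have En : bidegree_le n1 n2 E by apply: bidegreeB => //; apply: bZ; exact: bidegree_poly.
have Ea0 : E.[a0, b0] = 0 by rewrite horner2B horner2Z divfK // subrr.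
(* At a zero of q one has p~ = p, so s |D| <= 2 |p + p~| = 4 |p|; the term |c| pays for the shift by
   c p. *)
pose M := 4 / s + cmod c.
have M0 : 0 <= M by rewrite addr_ge0 ?cmod_ge0 // divr_ge0 // ltW.
have bound b : cmod b = 1 -> (N q^`()).[b] != 0 -> forall x, q.[x, b] = 0 ->
    cmod E.[x, b] <= M * cmod p.[x, b].
  move=> b1 Nb x qx; have [_ [_ _ /(_ x qx)[S [QE Sx]]]] := generic_slice p_neq0 refl0 q_irr b1 Nb.
  have x1 := slice_root_circle p_neq0 refl0 q_irr b1 qx.
  have spZ k P : specialize b (k%:P *: P) = k *: specialize b P by rewrite specializeZ hornerC.
  have spD P Q : specialize b (P + Q) = specialize b P + specialize b Q by exact: rmorphD.
  have spB P Q : specialize b (P - Q) = specialize b P - specialize b Q by exact: rmorphB.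
  have := simple_root_bound (N := specialize b (p + pt)) (D := specialize b D) x1 s0 QE Sx.
  rewrite -spZ -spD -spB !specializeE => H.
  have {}H : s * cmod D.[x, b] <= 2 * cmod (p + pt).[x, b].
    by apply: H => z z1; rewrite !specializeE; apply: slice_Re_ge0.
  have ptx : pt.[x, b] = p.[x, b].
    by move: qx => /eqP; rewrite horner2B subr_eq0 => /eqP.
  rewrite horner2B horner2Z; apply: le_trans (cmodB _ _) _.
  rewrite mulrDl -cmodM lerD2r mulrAC ler_pdivlMr // mulrC.
  have ppt : cmod (p + pt).[x, b] = 2 * cmod p.[x, b].
    rewrite horner2D ptx -(cmod_nat R 2) -cmodM; congr cmod; move: (p.[x, b]) => u; ring.
  by move: H; rewrite ppt mulrA -natrM.
have [k [bs [k0 bs1 sbs NpE]]] := resultant_circle_roots p_neq0 refl0 q_irr coprime sat.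
have M1 : 0 <= M ^+ n1 by rewrite exprn_ge0.
have dom : circle_dominated (M ^+ n1) (N E) (N p).
  apply: (circle_dominated_factor M1 (deriv_resultant_neq0 p_neq0 refl0 q_irr)) => b b1.
  rewrite !hornerM !cmodM mulrCA; have [->|Nb] := eqVneq (N q^`()).[b] 0.
    by rewrite cmod0 !mul0r.
  rewrite ler_wpM2l ?cmod_ge0 //.
  exact: (generic_resultant_bound p_neq0 refl0 q_irr b1 Nb En.1 (bound b b1 Nb)).
have NE0 : N E = 0.
  have [F FE] : exists F, N E = \prod_(b <- bs) ('X - b%:P) * F.
    apply: (circle_dominated_dvd (G := k%:P) M1 bs1).
    by rewrite mulrC mul_polyC -NpE.
  have sNE := size_det_sylvester En (bidegree_difference p).
  have pr0 : \prod_(b <- bs) ('X - b%:P) != 0 :> {poly C} := monic_neq0 (monic_prod_XsubC _ _ _).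
  have [F0|F0] := eqVneq F 0; first by rewrite FE F0 mulr0.
  have /size_poly1P[l l0 lE] : size F == 1%N.
    rewrite eqn_leq size_poly_gt0 F0 andbT; move: sNE; rewrite FE size_mul //.
    by rewrite size_prod_XsubC sbs addSn /= -[(2 * n1 * n2).+1]addn1 leq_add2l.
  have := common E En.1 Ea0; rewrite FE lE hornerM hornerC => /eqP.
  rewrite mulf_eq0 (negbTE l0) orbF => /eqP prb0.
  by move: Np; rewrite NpE hornerZ prb0 mulr0 eqxx.
have [e eE] := resultant_eq0_dvd p_neq0 refl0 q_irr En.1 NE0.
have [l lE] := bidegree_quotient En eE.
(* Evaluation at the origin, where D and p~ vanish and q equals p. *)
have lc : l = - c.
  have := congr1 (fun P : {poly {poly C}} => P.[0, 0]) lE.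
  rewrite horner2B !horner2Z horner2B D00 refl0 subr0 sub0r -mulNr.
  by move=> /(mulIf p00).
have DE : D = c%:P *: pt.
  have -> : D = E + c%:P *: p by rewrite subrK.
  by rewrite lE lc polyCN scaleNr scalerBr; ring.
suff c0 : c = 0 by rewrite DE c0 polyC0 scale0r.
by apply: (multiple_of_reflection_eq0 s0) => x y x1 y1;
  rewrite polyCM -scalerA -DE; [exact: HP|exact: HM].
Qed.

End Extremality.

Theorem theorem1p5 (R : realType) (p : {poly {poly R[i]}})
  (p_stable : scattering_stable p)
  (refl0 : (reflection p).[0, 0] = 0)
  (p_saturated : torus_saturated p)
  (p_irr : irreducible_elt (p - reflection p)) :
  extreme_point_PRP2
    (fun z : R[i] * R[i] =>
       (p + reflection p).[z.1, z.2] / (p - reflection p).[z.1, z.2]).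
Proof.
have [p_disk coprime] := p_stable.
have disk (x y : R[i]) : cmod x < 1 -> cmod y < 1 -> bidisk (x, y).
  by rewrite -!ltc1_cmod.
have p_neq0 (x y : R[i]) : cmod x < 1 -> cmod y < 1 -> p.[x, y] != 0.
  by move=> x1 y1; exact: p_disk (disk x y x1 y1).
split; first exact: cayley_PRP2.
move=> g h t gP hP t01 fE; have /andP[t0 t1] := t01.
pose q := p - reflection p; pose f (z : R[i] * R[i]) := (p + reflection p).[z.1, z.2] / q.[z.1, z.2].
rewrite -/q in p_irr; have {}fE z : bidisk z -> f z = t%:C%C * g z + (1 - t)%:C%C * h z by exact: fE.
suff: forall z, bidisk z -> g z = f z /\ h z = f z by [].
have fP : PRP2 f by exact: cayley_PRP2.
have [df Ref f0] := fP; have [dg Reg g0] := gP; have [dh Reh h0] := hP.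
have q_neq0 (x y : R[i]) : cmod x < 1 -> cmod y < 1 -> q.[x, y] != 0.
  by move=> x1 y1; exact: difference_neq0.
have ReE z : bidisk z -> complex.Re (f z) = t * complex.Re (g z) + (1 - t) * complex.Re (h z).
  by move=> /fE ->; rewrite ReD !ReM_real.
have [K K0 HK] := defect_radial p_neq0 refl0.
have [P Pn PE] : exists2 P, bidegree_le (deg1 p) (deg2 p) P &
    forall x y : R[i], cmod x < 1 -> cmod y < 1 -> P.[x, y] = q.[x, y] * g (x, y).
  apply: (polynomial_of_dominated (bidegree_difference p) _ _ f0 t0 K0) => //.
  - by move=> x y x1 y1; apply: df; exact: disk.
  - by move=> x y x1 y1; apply: dg; exact: disk.
  - move=> x y x1 y1; have d := disk x y x1 y1; rewrite ReE // (ltW (Reg _ d)).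
    by rewrite lerDl mulr_ge0 ?subr_ge0 ?(ltW t1) ?(ltW (Reh _ d)).
pose D := P - (p + reflection p).
have Dn : bidegree_le (deg1 p) (deg2 p) D.
  have [r1 r2] := bidegree_reflection p.
  rewrite /D opprD addrA; apply: bidegreeB; last by split.
  by apply: bidegreeB => //; exact: bidegree_poly.
have DE (x y : R[i]) : cmod x < 1 -> cmod y < 1 -> D.[x, y] = q.[x, y] * (g (x, y) - f (x, y)).
  move=> x1 y1; rewrite horner2B PE // mulrBr; congr (_ - _).
  by rewrite /f /= mulrC divfK // q_neq0.
have D00 : D.[0, 0] = 0 by rewrite DE ?cmod0 // g0 f0 subrr mulr0.
have D0 : D = 0.
  (* The value s = t serves both signs because t (g - f) = (1 - t) (f - h): the two quotients are (1
     - t) f + t g and t f + (1 - t) h. *)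
  apply: (numerator_eq0 p_neq0 refl0 p_irr coprime p_saturated t0 Dn D00) => x y x1 y1;
    have d := disk x y x1 y1; have qxy := q_neq0 x y x1 y1.
  - have -> : (p + reflection p + t%:C%C%:P *: D).[x, y] / q.[x, y] =
        (1 - t)%:C%C * f (x, y) + t%:C%C * g (x, y).
      rewrite horner2D horner2Z DE // mulrDl -/(f (x, y)) mulrCA [q.[x, y] * _]mulrC mulfK //.
      by rewrite rmorphB rmorph1; ring.
    by rewrite ReD !ReM_real addr_ge0 // mulr_ge0 ?subr_ge0 ?(ltW t0) ?(ltW t1) ?(ltW (Ref _ d)) ?(ltW (Reg _ d)).
  - have -> : (p + reflection p - t%:C%C%:P *: D).[x, y] / q.[x, y] =
        t%:C%C * f (x, y) + (1 - t)%:C%C * h (x, y).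
      rewrite horner2B horner2Z DE // mulrBl -/(f (x, y)) mulrCA [q.[x, y] * _]mulrC mulfK //.
      by rewrite [X in X - _]fE // rmorphB rmorph1; ring.
    by rewrite ReD !ReM_real addr_ge0 // mulr_ge0 ?subr_ge0 ?(ltW t0) ?(ltW t1) ?(ltW (Ref _ d)) ?(ltW (Reh _ d)).
move=> [x y] d; have [x1 y1] : cmod x < 1 /\ cmod y < 1 by rewrite -!ltc1_cmod.
have gf : g (x, y) = f (x, y).
  have := DE x y x1 y1; rewrite D0 !horner0 => /esym/eqP.
  by rewrite mulf_eq0 (negbTE (q_neq0 x y x1 y1)) subr_eq0 => /eqP.
split=> //; have := fE _ d; rewrite gf => E.
have t1C : (1 - t)%:C%C != 0 :> R[i] by apply: neq0C; rewrite subr_gt0.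
apply: (mulfI t1C); apply: (addrI (t%:C%C * f (x, y))); rewrite -E.
by rewrite rmorphB rmorph1; ring.
Qed.
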